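(* Let $\mathcal{L}$ be a lattice in $\mathbb{R}^d$, $d\ge 1$, and let $\mathbf{p}=\{p_i, i\in\mathcal{L}\}$ be a strictly stationary random field with values in $\mathbb{R}^d$ such that there exist real numbers $s>0$ and $q\ge d$ with $1/s+1/q=1$, $\mathbb{E}|p_0|^q<\infty$ and $$\sum_{i\in\mathcal{L}}\alpha_{1,1}^{1/s}(|i|)<\infty,$$ where $\alpha_{1,1}$ is the strong mixing coefficient of $\mathbf{p}$. Then the corresponding perturbed lattice $\Xi=\sum_{i\in\mathcal{L}}\delta_{i+p_i+U}$ is hyperuniform. If, moreover, the law of $p_0$ is symmetric and $\mathbb{E}|p_0|^{2q}<\infty$, then $\Xi$ is class-I hyperuniform.
   Context: A lattice $\mathcal{L}\subset\mathbb{R}^d$ is the set of all integer linear combinations of a basis $(a_1,\dots,a_d)$ of $\mathbb{R}^d$; its fundamental domain is $\mathcal{D}=\{\sum_{j=1}^d t_ja_j:\ (t_1,\dots,t_d)\in[0,1)^d\}$. $|\cdot|$ is the Euclidean norm, $\lambda^d$ is Lebesgue measure, and $B_r$ is the closed Euclidean ball of radius $r$ centered at $0$. A random field $\{p_i,i\in\mathcal{L}\}$ of $\mathbb{R}^d$-valued random vectors is strictly stationary if $\{p_i,i\in\Lambda\}$ and $\{p_{i+j},i\in\Lambda\}$ have the same distribution for all $\Lambda\subset\mathcal{L}$ and $j\in\mathcal{L}$. The corresponding perturbed lattice is the stationary random counting measure $\Xi=\sum_{i\in\mathcal{L}}\delta_{i+p_i+U}$, where $U$ is uniformly distributed on $\mathcal{D}$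 and independent of $\mathbf{p}$. Mixing coefficients: for two sub-$\sigma$-fields $\mathcal{A}_1,\mathcal{A}_2$, $\alpha(\mathcal{A}_1,\mathcal{A}_2)=\sup\{|\mathbb{P}(A\cap B)-\mathbb{P}(A)\mathbb{P}(B)|:\ A\in\mathcal{A}_1,\ B\in\mathcal{A}_2\}$. For $C\subset\mathcal{L}$, $\sigma(p_C)$ is the $\sigma$-field generated by $\{p_i,i\in C\}$. For $n\geq 0$, $$\alpha_{1,1}(n)=\sup\{\alpha(\sigma(p_A),\sigma(p_B)):\ A,B\subset\mathcal{L},\ |A|\le 1,\ |B|\le 1,\ d_{\mathcal{L}}(A,B)\ge n\},$$ where here $|A|,|B|$ denote cardinalities and $d_{\mathcal{L}}(A,B)=\inf\{|i-j|:\ i\in A,\ j\in B\}$. A stationary point process $\mu$ on $\mathbb{R}^d$ is hyperuniform if $\sigma(r):=\mathrm{Var}(\mu(B_r))/\lambda^d(B_r)\to 0$ as $r\to\infty$. It is class-I hyperuniform if $\sigma(r)=O(r^{-1})$ as $r\to\infty$, i.e. $\mathrm{Var}(\mu(B_r))=O(r^{d-1})$. *)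

(* Defs.v *)
From mathcomp Require Export all_boot all_order all_algebra.
From mathcomp Require Export all_classical all_reals all_analysis.
Export numFieldNormedType.Exports.
Export Order.TTheory GRing.Theory Num.Theory.

Set Implicit Arguments.
Unset Strict Implicit.
Unset Printing Implicit Defensive.

Local Open Scope classical_set_scope.
Local Open Scope ring_scope.

Section euclidean_space.
Context {R : realType} {d : nat}.

(* The norm `|x| that the library puts on 'rV[R]_d is the sup norm. *)
Definition enorm (x : 'rV[R]_d) : R := Num.sqrt (\sum_(k < d) x 0 k ^+ 2).

Definition eball (r : R) : set 'rV[R]_d := [set x | enorm x <= r].

End euclidean_space.

(* R^d with its Borel sigma-algebra. *)
Notation borelV R d := (g_sigma_algebraType (@open 'rV[R]_d)).
Notation borel R d := (@measurable _ (borelV R d)).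

(* lambda^0 is the unit mass on the one-point space R^0, and lambda^(d+1) is
   the product of lambda and lambda^d, under R^(d+1) = R * R^d. *)
Fixpoint lebesgueV (R : realType) (d : nat) : set 'rV[R]_d -> \bar R :=
  match d with
  | 0 => @dirac _ (borelV R 0) 0 R
  | n.+1 => fun B =>
      (@product_measure1 _ _ _ (borelV R n) R (@lebesgue_measure R)
         (@lebesgueV R n))
      [set x | B (row_mx (x.1)%:M x.2 : 'rV[R]_(1 + n))]
  end.

Section lattice.
Context {R : realType} {d : nat} (a : d.-tuple 'rV[R]_d).

Definition lattice : set 'rV[R]_d :=
  [set x | exists k : 'I_d -> int, x = \sum_(j < d) (k j)%:~R *: tnth a j].

Definition fundamental_domain : set 'rV[R]_d :=
  [set x | exists t : 'I_d -> R, (forall j, 0 <= t j < 1) /\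
                                 x = \sum_(j < d) t j *: tnth a j].

End lattice.

Section sigma_fields.
Context {R : realType} {d : nat}.

(* The sigma-field on T generated by the R^d-valued maps X i, i in C. *)
Definition sigma_gen {T I : Type} (C : set I) (X : I -> T -> 'rV[R]_d) :
    set (set T) :=
  <<s \bigcup_(i in C) preimage_set_system setT (X i) (borel R d) >>.

End sigma_fields.

Section random_vectors.
Context {disp : measure_display} {T : measurableType disp} {R : realType}
        {d : nat} (P : probability T R).
Local Open Scope ereal_scope.

Definition random_vector (X : T -> 'rV[R]_d) : Prop :=
  @measurable_fun _ _ T (borelV R d) setT X.

Definition uniform_on (D : set 'rV[R]_d) (X : T -> 'rV[R]_d) : Prop :=
  forall B, borel R d B -> P (X @^-1` B) = lebesgueV (B `&` D) / lebesgueV D.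

Definition symmetric_law (X : T -> 'rV[R]_d) : Prop :=
  forall B, borel R d B -> P [set w | B (- X w)%R] = P (X @^-1` B).

Definition independent (A1 A2 : set (set T)) : Prop :=
  forall A B, A1 A -> A2 B -> P (A `&` B) = P A * P B.

(* A random field on L is a total function of which only the values at sites of
   L are used.  The laws of {p_i, i in Lam} and {p_(i+j), i in Lam} are compared
   on the product sigma-field generated by the coordinates in Lam. *)
Definition strictly_stationary (L : set 'rV[R]_d)
    (p : 'rV[R]_d -> T -> 'rV[R]_d) : Prop :=
  forall (Lam : set 'rV[R]_d) (j : 'rV[R]_d), Lam `<=` L -> L j ->
  forall E : set ('rV[R]_d -> 'rV[R]_d),
    sigma_gen Lam (fun i (f : 'rV[R]_d -> 'rV[R]_d) => f i) E ->
    P [set w | E (fun i => p i w)] = P [set w | E (fun i => p (i + j)%R w)].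

Definition alpha (A1 A2 : set (set T)) : \bar R :=
  ereal_sup [set `|P (A `&` B) - P A * P B| | A in A1 & B in A2].

(* Equal to +oo when A or B is empty. *)
Definition dist (A B : set 'rV[R]_d) : \bar R :=
  ereal_inf [set (enorm (i - j)%R)%:E | i in A & j in B].

Definition alpha11 (L : set 'rV[R]_d) (p : 'rV[R]_d -> T -> 'rV[R]_d) (n : R) :
    \bar R :=
  ereal_sup [set x | exists A B : set 'rV[R]_d,
    [/\ A `<=` L, B `<=` L, (A #<= `I_1)%card, (B #<= `I_1)%card &
        n%:E <= dist A B /\ x = alpha (sigma_gen A p) (sigma_gen B p)]].

(* The counting measure \sum_(i in L) delta_(i + p_i + U), whose values may be
   infinite. *)
Definition perturbed_lattice (L : set 'rV[R]_d)
    (p : 'rV[R]_d -> T -> 'rV[R]_d) (U : T -> 'rV[R]_d) (w : T)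
    (B : set 'rV[R]_d) : \bar R :=
  \esum_(i in L) @dirac _ (borelV R d) (i + p i w + U w)%R R B.

(* The library's 'V_P is for real-valued random variables only. *)
Definition evariance (X : T -> \bar R) : \bar R :=
  \int[P]_w (X w - \int[P]_z X z) ^+ 2.

Definition reduced_variance (mu : T -> set 'rV[R]_d -> \bar R) (r : R) :
    \bar R :=
  evariance (fun w => mu w (eball r)) / lebesgueV (@eball R d r).

Definition hyperuniform (mu : T -> set 'rV[R]_d -> \bar R) : Prop :=
  reduced_variance mu r @[r --> +oo%R] --> 0.

Definition classI_hyperuniform (mu : T -> set 'rV[R]_d -> \bar R) : Prop :=
  exists C : R, \forall r \near +oo%R, reduced_variance mu r <= (C * r^-1)%:E.

End random_vectors.

(* Main.v *)
(* Let A be the matrix whose rows are the a_j.  In the coordinates x A^-1 the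
   lattice is Z^d, the shift V = U A^-1 is uniform on the unit cube, the
   displacements are X_k = p_(k A) A^-1, and the ball of radius r becomes an
   ellipsoid E.  With gamma z = lambda (E n (E - z)), Tonelli, stationarity and
   the tiling of R^d by unit cubes give, for N = Xi (B_r),
     E N = lambda E   and   E N^2 = sum_m E gamma (m + X_m - X_0).
   Replace X_m by an independent copy X_0' of X_0 in the m-th term.

   - After the replacement the sum is at most lambda(E)^2 + C r^(d-k), whatever
     the value z of X_0' - X_0: by Fourier inversion
     (2 pi)^d gamma z = int g(xi) cos (xi.z), where g is the square of the
     Fourier transform of E, and averaging over a large box of Z^d turns
     sum_m gamma (m + z) into an integral of g against a Fejer-type kernel.
     On the cube of side 2 pi one uses g <= lambda(E)^2, and outside it the
     decay g(xi) <= K r^(d-k) |xi|^-(d+k), 0 < k <= 1, which follows from an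
     energy estimate for Bessel's equation.

   - The error of the replacement is an integral of g against covariances of
     trigonometric functions of xi.X_0 and xi.X_m, which are at most
     c alpha_m^(1/s) min (1, |xi|^t) when E |p_0|^(t q) is finite, t < 2: expand
     the variables in base 2, interpolate the covariance of two events A and B
     between alpha_m, P A and P B, and use Markov's inequality.  For k < t the
     integral of g(xi) min (1, |xi|^t) is O(r^(d-k)).

   Hence Var N = O(r^(d-k)) as soon as k < t < 2.  Take k = 1/2 and t = 1 for
   hyperuniformity, k = 1 and t = 3/2 for class I. *)

(* Only an upper bound on E N^2 is needed, so Poisson summation is used as an inequality. The kernel
   is nonnegative and its mass over the cube of side 2 pi is exactly (2 pi)^d per point of the box,
   so the crude bound g <= lambda(E)^2 on that cube yields lambda(E)^2 with constant 1. This term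
   has to cancel (E N)^2 in the variance, and any constant factor lost here would ruin the rate.

   After the replacement all terms share the shift z = X_0' - X_0, and the sum over m can be bounded
   pointwise in z.

   The exponents: each of the two variables in a covariance contributes |xi|^(t/2), and the
   interpolation splits 1 as 1/s + 1/(2q) + 1/(2q). The binary digits lead to a geometric series of
   ratio 2^(t/2 - 1), hence t < 2. Near the origin g(xi) |xi|^t is controlled by |xi|^(t - d - k),
   which is integrable only for t > k. A moment of order q allows t = 1, and then k must be below 1;
   the value k = 1, the full decay of the transform of a ball, asks for t > 1, and 3/2 is one choice
   in (1, 2) covered by a moment of order 2q. *)
From HB Require Import structures.
Require Import Defs.
From mathcomp Require Import measurable_realfun ring lra zify.

Set Implicit Arguments.
Unset Strict Implicit.
Unset Printing Implicit Defensive.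

Local Open Scope classical_set_scope.
Local Open Scope ring_scope.

(** * Borel sets and Lebesgue measure on R^d *)

Section borel_coordinates.
Context {R : realType}.

Lemma measurable_coord d (j : 'I_d) :
  measurable_fun setT (fun x : borelV R d => (x : 'rV[R]_d) 0 j : R).
Proof.
apply: (measurability _ (RGenOpens.measurableE R)) => _ [_ [a [b ->] <-]].
rewrite setTI; apply: sub_sigma_algebra.
by apply: open_comp => [x _|]; [exact: coord_continuous|exact: interval_open].
Qed.

Lemma rV_ballE d (x y : 'rV[R]_d) (e : R) : 0 < e ->
  ball x e y <-> forall j, `|x 0 j - y 0 j| < e.
Proof.
move=> e0; split; first by move=> [_ +] j => /(_ 0 j).
by move=> h; split => // i j; rewrite (ord1 i); exact: h.
Qed.

(** A countable base of the topology: it makes the preimage of an open set a countable union of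
    preimages of balls. *)
Lemma open_bigcup_rat_ball d (A : set 'rV[R]_d) : open A ->
  A = \bigcup_(qn in [set qn : 'rV[rat]_d * nat |
        ball (map_mx ratr qn.1 : 'rV[R]_d) qn.2.+1%:R^-1 `<=` A])
      ball (map_mx ratr qn.1 : 'rV[R]_d) qn.2.+1%:R^-1.
Proof.
move=> oA; apply/seteqP; split => [x Ax|x [qn]]; last exact.
have /nbhs_ballP[e /= e0 eA] : nbhs x A by exact: open_nbhs_nbhs.
have [n ne] : exists n : nat, (n.+1%:R^-1 : R) < e / 2.
  have [n _ /(_ n)] := near_infty_natSinv_lt (PosNum (divr_gt0 e0 (ltr0n _ 2))).
  by move=> /(_ (leqnn _)) h; exists n.
have n0 : 0 < n.+1%:R^-1 :> R by rewrite invr_gt0.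
have /choice[q hq] : forall j : 'I_d, exists q : rat,
    `|ratr q - x 0 j| < n.+1%:R^-1 :> R.
  move=> j; have [|q] := @rat_in_itvoo R (x 0 j - n.+1%:R^-1) (x 0 j + n.+1%:R^-1).
    by rewrite ltrBlDr -addrA ltrDl addr_gt0.
  by rewrite in_itv /= => /andP[h1 h2]; exists q; rewrite ltr_distl h1 h2.
exists (\row_j q j, n) => /=; last by apply/(rV_ballE _ _ n0) => j; rewrite !mxE.
move=> y /(rV_ballE _ _ n0) hy; apply: eA; apply/(rV_ballE _ _ e0) => j.
have := hq j; have := hy j; rewrite !mxE [X in _ -> X < _ -> _]distrC => h1 h2.
rewrite -(subrKA (ratr (q j))) (splitr e); apply: (le_lt_trans (ler_normD _ _)).
by apply: ltrD; [exact: lt_trans h2 ne|apply: lt_trans ne; rewrite distrC in h1 *].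
Qed.

(** Balls of the sup norm are finite intersections of conditions on single coordinates, and open
    sets are countable unions of such balls. This is the criterion by which measurability into R^d
    is checked below. *)
Lemma measurable_to_borelV {disp} {T : measurableType disp} d
    (f : T -> 'rV[R]_d) :
  (forall j, measurable_fun setT (fun w => f w 0 j)) ->
  measurable_fun setT (f : T -> borelV R d).
Proof.
move=> mf.
have mball (x : 'rV[R]_d) (e : R) : 0 < e -> measurable (f @^-1` ball x e).
  move=> e0.
  have -> : f @^-1` ball x e = \bigcap_(j in [set: 'I_d])
      ((fun w => f w 0 j) @^-1` ball (x 0 j) e).
    apply/seteqP; split => w /=; first by move=> /(rV_ballE _ _ e0) h j _; exact: h.
    by move=> h; apply/(rV_ballE _ _ e0) => j; exact: h.
  apply: fin_bigcap_measurable => // j _; rewrite -[X in measurable X]setTI.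
  by apply: mf => //; apply: open_measurable; exact: ball_open.
apply: (@measurability _ _ T (borelV R d) setT f (@open 'rV[R]_d)) => //.
move=> _ [A oA <-]; rewrite setTI (open_bigcup_rat_ball oA).
rewrite preimage_bigcup bigcup_mkcond.
apply: countable_bigcupT_measurable => [|qn]; first exact: countableP.
by case: ifPn => // _; apply: mball; rewrite invr_gt0.
Qed.

Lemma measurable_borelV_coord {disp} {T : measurableType disp} d
    (f : T -> 'rV[R]_d) (j : 'I_d) :
  measurable_fun setT (f : T -> borelV R d) ->
  measurable_fun setT (fun w => f w 0 j).
Proof. by move=> mf; apply: (measurableT_comp (measurable_coord j) mf). Qed.

Lemma measurable_borelVD {disp} {T : measurableType disp} d
    (f g : T -> 'rV[R]_d) :
  measurable_fun setT (f : T -> borelV R d) ->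
  measurable_fun setT (g : T -> borelV R d) ->
  measurable_fun setT ((fun w => f w + g w) : T -> borelV R d).
Proof.
move=> mf mg; apply: measurable_to_borelV => j.
under eq_fun do rewrite mxE.
by apply: measurable_funD; exact: measurable_borelV_coord.
Qed.

Lemma measurable_borelVM {disp} {T : measurableType disp} d e
    (f : T -> 'rV[R]_d) (M : 'M[R]_(d, e)) :
  measurable_fun setT (f : T -> borelV R d) ->
  measurable_fun setT ((fun w => f w *m M) : T -> borelV R e).
Proof.
move=> mf; apply: measurable_to_borelV => j.
under eq_fun do rewrite mxE.
apply: measurable_sum => k; apply: measurable_funM => //.
exact: measurable_borelV_coord.
Qed.

Lemma measurable_borelVN {disp} {T : measurableType disp} d
    (f : T -> 'rV[R]_d) :
  measurable_fun setT (f : T -> borelV R d) ->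
  measurable_fun setT ((fun w => - f w) : T -> borelV R d).
Proof.
move=> mf; apply: measurable_to_borelV => j.
under eq_fun do rewrite mxE.
by apply: measurableT_comp => //; exact: measurable_borelV_coord.
Qed.

Lemma measurable_borelVZ {disp} {T : measurableType disp} d
    (c : R) (f : T -> 'rV[R]_d) :
  measurable_fun setT (f : T -> borelV R d) ->
  measurable_fun setT ((fun w => c *: f w) : T -> borelV R d).
Proof.
move=> mf; apply: measurable_to_borelV => j.
under eq_fun do rewrite mxE.
by apply: measurable_funM => //; exact: measurable_borelV_coord.
Qed.

Lemma measurable_enorm d :
  measurable_fun setT (fun x : borelV R d => enorm (x : 'rV[R]_d)).
Proof.
apply: (@measurableT_comp _ _ _ _ _ _ (@Num.sqrt R)).
  by apply: continuous_measurable_fun; exact: sqrt_continuous.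
apply: measurable_sum => k; apply: measurable_funX.
exact: measurable_coord.
Qed.

End borel_coordinates.

Section lebesgueV_measure.
Context {R : realType}.

(** The identification of R x R^n with R^(n+1) implicit in the recursive clause of [lebesgueV]. *)
Definition glue n (x : measurableTypeR R * borelV R n) : borelV R n.+1 :=
  row_mx (x.1)%:M x.2 : 'rV[R]_(1 + n).

Definition unglue n (x : borelV R n.+1) : measurableTypeR R * borelV R n :=
  ((x : 'rV[R]_(1 + n)) 0 0, rsubmx (x : 'rV[R]_(1 + n))).

Lemma glueK n : cancel (@glue n) (@unglue n).
Proof.
move=> [x y]; rewrite /glue /unglue /=; congr pair; last by rewrite row_mxKr.
have -> : (0 : 'I_(1 + n)) = lshift n (0 : 'I_1) by apply/val_inj.
by rewrite row_mxEl mxE eqxx.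
Qed.

Lemma unglueK n : cancel (@unglue n) (@glue n).
Proof.
move=> x; rewrite /glue /unglue /=.
have -> : ((x : 'rV[R]_(1 + n)) 0 0)%:M = lsubmx (x : 'rV[R]_(1 + n)).
  apply/matrixP => i j; rewrite (ord1 i) (ord1 j) !mxE eqxx mulr1n.
  by congr (x _ _); apply/val_inj.
exact: (@hsubmxK R 1 1 n (x : 'rV[R]_(1 + n))) .
Qed.

Lemma measurable_glue n : measurable_fun setT (@glue n).
Proof.
apply: measurable_to_borelV => j; rewrite /glue.
case: (@split_ordP 1 n j) => k ->.
  rewrite [X in measurable_fun _ X](_ : _ = fst); first exact: measurable_fst.
  apply/funext => w; rewrite (@row_mxEl R 1 1 n) (ord1 k).
  by rewrite !mxE eqxx mulr1n.
rewrite [X in measurable_fun _ X](_ : _ = (fun w => (w.2 : 'rV[R]_n) 0 k)).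
  exact: (measurableT_comp (measurable_coord k) (@measurable_snd _ _ _ _)).
by apply/funext => w; rewrite (@row_mxEr R 1 1 n).
Qed.

Lemma measurable_unglue n : measurable_fun setT (@unglue n).
Proof.
apply: measurable_fun_pair; first exact: measurable_coord.
apply: measurable_to_borelV => j; rewrite /unglue.
under eq_fun do rewrite mxE.
exact: measurable_coord.
Qed.

HB.instance Definition _ n :=
  isMeasurableFun.Build _ _ _ _ _ (@measurable_glue n).

End lebesgueV_measure.

Section glue_measure.
Context {R : realType} (n : nat) (m : {sigma_finite_measure set (borelV R n) -> \bar R}).
Local Open Scope ereal_scope.

(** The recursive clause of [lebesgueV] as a pushforward, from which countable additivity and
    sigma-finiteness are inherited. *)
Definition glue_measure : set (borelV R n.+1) -> \bar R :=
  pushforward (@lebesgue_measure R \x m) (@glue R n).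

Let gm0 : glue_measure set0 = 0.
Proof. by rewrite /glue_measure /pushforward preimage_set0 measure0. Qed.

Let gm_ge0 A : 0 <= glue_measure A.
Proof. by rewrite /glue_measure /pushforward; exact: measure_ge0. Qed.

Let gm_sigma_additive : semi_sigma_additive glue_measure.
Proof.
move=> F mF tF mUF; rewrite /glue_measure /pushforward preimage_bigcup.
apply: measure_semi_sigma_additive.
- by move=> k; rewrite -[X in measurable X]setTI; exact: measurable_glue.
- apply/trivIsetP => /= i j _ _ ij; rewrite -preimage_setI.
  by move/trivIsetP : tF => /(_ _ _ _ _ ij) ->//; rewrite preimage_set0.
- by rewrite -preimage_bigcup -[X in measurable X]setTI; exact: measurable_glue.
Qed.

HB.instance Definition _ := isMeasure.Build _ _ _ glue_measure gm0 gm_ge0 gm_sigma_additive.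

Let gm_sigma_finite : sigma_finite setT glue_measure.
Proof.
have /sigma_finiteP[F [TF ndF Foo]] := sigma_finiteT (@lebesgue_measure R).
have /sigma_finiteP[G [TG ndG Goo]] := sigma_finiteT m.
exists (fun k => @unglue R n @^-1` (F k `*` G k)).
  rewrite -preimage_bigcup (_ : \bigcup_k (F k `*` G k) = setT) ?preimage_setT //.
  apply/seteqP; split => // -[x y] _.
  have [i _ Fi] : (\bigcup_k F k) x by rewrite -TF.
  have [j _ Gj] : (\bigcup_k G k) y by rewrite -TG.
  exists (maxn i j) => //; split => /=.
    by move: x Fi; exact/subsetPset/ndF/leq_maxl.
  by move: y Gj; exact/subsetPset/ndG/leq_maxr.
move=> k; have [mF Fk] := Foo k; have [mG Gk] := Goo k.
have mFG : measurable (F k `*` G k) by exact: measurableX.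
split; first by rewrite -[X in measurable X]setTI; exact: measurable_unglue.
rewrite /glue_measure /pushforward -comp_preimage.
have -> : @unglue R n \o @glue R n = id by apply/funext => x /=; exact: glueK.
by rewrite preimage_id product_measure1E// lte_mul_pinfty// ge0_fin_numE.
Qed.

HB.instance Definition _ := Measure_isSigmaFinite.Build _ _ _ glue_measure gm_sigma_finite.

Lemma ge0_integral_glue_measure (f : borelV R n.+1 -> \bar R) :
  measurable_fun setT f -> (forall x, 0 <= f x) ->
  \int[glue_measure]_x f x = \int[@lebesgue_measure R]_x \int[m]_y f (glue (x, y)).
Proof.
move=> mf f0.
have mfg : measurable_fun setT (f \o @glue R n).
  exact: (measurableT_comp mf (@measurable_glue R n)).
transitivity (\int[@lebesgue_measure R \x m]_z (f \o @glue R n) z).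
  have <- := ge0_integral_pushforward (@measurable_glue R n)
    (@lebesgue_measure R \x m) measurableT mf (fun y _ => f0 y).
  exact: eq_measure_integral.
by rewrite (fubini_tonelli1 (f \o @glue R n))// => x; exact: f0.
Qed.

End glue_measure.

Section LV.
Context {R : realType}.

(** [lebesgueV] is a bare set function; induction on d equips it with the structure of a
    sigma-finite measure, and [LV] is the resulting bundled object. *)
Lemma lebesgueV_sigma_finite d :
  {m : {sigma_finite_measure set (borelV R d) -> \bar R} |
    (m : set (borelV R d) -> \bar R) = @lebesgueV R d}.
Proof.
elim: d => [|n [m mE]].
  by exists (@dirac _ (borelV R 0) 0 R : {sigma_finite_measure set _ -> \bar R}).
exists (glue_measure m : {sigma_finite_measure set _ -> \bar R}).
by apply/funext => B /=; rewrite /glue_measure /pushforward /= -mE.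
Qed.

Definition LV d : {sigma_finite_measure set (borelV R d) -> \bar R} :=
  sval (lebesgueV_sigma_finite d).

Lemma LVE d : LV d = @lebesgueV R d :> (set _ -> \bar R).
Proof. exact: (svalP (lebesgueV_sigma_finite d)). Qed.

Lemma LVS n (B : set (borelV R n.+1)) : LV n.+1 B = glue_measure (LV n) B.
Proof. by rewrite LVE /glue_measure /pushforward /= LVE. Qed.

Local Open Scope ereal_scope.

Lemma ge0_integral_LVS n (f : borelV R n.+1 -> \bar R) :
  measurable_fun setT f -> (forall x, 0 <= f x) ->
  \int[LV n.+1]_x f x = \int[@lebesgue_measure R]_x \int[LV n]_y f (glue (x, y)).
Proof.
move=> mf f0; rewrite -ge0_integral_glue_measure //.
by apply: eq_measure_integral => A _ _; exact: LVS.
Qed.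

End LV.

Section LV_theory.
Context {R : realType}.
Local Notation lam := (@lebesgue_measure R).
Local Open Scope ereal_scope.

Lemma glue0 n (x : R) (y : 'rV[R]_n) : (glue (x, y) : 'rV[R]_n.+1) 0%R 0%R = x.
Proof.
rewrite /glue /= (_ : 0%R = lshift n (0%R : 'I_1)); last exact/val_inj.
by rewrite (@row_mxEl R 1 1 n) mxE eqxx.
Qed.

Lemma glueS n (x : R) (y : 'rV[R]_n) j :
  (glue (x, y) : 'rV[R]_n.+1) 0%R (lift ord0 j) = y 0%R j.
Proof.
rewrite /glue /= (_ : lift ord0 j = rshift 1 j); last exact/val_inj.
by rewrite (@row_mxEr R 1 1 n).
Qed.

Lemma row_lift0P n (x y : 'rV[R]_n.+1) :
  x 0%R 0%R = y 0%R 0%R -> (forall j, x 0%R (lift ord0 j) = y 0%R (lift ord0 j)) -> x = y.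
Proof.
move=> h0 hS; apply/rowP => j; have [j' ->|->] := unliftP ord0 j; last exact: h0.
exact: hS.
Qed.

(** A translate of Lebesgue measure agrees with it on half-open intervals, and these determine
    it. *)
Lemma ge0_integral_lebesgueD (h : R) (f : measurableTypeR R -> \bar R) :
  measurable_fun setT f -> (forall x, 0 <= f x) ->
  \int[lam]_x f (x + h)%R = \int[lam]_x f x.
Proof.
move=> mf f0.
have mh : measurable_fun setT ((fun x => (x + h)%R) : measurableTypeR R -> measurableTypeR R).
  by apply: measurable_funD => //; exact: measurable_cst.
have <- := ge0_integral_pushforward mh lam measurableT mf (fun y _ => f0 y).
apply: eq_measure_integral => A mA _; apply/esym/lebesgue_measure_unique => //= _ [[a b]] _ <-.
rewrite /pushforward /=.
have -> : (fun x => (x + h)%R) @^-1` `]a, b]%classic = `](a - h)%R, (b - h)%R]%classic.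
  by apply/seteqP; split => x /=; rewrite !in_itv /= lerBrDr ltrBlDr.
rewrite !lebesgue_measure_itv /= !lte_fin ltrD2r.
by case: ifP => // _; rewrite -!EFinB; congr EFin; ring.
Qed.

(** Tonelli peels off the first coordinate: the others are translated by induction, the first by the
    one-dimensional case. *)
Lemma ge0_integral_LVD d (h : 'rV[R]_d) (f : borelV R d -> \bar R) :
  measurable_fun setT f -> (forall x, 0 <= f x) ->
  \int[LV d]_x f ((x : 'rV[R]_d) + h)%R = \int[LV d]_x f x.
Proof.
elim: d h f => [|n IH] h f mf f0.
  by apply: eq_integral => x _; rewrite (thinmx0 h) addr0.
have mD d (k : 'rV[R]_d) : measurable_fun setT
    ((fun x : borelV R d => (x : 'rV[R]_d) + k)%R : borelV R d -> borelV R d).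
  by apply: measurable_borelVD; [exact: measurable_id|exact: measurable_cst].
rewrite !ge0_integral_LVS //; last exact: (measurableT_comp mf (mD _ h)).
pose k : 'rV[R]_n := \row_j h 0%R (lift ord0 j).
have glueD x y : ((glue (x, y) : 'rV[R]_n.+1) + h)%R =
    glue ((x + h 0%R 0%R)%R, (y + k)%R).
  apply: row_lift0P => [|j]; first by rewrite [in LHS]mxE !glue0.
  by rewrite [in LHS]mxE !glueS [in RHS]mxE [in RHS]mxE.
pose g x := \int[LV n]_y f (glue (x, y)).
transitivity (\int[lam]_x g (x + h 0%R 0%R)%R).
  apply: eq_integral => x _; rewrite /g -(IH k (fun y => f (glue ((x + h 0 0)%R, y)))).
  - by apply: eq_integral => y _; rewrite glueD.
  - apply: (measurableT_comp mf); apply: (measurableT_comp (@measurable_glue R n)).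
    exact: pair1_measurable.
  - by move=> y; exact: f0.
rewrite ge0_integral_lebesgueD //; last by move=> x; apply: integral_ge0 => y _; exact: f0.
apply: (measurable_fun_fubini_tonelli_F (f \o @glue R n)) => [|x]; last exact: f0.
exact: (measurableT_comp mf (@measurable_glue R n)).
Qed.

Lemma ge0_integral_LV_prod d (w : 'I_d -> R -> R) :
  (forall j, measurable_fun setT (w j)) -> (forall j x, (0 <= w j x)%R) ->
  \int[LV d]_x (\prod_(j < d) w j ((x : 'rV[R]_d) 0%R j))%:E =
  \prod_(j < d) \int[lam]_x (w j x)%:E.
Proof.
elim: d w => [|n IH] w mw w0.
  rewrite big_ord0; under eq_integral do rewrite big_ord0.
  rewrite integral_cst // mul1e.
  by have h : LV 0 setT = 1 :> \bar R; [rewrite LVE /= diracT|exact: h].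
have mp d (v : 'I_d -> R -> R) : (forall j, measurable_fun setT (v j)) ->
    measurable_fun setT (fun x : borelV R d => \prod_(j < d) v j ((x : 'rV[R]_d) 0 j))%R.
  move=> mv; apply: measurable_prod => j _.
  exact: (measurableT_comp (mv j) (measurable_coord j)).
rewrite ge0_integral_LVS; last 2 first.
- apply/measurable_EFinP; exact: (mp n.+1 w mw).
- by move=> x; rewrite lee_fin prodr_ge0.
have -> : (fun x => \int[LV n]_y (\prod_(j < n.+1) w j ((glue (x, y) : 'rV[R]_n.+1) 0%R j))%:E) =
    (fun x => (w ord0 x)%:E * \prod_(j < n) \int[lam]_x (w (lift ord0 j) x)%:E).
  rewrite -(IH (fun j => w (lift ord0 j)) (fun j => mw _) (fun j => w0 _)).
  apply/funext => x; rewrite -ge0_integralZl //.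
  - apply: eq_integral => y _; rewrite big_ord_recl glue0 -EFinM.
    by congr (_ * _)%:E; apply: eq_bigr => j _; rewrite glueS.
  - apply/measurable_EFinP; exact: (mp n (fun j => w (lift ord0 j)) (fun j => mw _)).
  - by move=> y _; rewrite lee_fin prodr_ge0.
  - by rewrite lee_fin.
rewrite ge0_integralZr //; first by rewrite big_ord_recl.
- apply/measurable_EFinP; exact: (mw ord0).
- by move=> x _; rewrite lee_fin.
- by apply: prode_ge0 => j _; apply: integral_ge0 => x _; rewrite lee_fin.
Qed.

Definition box d (I : set R) : set (borelV R d) := [set x | forall j, I ((x : 'rV[R]_d) 0%R j)].

Lemma indic_box d (I : set R) (x : 'rV[R]_d) :
  \1_(box I) x = (\prod_(j < d) \1_I (x 0 j))%R :> R.
Proof.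
rewrite indicE; have [xI|/negP xI] := boolP (x \in box I).
  by rewrite big1 // => j _; rewrite indicE mem_set //; move: xI; rewrite inE; exact.
have [j Ij] : exists j, ~ I (x 0%R j).
  by apply/existsNP => h; apply: xI; rewrite inE.
by apply/esym/eqP/prodf_eq0; exists j => //; rewrite indicE memNset.
Qed.

Lemma measurable_box d (I : set R) : measurable I -> measurable (@box d I).
Proof.
move=> mI; rewrite (_ : box I = \bigcap_(j in [set: 'I_d])
  ((fun x : borelV R d => (x : 'rV[R]_d) 0%R j) @^-1` I)).
  apply: fin_bigcap_measurable => // j _; rewrite -[X in measurable X]setTI.
  exact: measurable_coord.
by apply/seteqP; split => x /= h j; [move=> _|]; exact: h.
Qed.

Lemma LV_box d (I : set R) : measurable I -> LV d (box I) = (lam I) ^+ d.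
Proof.
move=> mI; rewrite -[LHS]mul1e -integral_cst; last exact: measurable_box.
rewrite integral_mkcond.
transitivity (\int[LV d]_x (\prod_(j < d) (\1_I ((x : 'rV[R]_d) 0 j) : R))%:E).
  apply: eq_integral => x _; rewrite -(indic_box I x) indicE patchE.
  by case: ifP.
rewrite (ge0_integral_LV_prod (w := fun _ => \1_I)) //.
rewrite integral_indic // setIT.
by elim: d => [|n IH]; rewrite ?big_ord0 ?expe0 // big_ord_recl IH expeS.
Qed.

End LV_theory.

(** * Euclidean norm and reflections *)

Section dot_product.
Context {R : realType} {d : nat}.
Implicit Types x y z : 'rV[R]_d.

Definition dotv x y : R := \sum_(j < d) x 0 j * y 0 j.

Lemma dotvC x y : dotv x y = dotv y x.
Proof. by apply: eq_bigr => j _; rewrite mulrC. Qed.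

Lemma dotvDl x y z : dotv (x + y) z = dotv x z + dotv y z.
Proof. by rewrite -big_split; apply: eq_bigr => j _; rewrite mxE mulrDl. Qed.

Lemma dotvDr x y z : dotv x (y + z) = dotv x y + dotv x z.
Proof. by rewrite dotvC dotvDl !(dotvC x). Qed.

Lemma dotvZl c x y : dotv (c *: x) y = c * dotv x y.
Proof. by rewrite mulr_sumr; apply: eq_bigr => j _; rewrite mxE mulrA. Qed.

Lemma dotvZr c x y : dotv x (c *: y) = c * dotv x y.
Proof. by rewrite dotvC dotvZl dotvC. Qed.

Lemma dotvNl x y : dotv (- x) y = - dotv x y.
Proof. by rewrite -scaleN1r dotvZl mulN1r. Qed.

Lemma dotvNr x y : dotv x (- y) = - dotv x y.
Proof. by rewrite dotvC dotvNl dotvC. Qed.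

Lemma dotvBl x y z : dotv (x - y) z = dotv x z - dotv y z.
Proof. by rewrite dotvDl dotvNl. Qed.

Lemma dotvBr x y z : dotv x (y - z) = dotv x y - dotv x z.
Proof. by rewrite dotvDr dotvNr. Qed.

Lemma dotv0l x : dotv 0 x = 0.
Proof. by rewrite /dotv big1 // => j _; rewrite mxE mul0r. Qed.

Lemma dotvv_ge0 x : 0 <= dotv x x.
Proof. by apply: sumr_ge0 => j _; rewrite -expr2 sqr_ge0. Qed.

Lemma dotvv_eq0 x : (dotv x x == 0) = (x == 0).
Proof.
apply/idP/idP => [|/eqP ->]; last by rewrite dotv0l.
rewrite psumr_eq0 => [/allP h|j _]; last by rewrite -expr2 sqr_ge0.
apply/eqP/rowP => j; apply/eqP; rewrite mxE -sqrf_eq0 expr2.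
by apply: h; rewrite mem_index_enum.
Qed.

Lemma dotv_mulmx (M : 'M[R]_d) x y : dotv (x *m M) y = dotv x (y *m M^T).
Proof.
rewrite /dotv; under eq_bigr do rewrite mxE mulr_suml.
rewrite exchange_big; apply: eq_bigr => j _ /=; rewrite mxE mulr_sumr.
by apply: eq_bigr => k _; rewrite mxE; ring.
Qed.

Lemma enormE x : enorm x = Num.sqrt (dotv x x).
Proof. by congr Num.sqrt; apply: eq_bigr => j _; rewrite expr2. Qed.

Lemma enorm_ge0 x : 0 <= enorm x.
Proof. exact: sqrtr_ge0. Qed.

Lemma sqr_enorm x : enorm x ^+ 2 = dotv x x.
Proof. by rewrite enormE sqr_sqrtr // dotvv_ge0. Qed.

Lemma enorm_eq0 x : (enorm x == 0) = (x == 0).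
Proof. by rewrite -dotvv_eq0 -sqr_enorm sqrf_eq0. Qed.

Lemma enormZ c x : enorm (c *: x) = `|c| * enorm x.
Proof.
by rewrite !enormE dotvZl dotvZr mulrA -expr2 sqrtrM ?sqr_ge0 // sqrtr_sqr.
Qed.

Lemma enormN x : enorm (- x) = enorm x.
Proof. by rewrite -scaleN1r enormZ normrN1 mul1r. Qed.

Lemma dotv_le_enorm x y : `|dotv x y| <= enorm x * enorm y.
Proof.
rewrite -(@ler_pXn2r _ 2) // ?nnegrE ?mulr_ge0 ?enorm_ge0 //.
rewrite exprMn !sqr_enorm real_normK ?num_real //.
have [->|y0] := eqVneq y 0; first by rewrite !(dotvC _ 0) !dotv0l mulr0 expr0n.
have yy : 0 < dotv y y by rewrite lt0r dotvv_eq0 y0 dotvv_ge0.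
have := dotvv_ge0 (dotv y y *: x - dotv x y *: y).
rewrite !(dotvBl, dotvBr, dotvZl, dotvZr) (dotvC y x).
rewrite (_ : _ - _ = dotv y y * (dotv x x * dotv y y - dotv x y ^+ 2)); last ring.
by rewrite pmulr_rge0 // subr_ge0.
Qed.

Lemma enormD x y : enorm (x + y) <= enorm x + enorm y.
Proof.
rewrite -(@ler_pXn2r _ 2) // ?nnegrE ?addr_ge0 ?enorm_ge0 //.
rewrite sqrrD !sqr_enorm dotvDl !dotvDr (dotvC y x).
have := le_trans (ler_norm _) (dotv_le_enorm x y); lra.
Qed.

Lemma coord_le_enorm x j : `|x 0 j| <= enorm x.
Proof.
rewrite -(@ler_pXn2r _ 2) // ?nnegrE ?enorm_ge0 //.
rewrite sqr_enorm real_normK ?num_real // /dotv (bigD1 j) //= -expr2 lerDl.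
by apply: sumr_ge0 => k _; rewrite -expr2 sqr_ge0.
Qed.

Lemma enorm_le_sum x : enorm x <= \sum_(j < d) `|x 0 j|.
Proof.
rewrite -(@ler_pXn2r _ 2) // ?nnegrE ?enorm_ge0 ?sumr_ge0 //.
rewrite sqr_enorm expr2 mulr_suml; apply: ler_sum => j _.
apply: le_trans (ler_norm _) _; rewrite normrM ler_wpM2l //.
by rewrite (bigD1 j) //= lerDl sumr_ge0.
Qed.

Lemma enorm_le_box (a : R) x : (forall j, `|x 0 j| <= a) -> enorm x <= d%:R * a.
Proof.
move=> h; apply: (le_trans (enorm_le_sum x)).
by apply: (le_trans (ler_sum _ (fun j _ => h j))); rewrite sumr_const card_ord mulr_natl.
Qed.

(** The reflection in the hyperplane orthogonal to v, and the identity at v = 0. It replaces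
    rotations: with v = u - w it exchanges two vectors u and w of equal norm. *)
Definition householder (v : 'rV[R]_d) : 'M[R]_d := 1%:M - (2 / dotv v v) *: (v^T *m v).

Lemma mul_householder v x : x *m householder v = x - (2 * dotv x v / dotv v v) *: v.
Proof.
rewrite mulmxBr mulmx1 -scalemxAr mulmxA.
have -> : x *m v^T = (dotv x v)%:M.
  apply/rowP => j; rewrite (ord1 j) !mxE eqxx mulr1n.
  by apply: eq_bigr => k _; rewrite mxE.
by rewrite mul_scalar_mx scalerA; congr (_ - _ *: _); ring.
Qed.

Lemma householderK v x : x *m householder v *m householder v = x.
Proof.
rewrite !mul_householder; have [->|v0] := eqVneq v 0; first by rewrite !scaler0 !subr0.
have vv : dotv v v != 0 by rewrite dotvv_eq0.
rewrite dotvBl dotvZl -addrA -opprD -scalerDl.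
by rewrite [X in X *: v](_ : _ = 0) ?scale0r ?subr0 //; field.
Qed.

Lemma householder_unit v : householder v \in unitmx.
Proof.
apply: (proj1 (mulmx1_unit (B := householder v) _)).
apply/row_matrixP => i; rewrite row_mul rowE -mulmxA mulmxA.
by rewrite -[delta_mx _ _ *m _ *m _]/(delta_mx 0 i *m householder v *m householder v) householderK row1.
Qed.

Lemma enorm_householder v x : enorm (x *m householder v) = enorm x.
Proof.
rewrite !enormE mul_householder; have [->|v0] := eqVneq v 0.
  by rewrite scaler0 subr0.
have vv : dotv v v != 0 by rewrite dotvv_eq0.
rewrite !(dotvBl, dotvBr, dotvZl, dotvZr) (dotvC v x); congr Num.sqrt.
by field.
Qed.

Lemma dotv_householder u w x : dotv u u = dotv w w ->
  dotv (x *m householder (u - w)) u = dotv x w.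
Proof.
move=> uw; rewrite mul_householder.
rewrite (dotvBl x) (dotvZl (2 * dotv x (u - w) / dotv (u - w) (u - w))).
have [uw0|v0] := eqVneq (u - w) 0.
  have -> : u = w by apply/eqP; rewrite -subr_eq0 uw0.
  by rewrite subrr !dotv0l mulr0 subr0.
have vv : dotv (u - w) (u - w) != 0 by rewrite dotvv_eq0.
(* Since |u| = |w|, the vector u - w has the same product with u as with -w. *)
have e : dotv (u - w) (u - w) = 2 * dotv (u - w) u.
  by rewrite !(dotvBl, dotvBr) uw (dotvC w u); ring.
rewrite dotvBr e; field.
by move: vv; rewrite e mulf_eq0 negb_or => /andP[].
Qed.

End dot_product.

(** * Linear changes of variables *)

Section haar.
Context {R : realType} {d : nat}.
Local Notation bV := (borelV R d).
Local Open Scope ereal_scope.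

(* Weil's argument for the uniqueness of Haar measure: it gives the linear
   change of variables up to a constant, without determinants. *)
Lemma haar_unique (M : 'M[R]_d) (A B : set bV) : M \in unitmx ->
  measurable A -> measurable B ->
  LV d A * LV d [set y | B ((y : 'rV[R]_d) *m M)] =
  LV d B * LV d [set y | A (- ((y : 'rV[R]_d) *m M))%R].
Proof.
move=> uM mA mB.
pose a (x : 'rV[R]_d) : R := \1_A x; pose b (x : 'rV[R]_d) : R := \1_B x.
have ma : measurable_fun setT (a : bV -> R) by exact: measurable_indic.
have mb : measurable_fun setT (b : bV -> R) by exact: measurable_indic.
have mid : measurable_fun setT ((fun x => x) : bV -> bV) by exact: measurable_id.
have mfst : measurable_fun setT (fst : bV * bV -> bV) by exact: measurable_fst.
have msnd : measurable_fun setT (snd : bV * bV -> bV) by exact: measurable_snd.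
have mM : measurable_fun setT ((fun y => (y : 'rV[R]_d) *m M) : bV -> bV).
  exact: measurable_borelVM.
have mNM : measurable_fun setT ((fun y => - ((y : 'rV[R]_d) *m M))%R : bV -> bV).
  exact: measurable_borelVN.
have a0 x : (0 <= a x)%R by rewrite /a indicE.
have b0 x : (0 <= b x)%R by rewrite /b indicE.
have pre (f : bV -> bV) (C : set bV) : measurable_fun setT f -> measurable C ->
    \int[LV d]_y (\1_C (f y))%:E = LV d [set y | C (f y)].
  move=> mf mC; have mC' : measurable [set y | C (f y)].
    by rewrite -[X in measurable X]setTI; exact: mf.
  transitivity (\int[LV d]_y (\1_[set y | C (f y)] y : R)%:E) => //.
  by rewrite integral_indic // setIT.
(* For fixed x, a translation in y removes x from the second factor, so the double integral splits
   into a product of volumes; [step2] is the mirror image. *)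
have step1 : LV d A * LV d [set y | B ((y : 'rV[R]_d) *m M)] =
    \int[LV d]_x \int[LV d]_y (a x * b ((y : 'rV[R]_d) *m M + x))%:E.
  transitivity (\int[LV d]_x ((a x)%:E * LV d [set y | B ((y : 'rV[R]_d) *m M)])).
    rewrite ge0_integralZr //.
    - by rewrite (pre id).
    - exact/measurable_EFinP.
    - by move=> x _; rewrite lee_fin.
  apply: eq_integral => x _.
  have mb2 : measurable_fun setT (fun y : bV => (b ((y : 'rV[R]_d) *m M + x))%:E).
    apply/measurable_EFinP; apply: (measurableT_comp mb).
    by apply: measurable_borelVD => //; exact: measurable_cst.
  rewrite (_ : (fun y => _) = (fun y => (a x)%:E * (b ((y : 'rV[R]_d) *m M + x))%:E)) //.
  rewrite ge0_integralZl //; [|by move=> y _; rewrite lee_fin; exact: b0|by rewrite lee_fin; exact: a0].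
  congr (_ * _).
  rewrite -(pre _ _ mM mB) -(ge0_integral_LVD (x *m invmx M)).
  - by apply: eq_integral => y _; rewrite mulmxDl mulmxKV.
  - by apply/measurable_EFinP; exact: (measurableT_comp mb).
  - by move=> y; rewrite lee_fin; exact: b0.
have step2 : LV d B * LV d [set y | A (- ((y : 'rV[R]_d) *m M))%R] =
    \int[LV d]_x \int[LV d]_y (b x * a (x - (y : 'rV[R]_d) *m M))%:E.
  transitivity (\int[LV d]_x ((b x)%:E * LV d [set y | A (- ((y : 'rV[R]_d) *m M))%R])).
    rewrite ge0_integralZr //.
    - by rewrite (pre id).
    - exact/measurable_EFinP.
    - by move=> x _; rewrite lee_fin.
  apply: eq_integral => x _.
  have mb2 : measurable_fun setT (fun y : bV => (a (x - (y : 'rV[R]_d) *m M))%:E).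
    apply/measurable_EFinP; apply: (measurableT_comp ma).
    by apply: measurable_borelVD => //; exact: measurable_cst.
  rewrite (_ : (fun y => _) = (fun y => (b x)%:E * (a (x - (y : 'rV[R]_d) *m M))%:E)) //.
  rewrite ge0_integralZl //; [|by move=> y _; rewrite lee_fin; exact: a0|by rewrite lee_fin; exact: b0].
  congr (_ * _).
  rewrite -(pre _ _ mNM mA) -(ge0_integral_LVD (- (x *m invmx M))).
  - by apply: eq_integral => y _; rewrite mulmxDl mulNmx mulmxKV // opprD opprK addrC.
  - by apply/measurable_EFinP; exact: (measurableT_comp ma).
  - by move=> y; rewrite lee_fin; exact: a0.
rewrite step1 step2.
have mF1 : measurable_fun setT (fun xy : bV * bV =>
    (a xy.1 * b ((xy.2 : 'rV[R]_d) *m M + xy.1))%:E).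
  apply/measurable_EFinP; apply: measurable_funM.
    exact: (measurableT_comp ma).
  apply: (measurableT_comp mb); apply: measurable_borelVD => //.
  exact: (measurableT_comp mM).
have mF2 : measurable_fun setT (fun xy : bV * bV =>
    (b xy.1 * a (xy.1 - (xy.2 : 'rV[R]_d) *m M))%:E).
  apply/measurable_EFinP; apply: measurable_funM.
    exact: (measurableT_comp mb).
  apply: (measurableT_comp ma); apply: measurable_borelVD => //.
  exact: (measurableT_comp mNM).
(* Exchange the integrals: for fixed y, the translation of x by y M carries one integrand to the
   other. *)
rewrite (fubini_tonelli _ mF1) => [|x]; last by rewrite lee_fin mulr_ge0.
rewrite (fubini_tonelli _ mF2) => [|x]; last by rewrite lee_fin mulr_ge0.
apply: eq_integral => y _ /=.
rewrite -[RHS](ge0_integral_LVD ((y : 'rV[R]_d) *m M)).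
- by apply: eq_integral => x _; rewrite addrK mulrC addrC.
- exact: (measurable_fun_pair1 _ mF2).
- by move=> x; rewrite lee_fin mulr_ge0.
Qed.

End haar.

Section linear_change.
Context {R : realType} {d : nat}.
Local Notation bV := (borelV R d).
Local Notation lam := (@lebesgue_measure R).

Definition mx_abs_sum (M : 'M[R]_d) : R := \sum_i \sum_j `|M i j|.

Lemma mx_abs_sum_ge0 M : 0 <= mx_abs_sum M.
Proof. by apply: sumr_ge0 => i _; apply: sumr_ge0. Qed.

Lemma mulmx_coord_le (M : 'M[R]_d) (a : R) (x : 'rV[R]_d) j :
  (forall i, `|x 0 i| <= a) -> `|(x *m M) 0 j| <= a * mx_abs_sum M.
Proof.
move=> xa; rewrite mxE; apply: (le_trans (ler_norm_sum _ _ _)).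
rewrite /mx_abs_sum mulr_sumr; apply: ler_sum => i _; rewrite normrM.
have a0 : 0 <= a by apply: le_trans (xa i).
apply: ler_pM => //; rewrite (bigD1 j) //= lerDl; exact: sumr_ge0.
Qed.

Definition cube (a : R) : set bV := @box R d `[- a, a].

Lemma cubeP a (x : 'rV[R]_d) : cube a x <-> forall j, `|x 0 j| <= a.
Proof.
by split => h j; have := h j; rewrite /= in_itv /= ler_norml.
Qed.

Lemma measurable_cube a : measurable (cube a).
Proof. by apply: measurable_box. Qed.

Lemma LV_cube a : 0 <= a -> LV d (cube a) = ((2 * a) ^+ d)%:E.
Proof.
move=> a0; rewrite LV_box // lebesgue_measure_itv /= lte_fin.
have [aa|aa] := ltP (- a) a.
  by rewrite -EFinB -EFin_expe; congr ((_ ^+ _)%:E); ring.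
have -> : a = 0 by apply/eqP; rewrite eq_le a0 andbT; lra.
by rewrite mulr0 EFin_expe.
Qed.

Lemma measurable_mulmx (M : 'M[R]_d) :
  measurable_fun setT ((fun y => (y : 'rV[R]_d) *m M) : bV -> bV).
Proof. by apply: measurable_borelVM; exact: measurable_id. Qed.

Lemma measurable_preimage_mulmx (M : 'M[R]_d) (B : set bV) :
  measurable B -> measurable [set y : bV | B ((y : 'rV[R]_d) *m M)].
Proof.
by move=> mB; rewrite -[X in measurable X]setTI; exact: measurable_mulmx.
Qed.

(** Take the symmetric set A = [cube 1] in [haar_unique] and divide by its volume. The constant c is
    1 / |det M|, but it is left unnamed: where its value matters it is read off below on a cube or a
    ball. *)
Lemma LV_mulmx (M : 'M[R]_d) : M \in unitmx -> exists2 c : R, 0 < c &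
  forall B : set bV, measurable B ->
    LV d [set y | B ((y : 'rV[R]_d) *m M)] = (c%:E * LV d B)%E.
Proof.
move=> uM; set A := cube 1; pose A' : set bV := [set y | A ((y : 'rV[R]_d) *m M)].
have mA : measurable A by exact: measurable_cube.
have mA' : measurable A' by exact: measurable_preimage_mulmx.
(* The preimage A' lies between [cube a] and [cube b], so its volume is positive and finite. The
   summand 1 keeps the denominator positive. *)
pose a := (1 + mx_abs_sum M)^-1; pose b := mx_abs_sum (invmx M).
have a0 : 0 < a by rewrite invr_gt0 ltr_pwDl // mx_abs_sum_ge0.
have lo : cube a `<=` A'.
  move=> x /cubeP xa; apply/cubeP => j.
  apply: (le_trans (mulmx_coord_le M j xa)).
  rewrite mulrC ler_pdivrMr ?mul1r ?lerDr //.
  by rewrite ltr_pwDl // mx_abs_sum_ge0.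
have hi : A' `<=` cube b.
  move=> x /cubeP xa; apply/cubeP => j.
  rewrite -[x](mulmxK uM) -[leRHS]mul1r.
  exact: mulmx_coord_le.
have fA' : LV d A' \is a fin_num.
  rewrite ge0_fin_numE ?measure_ge0 //; apply: (@le_lt_trans _ _ (LV d (cube b))).
    by apply: le_measure; rewrite ?inE //; exact: measurable_cube.
  by rewrite LV_cube ?ltry // mx_abs_sum_ge0.
have pA' : (0 < LV d A')%E.
  apply: (@lt_le_trans _ _ (LV d (cube a))).
    by rewrite LV_cube ?ltW // lte_fin exprn_gt0 // mulr_gt0.
  by apply: le_measure; rewrite ?inE //; exact: measurable_cube.
have p2 : 0 < (2 * 1) ^+ d :> R by rewrite exprn_gt0 // mulr1.
exists (fine (LV d A') / (2 * 1) ^+ d).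
  by rewrite divr_gt0 // fine_gt0 // pA' ltey_eq fA'.
move=> B mB; have := haar_unique uM mA mB.
have -> : [set y : bV | A (- ((y : 'rV[R]_d) *m M))] = A'.
  apply/seteqP; split => x /cubeP h; apply/cubeP => j.
    by have := h j; rewrite mxE normrN.
  by rewrite mxE normrN; exact: h.
rewrite LV_cube // => e.
rewrite mulrC EFinM fineK // -muleA (muleC _ (LV d B)) -e muleA -EFinM.
by rewrite mulVf ?mul1e // gt_eqF.
Qed.

Lemma ge0_integral_mulmx (M : 'M[R]_d) (c : R) : 0 < c ->
  (forall B : set bV, measurable B ->
    LV d [set y | B ((y : 'rV[R]_d) *m M)] = (c%:E * LV d B)%E) ->
  forall f : bV -> \bar R, measurable_fun setT f -> (forall x, 0 <= f x)%E ->
  (\int[LV d]_y f ((y : 'rV[R]_d) *m M) = c%:E * \int[LV d]_y f y)%E.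
Proof.
move=> c0 cE f mf f0.
have <- := ge0_integral_pushforward (measurable_mulmx M) (LV d) measurableT mf
  (fun y _ => f0 y).
rewrite (_ : c%:E = (NngNum (ltW c0))%:num%:E) // -ge0_integral_mscale //.
by apply: eq_measure_integral => [|mM A mA _]; [exact: measurable_mulmx|exact: cE].
Qed.

Lemma integral_mulmx (M : 'M[R]_d) (c : R) : 0 < c ->
  (forall B : set bV, measurable B ->
    LV d [set y | B ((y : 'rV[R]_d) *m M)] = (c%:E * LV d B)%E) ->
  forall f : bV -> \bar R, (LV d).-integrable setT f ->
  (\int[LV d]_y f ((y : 'rV[R]_d) *m M) = c%:E * \int[LV d]_y f y)%E.
Proof.
move=> c0 cE f fi; have mf := measurable_int _ fi.
rewrite integralE [in RHS]integralE muleBr //; last first.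
  by rewrite fin_num_adde_defr // integrable_pos_fin_num.
rewrite -(ge0_integral_mulmx c0 cE (measurable_funepos mf) (funepos_ge0 f)).
rewrite -(ge0_integral_mulmx c0 cE (measurable_funeneg mf) (funeneg_ge0 f)).
by congr (_ - _)%E; apply: eq_integral => x _;
  [exact: (congr1 (@^~ x) (funepos_comp f (mulmx^~ M)))|exact: (congr1 (@^~ x) (funeneg_comp f (mulmx^~ M)))].
Qed.

(** The constant of [LV_mulmx] is identified on [cube 1], whose preimage is [cube r^-1]. *)
Lemma LV_scale (r : R) : 0 < r -> forall B : set bV, measurable B ->
  LV d [set y | B ((y : 'rV[R]_d) *m r%:M)] = ((r ^- d)%:E * LV d B)%E.
Proof.
move=> r0; have ur : (r%:M : 'M[R]_d) \in unitmx.
  by rewrite unitmxE det_scalar unitrX // unitfE gt_eqF.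
have [c c0 cE] := LV_mulmx ur.
suff -> : r ^- d = c by [].
have := cE (cube 1) (measurable_cube 1).
have -> : [set y : bV | cube 1 ((y : 'rV[R]_d) *m r%:M)] = cube r^-1.
  apply/seteqP; split => x /cubeP h; apply/cubeP => j; have := h j;
  rewrite mul_mx_scalar mxE normrM gtr0_norm //.
    by rewrite -ler_pdivlMl // mulr1.
  by rewrite -ler_pdivlMl // mulr1.
rewrite !LV_cube ?invr_ge0 ?ltW // -EFinM => -[]; rewrite mulr1 exprMn => e.
apply: (@mulfI _ (2 ^+ d)); first by rewrite gt_eqF // exprn_gt0.
by rewrite -exprVn e mulrC.
Qed.

Definition eballV (r : R) : set bV := @eball R d r.

Lemma measurable_eball r : measurable (eballV r).
Proof.
rewrite (_ : eballV r = (fun x : bV => enorm (x : 'rV[R]_d)) @^-1` `]-oo, r]).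
  rewrite -[X in measurable X]setTI; exact: measurable_enorm.
by apply/seteqP; split => x /=; rewrite in_itv.
Qed.

Lemma eball_fin_num r : LV d (eballV r) \is a fin_num.
Proof.
rewrite ge0_fin_numE ?measure_ge0 //.
apply: (@le_lt_trans _ _ (LV d (cube `|r|))); last by rewrite LV_cube ?ltry.
apply: le_measure; rewrite ?inE; [exact: measurable_eball|exact: measurable_cube|].
move=> x xr; apply/cubeP => j; apply: (le_trans (coord_le_enorm x j)).
by apply: le_trans xr (ler_norm _).
Qed.

Definition unit_ball_volume : R := fine (LV d (eballV 1)).

Lemma unit_ball_volume_gt0 : 0 < unit_ball_volume.
Proof.
apply: fine_gt0; rewrite ltey_eq eball_fin_num andbT.
(* By [enorm_le_box] the cube of half-side 1/(d + 1) lies in the unit ball; d + 1 rather than d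
   keeps the half-side meaningful at d = 0. *)
apply: (@lt_le_trans _ _ (LV d (cube (d.+1%:R)^-1))).
  by rewrite LV_cube ?invr_ge0 // lte_fin exprn_gt0 // mulr_gt0 // invr_gt0.
apply: le_measure; rewrite ?inE; [exact: measurable_cube|exact: measurable_eball|].
move=> x /cubeP h; rewrite /eballV /eball /=; apply: (le_trans (enorm_le_box h)).
by rewrite ler_pdivrMr ?ltr0n // mul1r ler_nat.
Qed.

Lemma LV_eball r : 0 < r -> LV d (eballV r) = (unit_ball_volume * r ^+ d)%:E.
Proof.
move=> r0; have ri : 0 < r^-1 by rewrite invr_gt0.
have := LV_scale ri (measurable_eball 1).
rewrite exprVn invrK (_ : [set y : bV | _] = eballV r).
  by move=> ->; rewrite -(fineK (eball_fin_num 1)) -EFinM mulrC.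
apply/seteqP; split => x; rewrite /eballV /eball /= mul_mx_scalar enormZ gtr0_norm //;
by rewrite ler_pdivrMl // mulr1.
Qed.

End linear_change.

(** * Decay of Bessel integrals *)

Section trig_integral.
Context {R : realType}.
Local Notation lam := (@lebesgue_measure R).
Variables (phi psi w : R -> R).
Hypothesis dphi : forall x : R, is_derive x 1 phi (psi x).
Hypothesis psi_le1 : forall x, `|psi x| <= 1.
Hypothesis cw : {within `[-1, 1], continuous w}.
Hypothesis w_le1 : forall x, x \in `[-1, 1] -> `|w x| <= 1.

Let cphi : continuous phi.
Proof.
move=> x; apply: differentiable_continuous; apply/derivable1_diffP.
exact: (@ex_derive _ _ _ _ _ _ _ (dphi x)).
Qed.

Lemma within_continuous_trig_mul t :
  {within `[-1, 1], continuous (fun x : R => phi (t * x) * w x)}.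
Proof.
move=> x; apply: continuousM; last exact: cw.
apply: continuous_subspaceT => {}x; apply: continuous_comp; last exact: cphi.
by apply: cvgM; [exact: cvg_cst|exact: cvg_id].
Qed.

Lemma integrable_trig_mul t :
  lam.-integrable `[-1, 1] (EFin \o (fun x : R => phi (t * x) * w x)).
Proof.
apply: continuous_compact_integrable; first exact: segment_compact.
exact: within_continuous_trig_mul.
Qed.

(** Differentiation under the integral: on [-1, 1] the factors [psi], x and w are at most 1, so the
    constant 1 dominates. Stated for a pair (phi, psi) to cover both the first and the second
    derivative of [bessel0]. *)
Lemma is_derive_trig_integral (t : R) :
  is_derive t 1 (fun s => \int[lam]_(x in `[-1, 1]) (phi (s * x) * w x))
    (\int[lam]_(x in `[-1, 1]) (psi (t * x) * (x * w x))).
Proof.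
have df (s y : R) : is_derive s 1 (fun s => phi (s * y) * w y) (psi (s * y) * (y * w y)).
  have d1 : is_derive s 1 (fun s => s * y) y.
    by apply: is_derive_eq; rewrite scaler0 add0r /GRing.scale /= mulr1.
  have d2 : is_derive s 1 (phi \o (fun s => s * y)) (psi (s * y) * y).
    exact: (@is_derive1_comp _ phi (fun s => s * y) s _ _ (dphi _) d1).
  have d3 := is_deriveM d2 (is_derive_cst (w y) s 1).
  apply: (is_derive_eq d3).
  by rewrite scaler0 add0r /GRing.scale /=; ring.
have p1E s y : partial1of2 (fun s x => phi (s * x) * w x) s y = psi (s * y) * (y * w y).
  by rewrite partial1of2E; apply: (@derive_val _ _ _ _ _ _ _ (df s y)).
have t_in : t \in `]t - 1, t + 1[ by rewrite in_itv /= ltrBlDr ltrDl ltr01.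
have i1 (s : R) : s \in `]t - 1, t + 1[ -> lam.-integrable `[-1, 1]
    (EFin \o (fun x : R => phi (s * x) * w x)) by move=> _; exact: integrable_trig_mul.
have d1 (s y : R) : s \in `]t - 1, t + 1[ -> `[-1, 1]%classic y ->
    derivable (fun s : R => phi (s * y) * w y) s 1.
  by move=> _ _; exact: (@ex_derive _ _ _ _ _ _ _ (df s y)).
have iG : lam.-integrable `[-1, 1] (EFin \o (fun _ : R => 1 : R)).
  apply: continuous_compact_integrable; first exact: segment_compact.
  by apply: continuous_subspaceT => x; exact: cvg_cst.
have G_ub (s y : R) : s \in `]t - 1, t + 1[ -> `[-1, 1]%classic y ->
    `|partial1of2 (fun s x => phi (s * x) * w x) s y| <= 1.
  move=> _ yI; rewrite p1E !normrM; apply: mulr_ile1 => //.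
  apply: mulr_ile1 => //; last exact: w_le1.
  by move: yI; rewrite /= in_itv /= ler_norml.
have mI : measurable (`[-1, 1]%classic : set (measurableTypeR R)) by exact: measurable_itv.
apply: DeriveDef.
  by apply: (@derivable_under_integral _ _ _ lam (fun s x => phi (s * x) * w x)
    _ mI t _ _ t_in i1 d1 (fun _ => 1)).
rewrite -derive1E (@differentiation_under_integral _ _ _ lam
  (fun s x => phi (s * x) * w x) _ mI t _ _ t_in i1 d1 (fun _ => 1)) //.
by apply: eq_Rintegral => y _; rewrite p1E.
Qed.

End trig_integral.

Section bessel.
Context {R : realType} (n : nat).
Local Notation lam := (@lebesgue_measure R).

Let u (x : R) : R := Num.sqrt (1 - x ^+ 2) ^+ n.
Let v (x : R) : R := Num.sqrt (1 - x ^+ 2) ^+ n.+2.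

(* Up to a constant, the Fourier transform of the unit ball of R^(n+1) at a
   vector of norm t. *)
Definition bessel0 (t : R) : R := \int[lam]_(x in `[-1, 1]) (cos (t * x) * u x).
Definition bessel1 (t : R) : R := \int[lam]_(x in `[-1, 1]) (- sin (t * x) * (x * u x)).
Definition bessel2 (t : R) : R := \int[lam]_(x in `[-1, 1]) (- cos (t * x) * (x * (x * u x))).

Let cs : continuous (fun x : R => Num.sqrt (1 - x ^+ 2)).
Proof.
move=> x; apply: (@continuous_comp _ _ _ (fun x : R => 1 - x ^+ 2) (@Num.sqrt R)); last exact: sqrt_continuous.
apply: cvgB; first exact: cvg_cst.
exact: exprn_continuous.
Qed.

Let csX k : continuous (fun x : R => Num.sqrt (1 - x ^+ 2) ^+ k).
Proof.
move=> x; apply: (@continuous_comp _ _ _ (fun x : R => Num.sqrt (1 - x ^+ 2)) (fun y => y ^+ k)).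
  exact: cs.
exact: exprn_continuous.
Qed.

Let cu : continuous u. Proof. exact: csX. Qed.

Let u_le1 x : x \in `[-1, 1] -> `|u x| <= 1.
Proof.
move=> xI; rewrite normrX exprn_ile1 // ger0_norm ?sqrtr_ge0 //.
by rewrite -[leRHS]sqrtr1 ler_wsqrtr // gerBl sqr_ge0.
Qed.

Let xu_le1 x : x \in `[-1, 1] -> `|x * u x| <= 1.
Proof.
move=> xI; rewrite normrM mulr_ile1 ?u_le1 //.
by move: xI; rewrite in_itv /= ler_norml.
Qed.

Let cxu : continuous (fun x : R => x * u x).
Proof. by move=> x; apply: cvgM; [exact: cvg_id|exact: cu]. Qed.

Lemma is_derive_bessel0 (t : R) : is_derive t 1 bessel0 (bessel1 t).
Proof.
apply: (@is_derive_trig_integral R cos (fun x : R => - sin x)).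
- by move=> x; rewrite normrN ler_norml sin_geN1 sin_le1.
- exact: continuous_subspaceT.
- exact: u_le1.
Qed.

Lemma is_derive_bessel1 (t : R) : is_derive t 1 bessel1 (bessel2 t).
Proof.
apply: (@is_derive_trig_integral R (fun x : R => - sin x) (fun x : R => - cos x)).
- by move=> x; rewrite normrN ler_norml cos_geN1 cos_le1.
- exact: continuous_subspaceT.
- exact: xu_le1.
Qed.

(** Bessel's equation t (f + f'') = - (n + 2) f' for f = [bessel0 n]. As (1 - x^2) u = v, the sum f
    + f'' is the integral of cos (t x) v(x); integrating by parts with v' = - (n + 2) x u and v = 0
    at the endpoints gives f'. *)
Lemma bessel_ode (t : R) : t * (bessel0 t + bessel2 t) = - n.+2%:R * bessel1 t.
Proof.
have c2 k (w : R -> R) : continuous w ->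
    lam.-integrable `[-1, 1] (EFin \o (fun x : R => cos (k * x) * w x)).
  move=> cw; apply: continuous_compact_integrable; first exact: segment_compact.
  apply: continuous_subspaceT => x; apply: cvgM; last exact: cw.
  apply: (@continuous_comp _ _ _ (fun x : R => k * x) cos); last exact: continuous_cos.
  by apply: cvgM; [exact: cvg_cst|exact: cvg_id].
have c3 k (w : R -> R) : continuous w ->
    lam.-integrable `[-1, 1] (EFin \o (fun x : R => sin (k * x) * w x)).
  move=> cw; apply: continuous_compact_integrable; first exact: segment_compact.
  apply: continuous_subspaceT => x; apply: cvgM; last exact: cw.
  apply: (@continuous_comp _ _ _ (fun x : R => k * x) sin); last exact: continuous_sin.
  by apply: cvgM; [exact: cvg_cst|exact: cvg_id].
have mI : measurable (`[-1, 1]%classic : set (measurableTypeR R)) by exact: measurable_itv.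
have cxxu : continuous (fun x : R => x * (x * u x)).
  by move=> x; apply: cvgM; [exact: cvg_id|exact: cxu].
have cv : continuous v by exact: csX.
have e1 : bessel0 t + bessel2 t = \int[lam]_(x in `[-1, 1]) (cos (t * x) * v x).
  have -> : bessel2 t = \int[lam]_(x in `[-1, 1]) ((-1) * (cos (t * x) * (x * (x * u x)))).
    by apply: eq_Rintegral => x _; ring.
  rewrite RintegralZl //; last exact: c2.
  rewrite mulN1r -RintegralB //; [|exact: c2|exact: c2].
  apply: eq_Rintegral => x; rewrite inE /= => xI.
  have x1 : 0 <= 1 - x ^+ 2.
    rewrite subr_ge0 -real_normK ?num_real // exprn_ile1 //.
    by move: xI; rewrite in_itv /= ler_norml.
  rewrite /v /u -[n.+2]addn2 exprD (sqr_sqrtr x1); ring.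
have ibp := @Rintegration_by_parts R (fun x : R => sin (t * x)) v (fun x : R => t * cos (t * x))
  (fun x : R => - n.+2%:R * (x * u x)) (-1) 1.
have {ibp} : \int[lam]_(x in `[-1, 1]) (sin (t * x) * (- n.+2%:R * (x * u x))) =
    - \int[lam]_(x in `[-1, 1]) (t * cos (t * x) * v x).
  have ds (x : R) : is_derive x 1 (fun x : R => sin (t * x)) (t * cos (t * x)).
    have d1 : is_derive x 1 (fun s => t * s) t.
      by apply: (is_derive_eq (is_deriveZ t (is_derive_id x 1))); rewrite /GRing.scale /= mulr1.
    apply: (is_derive_eq (@is_derive1_comp _ sin (fun s => t * s) x _ _ (is_derive_sin _) d1)).
    exact: mulrC.
  have css : continuous (fun x : R => sin (t * x)).
    move=> x; apply: (@continuous_comp _ _ _ (fun x : R => t * x) sin); last exact: continuous_sin.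
    by apply: cvgM; [exact: cvg_cst|exact: cvg_id].
  (* Only in the open interval: the chain rule fails at the endpoints, where the argument of the
     square root vanishes. *)
  have dv (x : R) : x \in `]-1, 1[ -> is_derive x 1 v (- n.+2%:R * (x * u x)).
    rewrite in_itv /= => /andP[x1 x2].
    have px : 0 < 1 - x ^+ 2 by rewrite (_ : _ - _ = (1 - x) * (1 + x)); [apply: mulr_gt0; lra|ring].
    have d1 : is_derive x 1 (fun x : R => 1 - x ^+ 2) (- (2 * x)).
      rewrite (_ : (fun x : R => _) = cst 1 - (@id R) ^+ 2) //.
      apply: (is_derive_eq (is_deriveB (is_derive_cst _ _ _) (is_deriveX 2 (is_derive_id x 1)))).
      by rewrite /GRing.scale /= expr1 mulr1 sub0r.
    have d2 := @is_derive1_comp _ Num.sqrt _ x _ _ (is_derive1_sqrt px) d1.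
    rewrite (_ : v = (Num.sqrt \o (fun x : R => 1 - x ^+ 2)) ^+ n.+2); last first.
      by apply/funext => y; rewrite !fctE.
    apply: (is_derive_eq (is_deriveX n.+2 d2)).
    have s0 : Num.sqrt (1 - x ^+ 2) != 0 by rewrite gt_eqF // sqrtr_gt0.
    by rewrite /GRing.scale /= exprS /u; field.
  rewrite ibp.
  - by rewrite /v expr1n sqrrN expr1n subrr sqrtr0 exprS mul0r !mulr0 subrr sub0r.
  - exact: lt_trans (ltrN10 R) ltr01.
  - apply: continuous_subspaceT => x; apply: cvgM; first exact: cvg_cst.
    apply: (@continuous_comp _ _ _ (fun x : R => t * x) cos); last exact: continuous_cos.
    by apply: cvgM; [exact: cvg_cst|exact: cvg_id].
  - split; [by move=> x _; exact: (@ex_derive _ _ _ _ _ _ _ (ds x))| |].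
      by apply: cvg_at_right_filter; exact: css.
    by apply: cvg_at_left_filter; exact: css.
  - by move=> x _; rewrite derive1E; exact: (@derive_val _ _ _ _ _ _ _ (ds x)).
  - apply: continuous_subspaceT => x; apply: cvgM; first exact: cvg_cst.
    exact: cxu.
  - split; [|by apply: cvg_at_right_filter; exact: cv|by apply: cvg_at_left_filter; exact: cv].
    by move=> x xI; exact: (@ex_derive _ _ _ _ _ _ _ (dv x xI)).
  - by move=> x xI; rewrite derive1E; exact: (@derive_val _ _ _ _ _ _ _ (dv x xI)).
have -> : \int[lam]_(x in `[-1, 1]) (sin (t * x) * (- n.+2%:R * (x * u x))) =
    \int[lam]_(x in `[-1, 1]) (- n.+2%:R * (sin (t * x) * (x * u x))).
  by apply: eq_Rintegral => x _; ring.
have -> : \int[lam]_(x in `[-1, 1]) (t * cos (t * x) * v x) =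
    \int[lam]_(x in `[-1, 1]) (t * (cos (t * x) * v x)).
  by apply: eq_Rintegral => x _; ring.
rewrite RintegralZl //; last exact: (c2 t v cv).
rewrite RintegralZl //; last exact: (c3 t (fun x : R => x * u x) cxu).
rewrite e1 => /eqP; rewrite -eqr_oppLR => /eqP <-.
have -> : bessel1 t = \int[lam]_(x in `[-1, 1]) ((-1) * (sin (t * x) * (x * u x))).
  by apply: eq_Rintegral => x _; ring.
rewrite RintegralZl //; last exact: (c3 t (fun x : R => x * u x) cxu).
ring.
Qed.

(* The energy of Bessel's equation in Liouville normal form; the factor
   exp (c / t) below absorbs the lower order term and makes it nonincreasing. *)
Let E (t : R) : R := t ^+ n.+2 * ((bessel1 t + n.+2%:R * bessel0 t / (2 * t)) ^+ 2 + bessel0 t ^+ 2).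
Let c : R := n.+2%:R * n%:R / 4.

Lemma bessel_energy_decr (t : R) : 0 < t -> exists2 D : R,
  is_derive t 1 (fun t => E t * expR (c / t)) D & D <= 0.
Proof.
move=> t0; have tn0 : t != 0 by rewrite gt_eqF.
have h0 := is_derive_bessel0 t; have h1 := is_derive_bessel1 t.
have hV : is_derive t 1 (fun t : R => t^-1) (- t ^- 2 *: 1) by apply: is_deriveV.
have hX : is_derive t 1 (fun t : R => t ^+ n.+2) ((n.+2%:R * t ^+ n.+1) *: 1).
  rewrite (_ : (fun t : R => t ^+ n.+2) = (@id R) ^+ n.+2); last by apply/funext => y; rewrite fctE.
  exact: (is_deriveX _ (is_derive_id t 1)).
pose D1 := n.+2%:R * t ^+ n.+1 * ((bessel1 t + n.+2%:R * bessel0 t / (2 * t)) ^+ 2 + bessel0 t ^+ 2)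
  + t ^+ n.+2 * (2 * (bessel1 t + n.+2%:R * bessel0 t / (2 * t)) *
     (bessel2 t + n.+2%:R / 2 * (bessel1 t / t - bessel0 t / t ^+ 2)) + 2 * bessel0 t * bessel1 t).
have dA : is_derive t 1 (fun t : R => bessel1 t + n.+2%:R * bessel0 t / (2 * t))
   (bessel2 t + n.+2%:R / 2 * (bessel1 t / t - bessel0 t / t ^+ 2)).
  rewrite (_ : (fun t => _) = bessel1 + (n.+2%:R / 2) *: (bessel0 * (fun t : R => t^-1))); last first.
    by apply/funext => x; rewrite !fctE /GRing.scale /= invfM; ring.
  apply: (is_derive_eq (is_deriveD h1 (is_deriveZ _ (is_deriveM h0 hV)))).
  by rewrite /GRing.scale /=; field.
have dE : is_derive t 1 E D1.
  rewrite (_ : E = (fun t : R => t ^+ n.+2) * ((fun t : R => bessel1 t + n.+2%:R * bessel0 t / (2 * t)) ^+ 2 + bessel0 ^+ 2)); last first.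
    by apply/funext => x; rewrite !fctE.
  apply: (is_derive_eq (is_deriveM hX (is_deriveD (is_deriveX 2 dA) (is_deriveX 2 h0)))).
  by rewrite /D1 !fctE /GRing.scale /=; ring.
have dx : is_derive t 1 (fun t => expR (c / t)) (expR (c / t) * (c * - t ^- 2)).
  apply: (@is_derive1_comp _ expR (fun t => c / t)).
  rewrite (_ : (fun t : R => c / t) = c *: (fun t : R => t^-1)) //.
  by apply: (is_derive_eq (is_deriveZ _ hV)); rewrite /GRing.scale /= mulr1.
exists (D1 * expR (c / t) + E t * (expR (c / t) * (c * - t ^- 2))).
  apply: (is_derive_eq (is_deriveM dE dx)).
  by rewrite /GRing.scale /=; ring.
have b2 : bessel2 t = - bessel0 t - n.+2%:R * bessel1 t / t.
  have := bessel_ode t => /(congr1 (fun z => z / t)).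
  rewrite mulrAC divff // mul1r => e; rewrite -(addrK (bessel0 t) (bessel2 t)) addrC.
  by rewrite (addrC (bessel2 t)) e; ring.
(* For g = t^((n+2)/2) f, Bessel's equation reads g'' + (1 - c/t^2) g = 0, which is where c comes
   from, and E = g^2 + g'^2. Hence E' = 2 c g g' / t^2, and the factor exp (c/t) completes this to
   the negative square - c (g' - g)^2 / t^2. *)
rewrite (_ : _ + _ = - (c * t ^+ n * expR (c / t) * (bessel1 t + n.+2%:R * bessel0 t / (2 * t) - bessel0 t) ^+ 2)).
  rewrite oppr_le0 mulr_ge0 ?sqr_ge0 // mulr_ge0 ?expR_ge0 //.
  by apply: mulr_ge0; [rewrite /c divr_ge0 // mulr_ge0|rewrite exprn_ge0 // ltW].
rewrite /D1 /E b2 /c !exprS -!natr1.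
by field.
Qed.

(** The energy is at most exp(c) times its value at 1, and it dominates t^(n+2) f(t)^2. For d = n +
    1 the exponent is d + 1, the decay of the squared transform of a ball. *)
Lemma bessel_decay : exists2 K : R, 0 <= K & forall t : R, 1 <= t -> bessel0 t ^+ 2 <= K / t ^+ n.+2.
Proof.
have E_ge0 (t : R) : 0 < t -> 0 <= E t.
  by move=> t0; rewrite mulr_ge0 ?exprn_ge0 ?addr_ge0 ?sqr_ge0 ?ltW.
exists (E 1 * expR c); first by rewrite mulr_ge0 ?expR_ge0 ?E_ge0.
move=> t t1; have t0 : 0 < t by apply: lt_le_trans t1.
rewrite ler_pdivlMr ?exprn_gt0 // mulrC.
apply: (@le_trans _ _ (E t)).
  by rewrite /E ler_wpM2l ?exprn_ge0 ?lerDr ?sqr_ge0 // ltW.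
apply: (@le_trans _ _ (E t * expR (c / t))).
  rewrite ler_peMr ?E_ge0 // -expR0 ler_expR.
  by apply: divr_ge0; [rewrite /c divr_ge0 // mulr_ge0|exact: ltW].
rewrite -[X in _ <= E 1 * expR X]divr1.
have dd (x : R) : 1 <= x -> derivable (fun t => E t * expR (c / t)) x 1.
  move=> x1; have [|D dD _] := @bessel_energy_decr x; first exact: lt_le_trans x1.
  exact: (@ex_derive _ _ _ _ _ _ _ dD).
apply: (@ler0_derive1_nincr R (fun t => E t * expR (c / t)) 1 t) => //.
- by move=> x; rewrite in_itv /= => /andP[/ltW x1 _]; exact: dd.
- move=> x; rewrite in_itv /= => /andP[x1 _].
  have [|D dD D0] := @bessel_energy_decr x; first exact: lt_trans x1.
  by rewrite derive1E (@derive_val _ _ _ _ _ _ _ dD).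
- apply: derivable_within_continuous => x; rewrite in_itv /= => /andP[x1 _].
  exact: dd.
Qed.

End bessel.

(** * Covariance inequalities under mixing *)

Section dyadic_digits.
Context {R : realType}.

(* The binary expansion writes a [0,1]-valued variable as a countable
   combination of indicators, reducing covariances to those of events. *)
Fixpoint dyadic_rem (n : nat) (x : R) : R :=
  if n is m.+1 then
    dyadic_rem m x - 2^-1 ^+ n * ((2^-1 : R) ^+ n <= dyadic_rem m x)%R%:R
  else x.

Definition dyadic_digit n : set R := [set x | 2^-1 ^+ n.+1 <= dyadic_rem n x].

Lemma measurable_dyadic_rem n : measurable_fun setT (dyadic_rem n).
Proof.
elim: n => [|n IH] /=; first exact: measurable_id.
apply: measurable_funB => //; apply: measurable_funM => //.
rewrite (_ : (fun x => _) = (fun x => \1_(dyadic_rem n @^-1` `[2^-1 ^+ n.+1, +oo[) x)).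
  apply: measurable_indic; rewrite -[X in measurable X]setTI; exact: IH.
apply/funext => x; rewrite indicE; congr (nat_of_bool _)%:R.
by apply/idP/idP; rewrite inE /= in_itv /= andbT.
Qed.

Lemma measurable_dyadic_digit n : measurable (dyadic_digit n).
Proof.
rewrite (_ : dyadic_digit n = dyadic_rem n @^-1` `[2^-1 ^+ n.+1, +oo[).
  rewrite -[X in measurable X]setTI; exact: measurable_dyadic_rem.
by apply/seteqP; split => x; rewrite /dyadic_digit /= in_itv /= andbT.
Qed.

Lemma dyadic_remE n x :
  x = \sum_(k < n) 2^-1 ^+ k.+1 * \1_(dyadic_digit k) x + dyadic_rem n x.
Proof.
elim: n => [|n IH]; first by rewrite big_ord0 add0r.
rewrite big_ord_recr /= [LHS]IH -!addrA; congr (_ + _).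
rewrite (_ : \1_(dyadic_digit n) x = ((2^-1 : R) ^+ n.+1 <= dyadic_rem n x)%R%:R); first by ring.
by rewrite indicE; congr (nat_of_bool _)%:R; apply/idP/idP; rewrite inE.
Qed.

Lemma dyadic_rem_bound n x : 0 <= x <= 1 -> 0 <= dyadic_rem n x <= 2^-1 ^+ n.
Proof.
move=> x01; elim: n => [|n /andP[h0 h1]] /=; first by rewrite expr0.
have e : 2^-1 ^+ n = 2 * 2^-1 ^+ n.+1 :> R by rewrite exprS mulrA mulfV // mul1r.
by case: (leP (2^-1 ^+ n.+1) (dyadic_rem n x)); rewrite ?mulr1 ?mulr0; move: (2^-1 ^+ n.+1) (2^-1 ^+ n) e h0 h1 => a b; lra.
Qed.

Lemma dyadic_rem_le n x : dyadic_rem n x <= x.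
Proof.
elim: n => [|n IH] //=; apply: le_trans IH.
by rewrite gerBl mulr_ge0 // exprn_ge0 // invr_ge0.
Qed.

(** The remainders never exceed x, so a digit can be 1 only if x is at least the weight of that
    digit. This bounds the probability of a digit by a tail probability of x. *)
Lemma dyadic_digit_ge n x : dyadic_digit n x -> 2^-1 ^+ n.+1 <= x.
Proof. by move=> h; exact: le_trans (dyadic_rem_le n x). Qed.

End dyadic_digits.

Section covariance.
Context {disp} {T : measurableType disp} {R : realType} (P : probability T R).

Definition bounded_mfun (f : T -> R) : Prop :=
  measurable_fun setT f /\ exists M, forall w, `|f w| <= M.

Definition Ex (f : T -> R) : R := \int[P]_w f w.
Definition Cov (f g : T -> R) : R := Ex (fun w => f w * g w) - Ex f * Ex g.

Lemma bounded_mfun_integrable f : bounded_mfun f -> P.-integrable setT (EFin \o f).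
Proof.
move=> [mf [M fM]]; apply: measurable_bounded_integrable => //.
  by apply: (le_lt_trans (probability_le1 P measurableT)); exact: ltry.
exists M; split; first exact: num_real.
by move=> x Mx w _; apply: le_trans (fM w) (ltW Mx).
Qed.

Lemma bounded_mfun_cst c : bounded_mfun (fun _ => c).
Proof. by split; [exact: measurable_cst|exists `|c|]. Qed.

Lemma bounded_mfunD f g : bounded_mfun f -> bounded_mfun g ->
  bounded_mfun (fun w => f w + g w).
Proof.
move=> [mf [M fM]] [mg [N gN]]; split; first exact: measurable_funD.
by exists (M + N) => w; apply: le_trans (ler_normD _ _) _; exact: lerD.
Qed.

Lemma bounded_mfunM f g : bounded_mfun f -> bounded_mfun g ->
  bounded_mfun (fun w => f w * g w).
Proof.
move=> [mf [M fM]] [mg [N gN]]; split; first exact: measurable_funM.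
by exists (M * N) => w; rewrite normrM; apply: ler_pM.
Qed.

Lemma bounded_mfunZ c f : bounded_mfun f -> bounded_mfun (fun w => c * f w).
Proof. by move=> ?; apply: bounded_mfunM => //; exact: bounded_mfun_cst. Qed.

Lemma bounded_mfunB f g : bounded_mfun f -> bounded_mfun g ->
  bounded_mfun (fun w => f w - g w).
Proof.
move=> bf [mg [N gN]]; apply: bounded_mfunD => //.
by split; [exact: measurableT_comp|exists N => w; rewrite normrN].
Qed.

Lemma bounded_mfun_sum n (c : nat -> R) (f : nat -> T -> R) :
  (forall k, bounded_mfun (f k)) ->
  bounded_mfun (fun w => \sum_(k < n) c k * f k w).
Proof.
move=> bf; elim: n => [|n IH].
  by under eq_fun do rewrite big_ord0; exact: bounded_mfun_cst.
under eq_fun do rewrite big_ord_recr /=.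
by apply: bounded_mfunD => //; exact: bounded_mfunZ.
Qed.

Lemma ExD f g : bounded_mfun f -> bounded_mfun g ->
  Ex (fun w => f w + g w) = Ex f + Ex g.
Proof. by move=> bf bg; rewrite /Ex RintegralD //; exact: bounded_mfun_integrable. Qed.

Lemma ExB f g : bounded_mfun f -> bounded_mfun g ->
  Ex (fun w => f w - g w) = Ex f - Ex g.
Proof. by move=> bf bg; rewrite /Ex RintegralB //; exact: bounded_mfun_integrable. Qed.

Lemma ExZ c f : bounded_mfun f -> Ex (fun w => c * f w) = c * Ex f.
Proof. by move=> bf; rewrite /Ex RintegralZl //; exact: bounded_mfun_integrable. Qed.

Lemma Ex_cst c : Ex (fun _ => c) = c.
Proof.
rewrite /Ex Rintegral_cst // -[RHS]mulr1; congr (_ * _).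
exact: (congr1 fine (probability_setT P)).
Qed.

Lemma Ex_norm_le f M : bounded_mfun f -> (forall w, `|f w| <= M) -> `|Ex f| <= M.
Proof.
move=> bf fM; apply: (le_trans (le_normr_Rintegral measurableT (bounded_mfun_integrable bf))).
rewrite -[leRHS](Ex_cst M); apply: le_Rintegral => //.
  exact: integrable_norm (bounded_mfun_integrable bf).
exact: bounded_mfun_integrable (bounded_mfun_cst M).
Qed.

Lemma CovC f g : Cov f g = Cov g f.
Proof. by rewrite /Cov mulrC; congr (Ex _ - _); apply/funext => w; rewrite mulrC. Qed.

Lemma CovDl f g h : bounded_mfun f -> bounded_mfun g -> bounded_mfun h ->
  Cov (fun w => f w + g w) h = Cov f h + Cov g h.
Proof.
move=> bf bg bh; rewrite /Cov ExD //; under eq_fun do rewrite mulrDl.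
by rewrite ExD; [ring|exact: bounded_mfunM|exact: bounded_mfunM].
Qed.

Lemma CovZl c f h : bounded_mfun f -> bounded_mfun h ->
  Cov (fun w => c * f w) h = c * Cov f h.
Proof.
move=> bf bh; rewrite /Cov ExZ //; under eq_fun do rewrite -mulrA.
by rewrite ExZ; [ring|exact: bounded_mfunM].
Qed.

Lemma Cov_cstl c h : bounded_mfun h -> Cov (fun _ => c) h = 0.
Proof. by move=> bh; rewrite /Cov ExZ // Ex_cst subrr. Qed.

Lemma CovBl f g h : bounded_mfun f -> bounded_mfun g -> bounded_mfun h ->
  Cov (fun w => f w - g w) h = Cov f h - Cov g h.
Proof.
move=> bf bg bh; rewrite /Cov ExB //; under eq_fun do rewrite mulrBl.
by rewrite ExB; [ring|exact: bounded_mfunM|exact: bounded_mfunM].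
Qed.

Lemma Cov_suml n (c : nat -> R) (f : nat -> T -> R) h :
  (forall k, bounded_mfun (f k)) -> bounded_mfun h ->
  Cov (fun w => \sum_(k < n) c k * f k w) h = \sum_(k < n) c k * Cov (f k) h.
Proof.
move=> bf bh; elim: n => [|n IH].
  by under eq_fun do rewrite big_ord0; rewrite Cov_cstl // big_ord0.
under eq_fun do rewrite big_ord_recr /=.
rewrite CovDl //; [|exact: bounded_mfun_sum|exact: bounded_mfunZ].
by rewrite IH CovZl // big_ord_recr.
Qed.

Lemma Cov_norm_le f g M N : bounded_mfun f -> bounded_mfun g ->
  (forall w, `|f w| <= M) -> (forall w, `|g w| <= N) -> `|Cov f g| <= 2 * (M * N).
Proof.
move=> bf bg fM gN; apply: (le_trans (ler_normB _ _)).
rewrite mulr_natl mulr2n; apply: lerD.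
  apply: Ex_norm_le; first exact: bounded_mfunM.
  by move=> w; rewrite normrM; apply: ler_pM.
by rewrite normrM; apply: ler_pM => //; exact: Ex_norm_le.
Qed.

Lemma Ex_indic (A : set T) : measurable A -> Ex (\1_A) = fine (P A).
Proof. by move=> mA; rewrite /Ex /Rintegral integral_indic // setIT. Qed.

Lemma bounded_mfun_indic (A : set T) : measurable A -> bounded_mfun (\1_A).
Proof.
move=> mA; split; first exact: measurable_indic.
by exists 1 => w; rewrite indicE; case: (_ \in _); rewrite ?normr1 ?normr0.
Qed.

Lemma Cov_indic_min (A B : set T) : measurable A -> measurable B ->
  `|Cov (\1_A) (\1_B)| <= fine (P A) /\ `|Cov (\1_A) (\1_B)| <= fine (P B).
Proof.
move=> mA mB; have mAB : measurable (A `&` B) by exact: measurableI.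
have -> : Cov (\1_A) (\1_B) = fine (P (A `&` B)) - fine (P A) * fine (P B).
  rewrite /Cov !Ex_indic // -(Ex_indic mAB); congr (_ - _).
  by congr Ex; apply/funext => w; rewrite indicI.
have pA : 0 <= fine (P A) by rewrite fine_ge0.
have pB : 0 <= fine (P B) by rewrite fine_ge0.
have pAB : 0 <= fine (P (A `&` B)) by rewrite fine_ge0.
have f1 (C : set T) : measurable C -> fine (P C) <= 1.
  by move=> mC; rewrite -lee_fin fineK ?fin_num_measure // probability_le1.
have hA := f1 _ mA; have hB := f1 _ mB.
have hABA : fine (P (A `&` B)) <= fine (P A).
  by apply: fine_le; rewrite ?fin_num_measure // le_measure ?inE.
have hABB : fine (P (A `&` B)) <= fine (P B).
  by apply: fine_le; rewrite ?fin_num_measure // le_measure ?inE.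
have m1 : fine (P A) * fine (P B) <= fine (P A) by rewrite ler_piMr.
have m2 : fine (P A) * fine (P B) <= fine (P B) by rewrite ler_piMl.
by rewrite !ler_norml; split; apply/andP; split; nra.
Qed.

(* The covariance is at most alpha, P A and P B; interpolate. *)
Lemma Cov_indic_interp (A B : set T) (alpha a1 a2 : R) :
  measurable A -> measurable B -> 0 < a1 -> 0 < a2 -> a1 + (a2 + a2) = 1 ->
  `|Cov (\1_A) (\1_B)| <= alpha ->
  `|Cov (\1_A) (\1_B)| <= alpha `^ a1 * (fine (P A) `^ a2 * fine (P B) `^ a2).
Proof.
move=> mA mB a1_gt0 a2_gt0 a12 hal; have [hA hB] := Cov_indic_min mA mB.
set x := `|Cov _ _| in hal hA hB *.
have x0 : 0 <= x by exact: normr_ge0.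
have [->|xn0] := eqVneq x 0; first by rewrite !mulr_ge0 // powR_ge0.
rewrite -[leLHS](powRr1 x0) -a12 !powRD; [|by rewrite xn0 implybT|by rewrite xn0 implybT].
have mono (a y : R) : 0 < a -> x <= y -> x `^ a <= y `^ a.
  by move=> a0 xy; apply: ge0_ler_powR => //; rewrite ?nnegrE ?(le_trans x0 xy) // ltW.
apply: ler_pM; [exact: powR_ge0|by rewrite mulr_ge0 ?powR_ge0|exact: mono|].
by apply: ler_pM; [exact: powR_ge0|exact: powR_ge0|exact: mono|exact: mono].
Qed.

Section mixing.
Variables (U V : T -> R) (alpha a1 a2 : R).
Hypotheses (mU : measurable_fun setT U) (mV : measurable_fun setT V).
Hypotheses (a1_gt0 : 0 < a1) (a2_gt0 : 0 < a2) (a12 : a1 + (a2 + a2) = 1).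
Hypothesis mixing : forall A B : set R, measurable A -> measurable B ->
  `|fine (P (U @^-1` A `&` V @^-1` B)) - fine (P (U @^-1` A)) * fine (P (V @^-1` B))| <= alpha.

(** Truncate both binary expansions at n digits. The covariance of the truncations is a double sum
    of covariances of events; interpolation bounds each by a product of a term in k and a term in j,
    so the double sum factorizes into [BU] and [BV]. The remainders vanish as n grows, because both
    bounds are uniform in n. *)
Lemma Cov_mixing_unit (f g : R -> R) (BU BV : R) :
  measurable_fun setT f -> measurable_fun setT g ->
  (forall x, 0 <= f x <= 1) -> (forall x, 0 <= g x <= 1) ->
  (forall n, \sum_(k < n) 2^-1 ^+ k.+1 *
     fine (P [set w | 2^-1 ^+ k.+1 <= f (U w)]) `^ a2 <= BU) ->
  (forall n, \sum_(k < n) 2^-1 ^+ k.+1 *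
     fine (P [set w | 2^-1 ^+ k.+1 <= g (V w)]) `^ a2 <= BV) ->
  `|Cov (f \o U) (g \o V)| <= alpha `^ a1 * (BU * BV).
Proof.
move=> mf mg f01 g01 hBU hBV.
have mpre (h : T -> R) (D : set R) : measurable_fun setT h -> measurable D -> measurable (h @^-1` D).
  by move=> mh mD; rewrite -[X in measurable X]setTI; exact: mh.
have mfU : measurable_fun setT (f \o U) by exact: measurableT_comp.
have mgV : measurable_fun setT (g \o V) by exact: measurableT_comp.
pose AU k := (f \o U) @^-1` dyadic_digit k; pose AV k := (g \o V) @^-1` dyadic_digit k.
have mAU k : measurable (AU k) by apply: mpre => //; exact: measurable_dyadic_digit.
have mAV k : measurable (AV k) by apply: mpre => //; exact: measurable_dyadic_digit.
have b01 (h : R -> R) (W : T -> R) : measurable_fun setT (h \o W) ->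
    (forall x, 0 <= h x <= 1) -> bounded_mfun (h \o W).
  move=> mh h01; split => //; exists 1 => w; have /andP[h0 h1] := h01 (W w).
  by rewrite ger0_norm.
have bf := b01 _ _ mfU f01; have bg := b01 _ _ mgV g01.
pose SU n w : R := \sum_(k < n) 2^-1 ^+ k.+1 * \1_(AU k) w.
pose SV n w : R := \sum_(k < n) 2^-1 ^+ k.+1 * \1_(AV k) w.
have bSU n : bounded_mfun (SU n).
  by apply: (@bounded_mfun_sum n (fun k => 2^-1 ^+ k.+1) (fun k => \1_(AU k))) => k; exact: bounded_mfun_indic.
have bSV n : bounded_mfun (SV n).
  by apply: (@bounded_mfun_sum n (fun k => 2^-1 ^+ k.+1) (fun k => \1_(AV k))) => k; exact: bounded_mfun_indic.
have eU n w : f (U w) = SU n w + dyadic_rem n (f (U w)) by exact: dyadic_remE.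
have eV n w : g (V w) = SV n w + dyadic_rem n (g (V w)) by exact: dyadic_remE.
have rU n w := dyadic_rem_bound n (f01 (U w)).
have rV n w := dyadic_rem_bound n (g01 (V w)).
have BU0 : 0 <= BU by have := hBU 0%N; rewrite big_ord0.
have BV0 : 0 <= BV by have := hBV 0%N; rewrite big_ord0.
have PmonoU k : fine (P (AU k)) <= fine (P [set w | 2^-1 ^+ k.+1 <= f (U w)]).
  have mC : measurable [set w | 2^-1 ^+ k.+1 <= f (U w)].
    rewrite (_ : [set w | _] = (f \o U) @^-1` `[2^-1 ^+ k.+1, +oo[); first exact: mpre.
    by apply/seteqP; split => w; rewrite /= in_itv /= andbT.
  apply: fine_le; rewrite ?fin_num_measure //; apply: le_measure; rewrite ?inE //.
  by move=> w; exact: dyadic_digit_ge.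
have PmonoV k : fine (P (AV k)) <= fine (P [set w | 2^-1 ^+ k.+1 <= g (V w)]).
  have mC : measurable [set w | 2^-1 ^+ k.+1 <= g (V w)].
    rewrite (_ : [set w | _] = (g \o V) @^-1` `[2^-1 ^+ k.+1, +oo[); first exact: mpre.
    by apply/seteqP; split => w; rewrite /= in_itv /= andbT.
  apply: fine_le; rewrite ?fin_num_measure //; apply: le_measure; rewrite ?inE //.
  by move=> w; exact: dyadic_digit_ge.
have covS n : `|Cov (SU n) (SV n)| <= alpha `^ a1 * (BU * BV).
  rewrite (@Cov_suml n (fun k => 2^-1 ^+ k.+1) (fun k => \1_(AU k))) //; last first.
    by move=> k; exact: bounded_mfun_indic.
  under eq_bigr => k _.
    rewrite CovC (@Cov_suml n (fun k => 2^-1 ^+ k.+1) (fun k => \1_(AV k))) //; [|by move=> j; exact: bounded_mfun_indic|exact: bounded_mfun_indic].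
    over.
  apply: (le_trans (ler_norm_sum _ _ _)).
  apply: (@le_trans _ _ (\sum_(k < n) \sum_(j < n) alpha `^ a1 *
      ((2^-1 ^+ k.+1 * fine (P [set w | 2^-1 ^+ k.+1 <= f (U w)]) `^ a2) *
       (2^-1 ^+ j.+1 * fine (P [set w | 2^-1 ^+ j.+1 <= g (V w)]) `^ a2)))).
    apply: ler_sum => k _; rewrite normrM ger0_norm ?exprn_ge0 ?invr_ge0 //.
    apply: (@le_trans _ _ (2^-1 ^+ k.+1 * \sum_(j < n) 2^-1 ^+ j.+1 * `|Cov (\1_(AV j)) (\1_(AU k))|)).
      rewrite ler_wpM2l ?exprn_ge0 ?invr_ge0 //; apply: (le_trans (ler_norm_sum _ _ _)).
      by apply: ler_sum => j _; rewrite normrM ger0_norm ?exprn_ge0 ?invr_ge0.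
    rewrite mulr_sumr; apply: ler_sum => j _; rewrite CovC.
    have hc : `|Cov (\1_(AU k)) (\1_(AV j))| <= alpha `^ a1 * (fine (P (AU k)) `^ a2 * fine (P (AV j)) `^ a2).
      apply: Cov_indic_interp => //.
      have -> : Cov (\1_(AU k)) (\1_(AV j)) = fine (P (AU k `&` AV j)) - fine (P (AU k)) * fine (P (AV j)).
        rewrite /Cov !Ex_indic // -(Ex_indic (measurableI _ _ (mAU k) (mAV j))).
        by congr (_ - _); congr Ex; apply/funext => w; rewrite indicI.
      apply: (mixing (A := f @^-1` dyadic_digit k) (B := g @^-1` dyadic_digit j)).
        by rewrite -[X in measurable X]setTI; apply: mf => //; exact: measurable_dyadic_digit.
      by rewrite -[X in measurable X]setTI; apply: mg => //; exact: measurable_dyadic_digit.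
    have hp : alpha `^ a1 * (fine (P (AU k)) `^ a2 * fine (P (AV j)) `^ a2) <=
       alpha `^ a1 * (fine (P [set w | 2^-1 ^+ k.+1 <= f (U w)]) `^ a2 * fine (P [set w | 2^-1 ^+ j.+1 <= g (V w)]) `^ a2).
      rewrite ler_wpM2l ?powR_ge0 //; apply: ler_pM; rewrite ?powR_ge0 //.
        by apply: ge0_ler_powR; rewrite ?nnegrE ?fine_ge0 // ltW.
      by apply: ge0_ler_powR; rewrite ?nnegrE ?fine_ge0 // ltW.
    have h2 := le_trans hc hp.
    rewrite mulrA; have w0 : 0 <= 2^-1 ^+ k.+1 * 2^-1 ^+ j.+1 :> R.
      by rewrite mulr_ge0 // exprn_ge0 // invr_ge0.
    apply: le_trans (ler_wpM2l w0 h2) _; rewrite le_eqVlt; apply/orP; left; apply/eqP; ring.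
  rewrite (_ : \sum_(k < n) _ = alpha `^ a1 * ((\sum_(k < n) 2^-1 ^+ k.+1 *
     fine (P [set w | 2^-1 ^+ k.+1 <= f (U w)]) `^ a2) * (\sum_(k < n) 2^-1 ^+ k.+1 *
     fine (P [set w | 2^-1 ^+ k.+1 <= g (V w)]) `^ a2))).
    rewrite ler_wpM2l ?powR_ge0 //; apply: ler_pM => //;
    by apply: sumr_ge0 => k _; rewrite mulr_ge0 ?powR_ge0 // exprn_ge0 // invr_ge0.
  rewrite mulr_suml mulr_sumr; apply: eq_bigr => k _.
  by rewrite !mulr_sumr; apply: eq_bigr => j _; ring.
apply/ler_addgt0Pr => e e0.
(* Two covariances with a remainder at most 2^-n have to be absorbed, each costing at most 2 times
   2^-n; whence e/4. *)
have [n hn] : exists n : nat, 2^-1 ^+ n < e / 4.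
  have e40 : 0 < e / 4 by rewrite divr_gt0.
  have [n _ /(_ n (leqnn n))] := near_infty_natSinv_expn_lt (PosNum e40).
  by rewrite /= div1r -exprVn => ?; exists n.
have p0 : 0 <= 2^-1 ^+ n :> R by rewrite exprn_ge0 // invr_ge0.
(* Replace f(U) by its truncation first, then g(V). *)
have -> : Cov (f \o U) (g \o V) = Cov (SU n) (SV n) +
    (Cov (fun w => f (U w) - SU n w) (g \o V) + Cov (fun w => g (V w) - SV n w) (SU n)).
  rewrite !CovBl // (CovC (SV n)) (CovC (g \o V)); ring.
apply: (le_trans (ler_normD _ _)); apply: lerD; first exact: covS.
apply: (le_trans (ler_normD _ _)).
have SU1 w : `|SU n w| <= 1.
  have := eU n w; have /andP[r0 r1] := rU n w; have /andP[f0 f1] := f01 (U w).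
  have s0 : 0 <= SU n w.
    by apply: sumr_ge0 => k _; rewrite mulr_ge0 ?exprn_ge0 ?invr_ge0 // indicE.
  by move=> ?; rewrite ger0_norm //; lra.
have c1 : `|Cov (fun w => f (U w) - SU n w) (g \o V)| <= 2 * (2^-1 ^+ n * 1).
  apply: Cov_norm_le => //; first exact: bounded_mfunB.
    move=> w; rewrite {1}(eU n w) addrAC subrr add0r.
    by have /andP[r0 r1] := rU n w; rewrite ger0_norm.
  by move=> w; have /andP[r0 r1] := g01 (V w); rewrite ger0_norm.
have c2 : `|Cov (fun w => g (V w) - SV n w) (SU n)| <= 2 * (2^-1 ^+ n * 1).
  apply: Cov_norm_le => //; first exact: bounded_mfunB.
  move=> w; rewrite {1}(eV n w) addrAC subrr add0r.
  by have /andP[r0 r1] := rV n w; rewrite ger0_norm.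
apply: (le_trans (lerD c1 c2)); rewrite !mulr1 -mulrDl; lra.
Qed.

End mixing.
End covariance.

Section trig_bounds.
Context {R : realType}.

Lemma powR_exprn (a y : R) k : 0 <= a -> (a ^+ k) `^ y = (a `^ y) ^+ k.
Proof. by move=> a0; elim: k => [|k IH]; rewrite ?expr0 ?powR1 // !exprS powRM ?exprn_ge0 // IH. Qed.

Lemma norm_sin_le (u : R) : `|sin u| <= `|u|.
Proof.
have h (x : R) : 0 <= x -> `|sin x| <= x.
  move=> x0; have [c _] := MVT_segment x0 (fun y _ => is_derive_sin y)
    (continuous_subspaceT (@continuous_sin R)).
  rewrite sin0 !subr0 => ->; rewrite normrM (ger0_norm x0) ler_piMl //.
  exact: cos_max.
have [u0|u0] := leP 0 u; first by rewrite (ger0_norm u0); exact: h.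
by rewrite (ltr0_norm u0) -normrN -sinN; apply: h; rewrite oppr_ge0 ltW.
Qed.

Lemma one_sub_cos_le (u : R) : 1 - cos u <= `|u|.
Proof.
have h (x : R) : 0 <= x -> 1 - cos x <= x.
  move=> x0; have [c _] := MVT_segment x0 (fun y _ => is_derive_cos y)
    (continuous_subspaceT (@continuous_cos R)).
  rewrite cos0 subr0 -opprB => /eqP; rewrite eqr_oppLR mulNr opprK => /eqP ->.
  by rewrite ler_piMl // sin_le1.
by have := h `|u| (normr_ge0 u); rewrite cos_norm.
Qed.

End trig_bounds.

(** * Covariances of trigonometric functions *)

Section mixing_trig.
Context {disp} {T : measurableType disp} {R : realType} (P : probability T R).
Local Notation Ex := (Ex P).
Local Notation Cov := (Cov P).

(** What Markov's inequality gives for a variable with E|U|^Q <= m^Q. *)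
Definition tail_bound (U : T -> R) (Q m : R) : Prop :=
  forall t : R, 0 < t -> fine (P [set w | t <= `|U w|]) <= (m / t) `^ Q.

(** The geometric series of ratio 2^(eta - 1), convergent for eta < 1. In the application eta = t/2,
    which is the origin of the restriction t < 2. *)
Definition geom_const (eta : R) : R := (1 - 2 `^ eta / 2)^-1.

Lemma geom_ratio (eta : R) : eta < 1 -> 0 <= (2 `^ eta / 2 : R) < 1.
Proof.
move=> e1; rewrite divr_ge0 ?powR_ge0 //= ltr_pdivrMr // mul1r.
rewrite /powR (gt_eqF (ltr0n R 2)) -[X in _ < X](@lnK R) ?posrE // ltr_expR.
by rewrite -[X in _ < X]mul1r ltr_pM2r // ln_gt0 // ltr1n.
Qed.

Lemma geom_const_ge1 eta : eta < 1 -> 1 <= geom_const eta.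
Proof.
move=> /geom_ratio /andP[h0 h1]; rewrite /geom_const -[leLHS]invr1.
by rewrite lef_pV2 ?posrE; lra.
Qed.

Lemma sum_geom_le (r : R) n : 0 <= r < 1 -> \sum_(k < n) r ^+ k.+1 <= (1 - r)^-1.
Proof.
move=> /andP[r0 r1]; have p : 0 < 1 - r by rewrite subr_gt0.
rewrite -[leRHS]mul1r ler_pdivlMr //.
have -> : (\sum_(k < n) r ^+ k.+1) * (1 - r) = r - r ^+ n.+1.
  elim: n => [|n IH]; first by rewrite big_ord0 mul0r expr1 subrr.
  by rewrite big_ord_recr /= mulrDl IH (exprS r n.+1); ring.
have := exprn_ge0 n.+1 r0; lra.
Qed.

(** Bounding all probabilities by 1 leaves the sum of the 2^-(k+1), at most 1. The tail bound
    instead turns the k-th term into m^(Q a2) times (2^(Q a2) / 2)^(k+1), a geometric series since Q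
    a2 < 1. *)
Lemma dyadic_tail_sum (U : T -> R) (f : R -> R) (Q a2 m : R) n :
  measurable_fun setT U -> measurable_fun setT f ->
  (forall u, f u <= `|u|) -> 0 < Q -> 0 < a2 -> Q * a2 < 1 -> 0 <= m ->
  tail_bound U Q m ->
  \sum_(k < n) 2^-1 ^+ k.+1 * fine (P [set w | 2^-1 ^+ k.+1 <= f (U w)]) `^ a2
    <= geom_const (Q * a2) * Num.min 1 (m `^ (Q * a2)).
Proof.
move=> mU mf fu Q0 a20 Qa m0 tU.
have /andP[r0 r1] := geom_ratio Qa.
have ha1 : 0 <= geom_const (Q * a2) by apply: le_trans (geom_const_ge1 Qa).
have mE k : measurable [set w | 2^-1 ^+ k.+1 <= f (U w)].
  rewrite (_ : [set w | _] = (f \o U) @^-1` `[2^-1 ^+ k.+1, +oo[).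
    by rewrite -[X in measurable X]setTI; exact: (measurableT_comp mf mU).
  by apply/seteqP; split => w; rewrite /= in_itv /= andbT.
have mE' t : measurable [set w | t <= `|U w|].
  rewrite (_ : [set w | _] = (Num.norm \o U) @^-1` `[t, +oo[).
    by rewrite -[X in measurable X]setTI; exact: (measurableT_comp (@normr_measurable R setT) mU).
  by apply/seteqP; split => w; rewrite /= in_itv /= andbT.
rewrite minr_pMr // le_min mulr1; apply/andP; split.
  apply: le_trans (geom_const_ge1 Qa).
  have e1 : (1 : R) `^ a2 = 1 by rewrite powR1.
  apply: (@le_trans _ _ (\sum_(k < n) (2^-1 : R) ^+ k.+1)).
    apply: ler_sum => k _; rewrite ler_piMr ?exprn_ge0 ?invr_ge0 //.
    rewrite -[leRHS]e1; apply: ge0_ler_powR; [exact: ltW|by rewrite nnegrE fine_ge0|by rewrite nnegrE|].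
    by rewrite -lee_fin fineK ?fin_num_measure // probability_le1.
  have -> : (\sum_(k < n) (2^-1 : R) ^+ k.+1) = 1 - 2^-1 ^+ n.
    elim: n => [|n IH]; first by rewrite big_ord0 expr0 subrr.
    by rewrite big_ord_recr /= IH exprS; field.
  by rewrite gerBl exprn_ge0 // invr_ge0.
apply: (@le_trans _ _ (\sum_(k < n) m `^ (Q * a2) * (2 `^ (Q * a2) / 2) ^+ k.+1)).
  apply: ler_sum => k _.
  have p2 : 0 < 2^-1 ^+ k.+1 :> R by rewrite exprn_gt0 // invr_gt0.
  apply: (@le_trans _ _ (2^-1 ^+ k.+1 * (m * 2 ^+ k.+1) `^ (Q * a2))).
    rewrite ler_wpM2l ?(ltW p2) // powRrM; apply: ge0_ler_powR; [exact: ltW|by rewrite nnegrE fine_ge0|by rewrite nnegrE powR_ge0|].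
    apply: (@le_trans _ _ (fine (P [set w | 2^-1 ^+ k.+1 <= `|U w|]))).
      apply: fine_le; rewrite ?fin_num_measure //; apply: le_measure; rewrite ?inE //.
      by move=> w /= h; exact: le_trans h (fu _).
    by have := tU _ p2; rewrite exprVn invrK.
  rewrite powRM ?exprn_ge0 // le_eqVlt; apply/orP; left; apply/eqP.
  have -> : (2 ^+ k.+1) `^ (Q * a2) = (2 `^ (Q * a2)) ^+ k.+1 :> R.
    exact: powR_exprn.
  by rewrite expr_div_n exprVn; ring.
rewrite -mulr_sumr mulrC ler_wpM2r ?powR_ge0 //.
by apply: sum_geom_le; rewrite r0 r1.
Qed.

(** Building blocks with values in [0, 1] and bounded by |u|, the form asked for by the digit
    expansion: the cosine is 1 - 4 times part 0, the sine is 2 times the difference of parts 1 and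
    2. *)
Definition trig_part (i : 'I_3) (u : R) : R :=
  match val i with
  | 0 => (1 - cos u) / 4
  | 1 => Num.max (sin u) 0 / 2
  | _ => Num.max (- sin u) 0 / 2
  end.

Lemma measurable_trig_part i : measurable_fun setT (trig_part i).
Proof.
have mc : measurable_fun setT (@cos R) by apply: continuous_measurable_fun; exact: continuous_cos.
have ms : measurable_fun setT (@sin R) by apply: continuous_measurable_fun; exact: continuous_sin.
case: i => -[|[|[|//]]] ? /=; rewrite /trig_part /=.
- by apply: measurable_funM => //; apply: measurable_funB.
- by apply: measurable_funM => //; apply: measurable_maxr.
- by apply: measurable_funM => //; apply: measurable_maxr => //; exact: measurableT_comp.
Qed.

Lemma trig_part_bounds i u : 0 <= trig_part i u <= 1 /\ trig_part i u <= `|u|.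
Proof.
have c1 := cos_le1 u; have c2 := cos_geN1 u; have c3 := one_sub_cos_le u.
have s1 := sin_le1 u; have s2 := sin_geN1 u; have := norm_sin_le u.
rewrite ler_norml => /andP[s3 s4]; have := normr_ge0 u.
case: i => -[|[|[|//]]] ? /= n0; rewrite /trig_part /=; split; try (apply/andP; split); try lra.
all: by rewrite ?maxEle; case: ifP => ?; lra.
Qed.

(** The subtracted expression is E cos (c + V' - U) for a copy V' of V independent of U, expanded by
    the addition formulas. The difference is thus a combination of four covariances of sines and
    cosines. *)
Lemma mixing_cos (U V : T -> R) (alpha a1 a2 Q m c : R) :
  measurable_fun setT U -> measurable_fun setT V ->
  0 < a1 -> 0 < a2 -> a1 + (a2 + a2) = 1 ->
  (forall A B : set R, measurable A -> measurable B ->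
  `|fine (P (U @^-1` A `&` V @^-1` B)) - fine (P (U @^-1` A)) * fine (P (V @^-1` B))| <= alpha) ->
  0 < Q -> Q * a2 < 1 -> 0 <= m -> tail_bound U Q m -> tail_bound V Q m ->
  `|Ex (fun w => cos (c + (V w - U w))) -
    (cos c * (Ex (cos \o V) * Ex (cos \o U) + Ex (sin \o V) * Ex (sin \o U)) -
     sin c * (Ex (sin \o V) * Ex (cos \o U) - Ex (cos \o V) * Ex (sin \o U)))| <=
  64 * geom_const (Q * a2) ^+ 2 * alpha `^ a1 * Num.min 1 (m `^ (Q * a2)) ^+ 2.
Proof.
move=> mU mV a10 a20 a12 mix Q0 Qa m0 tU tV.
have bW (h : R -> R) (W : T -> R) : measurable_fun setT W -> measurable_fun setT h ->
    (forall x, `|h x| <= 1) -> bounded_mfun (h \o W).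
  by move=> mW mh h1; split; [exact: measurableT_comp|exists 1 => w; exact: h1].
have mc : measurable_fun setT (@cos R) by apply: continuous_measurable_fun; exact: continuous_cos.
have ms : measurable_fun setT (@sin R) by apply: continuous_measurable_fun; exact: continuous_sin.
have sin_max (x : R) : `|sin x| <= 1 by rewrite ler_norml sin_geN1 sin_le1.
have bcU := bW _ _ mU mc (@cos_max R); have bcV := bW _ _ mV mc (@cos_max R).
have bsU := bW _ _ mU ms sin_max; have bsV := bW _ _ mV ms sin_max.
have bp i (W : T -> R) : measurable_fun setT W -> bounded_mfun (trig_part i \o W).
  move=> mW; apply: (bW (trig_part i) W) => //; first exact: measurable_trig_part.
  by move=> x; have [/andP[h0 h1] _] := trig_part_bounds i x; rewrite ger0_norm.
set kap := alpha `^ a1 * ((geom_const (Q * a2) * Num.min 1 (m `^ (Q * a2))) ^+ 2).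
have ck i j : `|Cov (trig_part i \o U) (trig_part j \o V)| <= kap.
  rewrite /kap expr2; apply: (Cov_mixing_unit mU mV a10 a20 a12 mix).
  - exact: measurable_trig_part.
  - exact: measurable_trig_part.
  - by move=> x; have [] := trig_part_bounds i x.
  - by move=> x; have [] := trig_part_bounds j x.
  - move=> n; apply: dyadic_tail_sum => //; first exact: measurable_trig_part.
    by move=> x; have [] := trig_part_bounds i x.
  - move=> n; apply: dyadic_tail_sum => //; first exact: measurable_trig_part.
    by move=> x; have [] := trig_part_bounds j x.
pose i0 : 'I_3 := @Ordinal 3 0 isT; pose i1 : 'I_3 := @Ordinal 3 1 isT.
pose i2 : 'I_3 := @Ordinal 3 2 isT.
have cosE (W : T -> R) : (cos \o W : T -> R) = (fun w => 1 - 4 * (trig_part i0 \o W) w).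
  by apply/funext => w; rewrite /= /trig_part /=; field.
have sinE (W : T -> R) : (sin \o W : T -> R) = (fun w => 2 * (trig_part i1 \o W) w - 2 * (trig_part i2 \o W) w).
  apply/funext => w; rewrite /= /trig_part /= !maxEle.
  by case: ifP => h1; case: ifP => h2; lra.
have bcst := @bounded_mfun_cst _ T R 1.
have bZ k i (W : T -> R) : measurable_fun setT W -> bounded_mfun (fun w => k * (trig_part i \o W) w).
  by move=> mW; apply: bounded_mfunZ; exact: bp.
have CovBr f g h : bounded_mfun f -> bounded_mfun g -> bounded_mfun h ->
    Cov h (fun w => f w - g w) = Cov h f - Cov h g.
  by move=> *; rewrite !(CovC _ h) CovBl.
have CovZr k f h : bounded_mfun f -> bounded_mfun h ->
    Cov h (fun w => k * f w) = k * Cov h f.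
  by move=> *; rewrite !(CovC _ h) CovZl.
have Cov_cstr k h : bounded_mfun h -> Cov h (fun _ => k) = 0.
  by move=> *; rewrite CovC Cov_cstl.
(* Each of the four covariances is at most 16 kap: one term with factor 16 for cosine and cosine,
   four with factor 4 for sine and sine, two with factor 8 in the mixed cases. *)
have kcc : `|Cov (cos \o U) (cos \o V)| <= 16 * kap.
  have bB : bounded_mfun (fun w => 1 - 4 * (trig_part i0 \o V) w) by rewrite -cosE.
  rewrite !cosE CovBl ?Cov_cstl ?CovZl //; do ?[exact: bZ|exact: bp].
  rewrite CovBr ?Cov_cstr ?CovZr //; do ?[exact: bZ|exact: bp].
  rewrite !sub0r !mulrN !opprK mulrA normrM.
  by rewrite (_ : `|4 * 4| = 16) ?ler_wpM2l ?ck // -natrM normr_nat.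
have kss : `|Cov (sin \o U) (sin \o V)| <= 16 * kap.
  have bB : bounded_mfun (fun w => 2 * (trig_part i1 \o V) w - 2 * (trig_part i2 \o V) w) by rewrite -sinE.
  rewrite !sinE CovBl ?CovZl //; do ?[exact: bZ|exact: bp].
  rewrite !CovBr ?CovZr //; do ?[exact: bZ|exact: bp].
  have h11 := ck i1 i1; have h12 := ck i1 i2; have h21 := ck i2 i1; have h22 := ck i2 i2.
  move: h11 h12 h21 h22; rewrite !ler_norml => /andP[? ?] /andP[? ?] /andP[? ?] /andP[? ?].
  by apply/andP; split; lra.
have ksc : `|Cov (sin \o U) (cos \o V)| <= 16 * kap.
  have bB : bounded_mfun (fun w => 1 - 4 * (trig_part i0 \o V) w) by rewrite -cosE.
  rewrite sinE cosE CovBl ?CovZl //; do ?[exact: bZ|exact: bp].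
  rewrite !CovBr ?Cov_cstr ?CovZr //; do ?[exact: bZ|exact: bp].
  have h11 := ck i1 i0; have h12 := ck i2 i0.
  move: h11 h12; rewrite !ler_norml => /andP[? ?] /andP[? ?].
  by apply/andP; split; lra.
have kcs : `|Cov (cos \o U) (sin \o V)| <= 16 * kap.
  have bB : bounded_mfun (fun w => 2 * (trig_part i1 \o V) w - 2 * (trig_part i2 \o V) w) by rewrite -sinE.
  rewrite sinE cosE CovBl ?Cov_cstl ?CovZl //; do ?[exact: bZ|exact: bp].
  rewrite !CovBr ?CovZr //; do ?[exact: bZ|exact: bp].
  have h11 := ck i0 i1; have h12 := ck i0 i2.
  move: h11 h12; rewrite !ler_norml => /andP[? ?] /andP[? ?].
  by apply/andP; split; lra.
have -> : Ex (fun w => cos (c + (V w - U w))) =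
   cos c * (Ex (fun w => cos (U w) * cos (V w)) + Ex (fun w => sin (U w) * sin (V w))) -
   sin c * (Ex (fun w => cos (U w) * sin (V w)) - Ex (fun w => sin (U w) * cos (V w))).
  rewrite -ExD ?[X in _ - sin c * X]/_; do ?[exact: bounded_mfunM].
  rewrite -ExB; do ?[exact: bounded_mfunM].
  have bA : bounded_mfun (fun w => cos (U w) * cos (V w) + sin (U w) * sin (V w)).
    by apply: bounded_mfunD; exact: bounded_mfunM.
  have bC : bounded_mfun (fun w => cos (U w) * sin (V w) - sin (U w) * cos (V w)).
    by apply: bounded_mfunB; exact: bounded_mfunM.
  rewrite -!ExZ // -ExB; [|exact: bounded_mfunZ|exact: bounded_mfunZ].
  by congr Ex; apply/funext => w; rewrite cosD cosB sinB; ring.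
rewrite (_ : _ - _ = cos c * (Cov (cos \o U) (cos \o V) + Cov (sin \o U) (sin \o V)) -
   sin c * (Cov (cos \o U) (sin \o V) - Cov (sin \o U) (cos \o V))); last first.
  by rewrite /Cov /=; ring.
rewrite (_ : 64 * _ * _ * _ = 32 * kap + 32 * kap); last by rewrite /kap; ring.
apply: (le_trans (ler_normB _ _)); apply: lerD.
  rewrite normrM -[leRHS]mul1r; apply: ler_pM => //; first exact: cos_max.
  apply: (le_trans (ler_normD _ _)); apply: le_trans (lerD kcc kss) _; lra.
rewrite normrM -[leRHS]mul1r; apply: ler_pM => //.
apply: (le_trans (ler_normB _ _)); apply: le_trans (lerD kcs ksc) _; lra.
Qed.

End mixing_trig.

(** * Fourier transform of the unit ball *)

Section integrable_on_finite.
Context {R : realType} {d : nat}.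
Local Notation bV := (borelV R d).

Lemma bounded_on_integrable (E : set bV) (f : bV -> R) (M : R) :
  measurable E -> (LV d E < +oo)%E -> measurable_fun setT f ->
  (forall x, `|f x| <= M) -> (LV d).-integrable E (EFin \o f).
Proof.
move=> mE fE mf fM; apply: measurable_bounded_integrable => //.
  exact: measurable_funS mf.
exists M; split; first exact: num_real.
by move=> x Mx w _; apply: le_trans (fM w) (ltW Mx).
Qed.

Lemma measurable_dotv (u : 'rV[R]_d) : measurable_fun setT (fun x : bV => dotv u (x : 'rV[R]_d)).
Proof.
apply: measurable_sum => k; apply: measurable_funM => //; exact: measurable_coord.
Qed.

Lemma measurable_cos_dotv (u : 'rV[R]_d) :
  measurable_fun setT (fun x : bV => cos (dotv u (x : 'rV[R]_d))).
Proof.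
apply: (measurableT_comp (f := @cos R)); last exact: measurable_dotv.
by apply: continuous_measurable_fun; exact: continuous_cos.
Qed.

Lemma Rintegral_mulmx (M : 'M[R]_d) (c : R) : 0 < c ->
  (forall B : set bV, measurable B ->
    LV d [set y | B ((y : 'rV[R]_d) *m M)] = (c%:E * LV d B)%E) ->
  forall (E : set bV) (f : bV -> R), measurable E ->
  (LV d).-integrable E (EFin \o f) ->
  \int[LV d]_(y in [set y | E ((y : 'rV[R]_d) *m M)]) f ((y : 'rV[R]_d) *m M) =
  c * \int[LV d]_(y in E) f y.
Proof.
move=> c0 cE E f mE fi; rewrite /Rintegral.
rewrite integral_mkcond (integral_mkcond E).
have fi' : (LV d).-integrable setT ((EFin \o f) \_ E).
  by apply/integrable_restrict; rewrite ?setTI.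
have fin : (\int[LV d]_x ((EFin \o f) \_ E) x \is a fin_num)%E.
  exact: integrable_fin_num.
transitivity (fine (c%:E * \int[LV d]_x ((EFin \o f) \_ E) x)%E); last by rewrite fineM.
congr fine; rewrite -(integral_mulmx c0 cE fi').
apply: eq_integral => x _; rewrite !patchE.
by rewrite (_ : (x \in _) = ((x : 'rV[R]_d) *m M \in E)) //; apply/idP/idP; rewrite !inE.
Qed.

End integrable_on_finite.

Section ball_fourier.
Context {R : realType} (n : nat).
Local Notation lam := (@lebesgue_measure R).
Local Notation bV := (borelV R n.+1).

Let e0 : 'rV[R]_n.+1 := delta_mx 0 0.

Lemma dotv_e0 x : dotv e0 x = x 0 0.
Proof.
rewrite /dotv (bigD1 0) //= mxE !eqxx mul1r big1 ?addr0 // => j j0.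
by rewrite mxE eqxx /= (negbTE j0) mul0r.
Qed.

(** Radius 0 is included because the slices of the unit ball at first coordinate 1 and -1 have it.
    For k = 0 the convention 0^0 = 1 gives the right value, the mass of the one-point space. *)
Lemma LV_eball_ge0 k (r : R) : 0 <= r -> LV k (@eballV R k r) = (@unit_ball_volume R k * r ^+ k)%:E.
Proof.
rewrite le_eqVlt => /orP[/eqP <-|]; last exact: LV_eball.
have -> : @eballV R k 0 = cube 0.
  apply/seteqP; split => x; rewrite /eballV /eball /=.
    move=> x0; apply/cubeP => j; apply: (le_trans (coord_le_enorm x j) x0).
  by move=> /cubeP h; have := enorm_le_box h; rewrite mulr0.
rewrite LV_cube // mulr0; case: k => [|k]; last by rewrite !expr0n /= !mulr0n mulr0.
rewrite !expr0 mulr1 /unit_ball_volume.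
have -> : @eballV R 0 1 = cube 0.
  apply/seteqP; split => x; last by move=> _; rewrite /eballV /eball /enorm /= big_ord0 sqrtr0.
  by move=> _; apply/cubeP => -[].
by rewrite LV_cube.
Qed.

(** The condition s^2 <= r^2 cannot be dropped: for |s| > r the square root takes the value 0 and
    the second condition alone would still admit y = 0. *)
Lemma eball_glue (r s : R) (y : 'rV[R]_n) : 0 <= r ->
  eballV r (glue (s, y)) <-> (s ^+ 2 <= r ^+ 2) /\ eballV (Num.sqrt (r ^+ 2 - s ^+ 2)) y.
Proof.
move=> r0; have e : dotv (glue (s, y) : 'rV[R]_n.+1) (glue (s, y)) = s ^+ 2 + dotv y y.
  rewrite /dotv big_ord_recl glue0 -expr2; congr (_ + _).
  by apply: eq_bigr => j _; rewrite glueS.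
have h (z : R) : 0 <= z -> (Num.sqrt z <= r) = (z <= r ^+ 2).
  by move=> z0; rewrite -{1}(ger0_norm r0) -sqrtr_sqr ler_sqrt // sqr_ge0.
have y0 := dotvv_ge0 y.
rewrite /eballV /eball /= !enormE e h ?addr_ge0 ?sqr_ge0 //.
split => [hs|[h1]].
  have h1 : s ^+ 2 <= r ^+ 2 by apply: le_trans hs; rewrite lerDl.
  by split => //; rewrite ler_sqrt ?subr_ge0 // lerBrDl.
by rewrite ler_sqrt ?subr_ge0 // lerBrDl.
Qed.

(** Adding 1 makes the integrand nonnegative, so Tonelli slices the ball directly: the slice at
    height s is a ball of R^n of radius sqrt (1 - s^2). The constant 1 is removed in
    [ball_cos_coord] by comparison with t = 0. *)
Lemma ball_one_add_cos (t : R) :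
  (\int[LV n.+1]_(x in eballV 1) (1 + cos (t * (x : 'rV[R]_n.+1) 0 0))%:E =
  (@unit_ball_volume R n * (bessel0 n 0 + bessel0 n t))%:E)%E.
Proof.
pose I11 : set (measurableTypeR R) := `[-1, 1]%classic.
have mcos : measurable_fun setT (fun s : R => 1 + cos (t * s)).
  apply: measurable_funD => //; apply: (measurableT_comp (f := @cos R)).
    by apply: continuous_measurable_fun; exact: continuous_cos.
  exact: measurable_funM.
have cos_ge0 (s : R) : 0 <= 1 + cos (t * s) by have := cos_geN1 (t * s); lra.
pose F (x : bV) : R := \1_(eballV 1) x * (1 + cos (t * (x : 'rV[R]_n.+1) 0 0)).
have mF : measurable_fun setT F.
  apply: measurable_funM; first by apply: measurable_indic; exact: measurable_eball.
  exact: (measurableT_comp mcos (measurable_coord _)).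
transitivity (\int[LV n.+1]_x (F x)%:E)%E.
  rewrite integral_mkcond; apply: eq_integral => x _; rewrite patchE /F indicE.
  by case: (x \in _); rewrite ?mul1r ?mul0r.
rewrite ge0_integral_LVS; last 2 first.
- exact/measurable_EFinP.
- by move=> x; rewrite lee_fin mulr_ge0 // indicE.
pose u (s : R) : R := Num.sqrt (1 - s ^+ 2) ^+ n.
have inner (s : R) : (\int[LV n]_y (F (glue (s, y)))%:E =
    ((fun s : R => ((1 + cos (t * s)) * (@unit_ball_volume R n * u s))%:E) \_ I11) s)%E.
  have s1E : (s \in I11) = (s ^+ 2 <= 1).
    rewrite -[in RHS](expr1n _ 2) -real_normK ?num_real // ler_pXn2r ?nnegrE //.
    by rewrite ler_norml; apply/idP/idP; rewrite inE /I11 /= in_itv.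
  rewrite patchE s1E; case: ifPn => s1; last first.
    apply: integral0_eq => y _; rewrite /F glue0 indicE memNset ?mul0r //.
    by move=> /(eball_glue _ _ ler01)[]; rewrite expr1n (negbTE s1).
  pose B := @eballV R n (Num.sqrt (1 - s ^+ 2)).
  rewrite (eq_integral (fun y => (1 + cos (t * s))%:E * (\1_B y)%:E)%E); last first.
    move=> y _; rewrite /F glue0 -EFinM mulrC; congr (_ * _)%:E.
    rewrite !indicE; congr (nat_of_bool _)%:R; apply/idP/idP; rewrite !inE.
      by move=> /(eball_glue _ _ ler01)[_]; rewrite expr1n.
    by move=> h; apply/(eball_glue _ _ ler01); rewrite expr1n.
  have mB : measurable B by exact: measurable_eball.
  rewrite ge0_integralZl //.
  - rewrite integral_indic // setIT [RHS]EFinM; congr (_ * _)%E.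
    exact: LV_eball_ge0 (sqrtr_ge0 _).
  - by apply/measurable_EFinP; exact: measurable_indic.
under eq_integral do rewrite inner.
rewrite -integral_mkcond.
have cu : continuous u.
  move=> x; apply: (@continuous_comp _ _ _ (fun x : R => Num.sqrt (1 - x ^+ 2)) (fun y => y ^+ n)); last exact: exprn_continuous.
  apply: (@continuous_comp _ _ _ (fun x : R => 1 - x ^+ 2) (@Num.sqrt R)); last exact: sqrt_continuous.
  by apply: cvgB; [exact: cvg_cst|exact: exprn_continuous].
have iu k : lam.-integrable I11 (EFin \o (fun s : R => cos (k * s) * u s)).
  apply: continuous_compact_integrable; first exact: segment_compact.
  apply: continuous_subspaceT => x; apply: cvgM; last exact: cu.
  apply: (@continuous_comp _ _ _ (fun x => k * x) cos); last exact: continuous_cos.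
  by apply: cvgM; [exact: cvg_cst|exact: cvg_id].
have mI : measurable I11 by exact: measurable_itv.
have bE k : (\int[lam]_(s in I11) (cos (k * s) * u s)%:E = (bessel0 n k)%:E)%E.
  by rewrite /bessel0 /Rintegral fineK //; apply: integrable_fin_num => //; exact: iu.
have iD : lam.-integrable I11 (fun s : R => (cos (0 * s) * u s)%:E + (cos (t * s) * u s)%:E)%E.
  by apply: integrableD => //; exact: iu.
transitivity (\int[lam]_(s in I11) ((@unit_ball_volume R n)%:E * ((cos (0 * s) * u s)%:E + (cos (t * s) * u s)%:E))%E)%E.
  by apply: eq_integral => s _; rewrite -EFinD -EFinM mul0r cos0; congr EFin; ring.
rewrite integralZl // integralD //; [|exact: iu|exact: iu].
by rewrite !bE -EFinD -EFinM.
Qed.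

Lemma ball_cos_coord (t : R) :
  \int[LV n.+1]_(x in eballV 1) cos (t * (x : 'rV[R]_n.+1) 0 0) =
  @unit_ball_volume R n * bessel0 n t.
Proof.
have mE := @measurable_eball R n.+1 1.
have fE : (LV n.+1 (@eballV R n.+1 1) < +oo)%E by rewrite ltey_eq eball_fin_num.
have mc (k : R) : measurable_fun setT (fun x : bV => cos (k * (x : 'rV[R]_n.+1) 0 0)).
  apply: (measurableT_comp (f := @cos R)).
    by apply: continuous_measurable_fun; exact: continuous_cos.
  by apply: measurable_funM => //; exact: measurable_coord.
have ic k : (LV n.+1).-integrable (eballV 1) (EFin \o (fun x : bV => cos (k * (x : 'rV[R]_n.+1) 0 0))).
  by apply: (bounded_on_integrable mE fE (mc k)) => x; exact: cos_max.
have i1 : (LV n.+1).-integrable (eballV 1) (EFin \o (fun _ : bV => 1 : R)).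
  by apply: (bounded_on_integrable (M := 1) mE fE) => // x; rewrite normr1.
have h k : \int[LV n.+1]_(x in eballV 1) (1 : R) +
    \int[LV n.+1]_(x in eballV 1) cos (k * (x : 'rV[R]_n.+1) 0 0) =
    @unit_ball_volume R n * (bessel0 n 0 + bessel0 n k).
  by rewrite -RintegralD // /Rintegral ball_one_add_cos.
have h0 := h 0; have ht := h t.
have e : \int[LV n.+1]_(x in eballV 1) cos (0 * (x : 'rV[R]_n.+1) 0 0) =
    \int[LV n.+1]_(x in eballV 1) (1 : R).
  by apply: eq_Rintegral => x _; rewrite mul0r cos0.
by move: h0 ht; rewrite e; lra.
Qed.

Lemma enorm_e0 : enorm e0 = 1.
Proof. by rewrite enormE dotv_e0 mxE !eqxx sqrtr1. Qed.

(** The unit ball is invariant and has positive finite volume, which forces the constant of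
    [LV_mulmx] to be 1. *)
Lemma LV_isometry (M : 'M[R]_n.+1) : M \in unitmx -> (forall x, enorm (x *m M) = enorm x) ->
  forall B : set bV, measurable B -> LV n.+1 [set y | B ((y : 'rV[R]_n.+1) *m M)] = (1%:E * LV n.+1 B)%E.
Proof.
move=> uM eM; have [c c0 cE] := LV_mulmx uM.
suff <- : c = 1 by [].
have := cE _ (@measurable_eball R n.+1 1).
rewrite (_ : [set y : bV | _] = eballV 1); last first.
  by apply/seteqP; split => x; rewrite /eballV /eball /= eM.
rewrite LV_eball // expr1n mulr1 -EFinM => -[] /esym/eqP.
rewrite -subr_eq0 -{2}[unit_ball_volume]mul1r -mulrBl mulf_eq0 subr_eq0.
by rewrite (gt_eqF (@unit_ball_volume_gt0 R n.+1)) orbF => /eqP.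
Qed.

(** The reflection exchanging z and |z| e0 preserves the ball and reduces the claim to a frequency
    along the first axis. *)
Lemma ball_cos (z : 'rV[R]_n.+1) :
  \int[LV n.+1]_(x in eballV 1) cos (dotv z (x : 'rV[R]_n.+1)) =
  @unit_ball_volume R n * bessel0 n (enorm z).
Proof.
have mE := @measurable_eball R n.+1 1.
have fE : (LV n.+1 (@eballV R n.+1 1) < +oo)%E by rewrite ltey_eq eball_fin_num.
pose w := enorm z *: e0.
have zw : dotv z z = dotv w w.
  by rewrite -!sqr_enorm enormZ enorm_e0 mulr1 ger0_norm ?enorm_ge0.
have iso := LV_isometry (householder_unit (z - w)) (enorm_householder (z - w)).
have ic : (LV n.+1).-integrable (eballV 1) (EFin \o (fun x : bV => cos (dotv z (x : 'rV[R]_n.+1)))).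
  by apply: (bounded_on_integrable mE fE (measurable_cos_dotv z)) => x; exact: cos_max.
have := Rintegral_mulmx ltr01 iso mE ic; rewrite mul1r => <-.
rewrite -ball_cos_coord (_ : [set y : bV | _] = eballV 1); last first.
  by apply/seteqP; split => x; rewrite /eballV /eball /= enorm_householder.
by apply: eq_Rintegral => x _; rewrite dotvC dotv_householder // dotvZr dotvC dotv_e0.
Qed.

End ball_fourier.

(** * Fourier inversion for the covariogram *)

Section Rintegral_extra.
Context {disp} {T : measurableType disp} {R : realType} (mu : {measure set T -> \bar R}).

Lemma EFin_Rintegral (f : T -> R) : mu.-integrable setT (EFin \o f) ->
  (\int[mu]_x (f x)%:E)%E = (\int[mu]_x f x)%:E.
Proof. by move=> fi; rewrite /Rintegral fineK //; exact: integrable_fin_num. Qed.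

Lemma integrable_dom (f g : T -> R) : measurable_fun setT f ->
  (forall x, `|f x| <= g x) -> mu.-integrable setT (EFin \o g) ->
  mu.-integrable setT (EFin \o f).
Proof.
move=> mf fg; apply: le_integrable => //; first exact/measurable_EFinP.
by move=> x _; rewrite /= lee_fin (le_trans (fg x)) // ler_norm.
Qed.

Lemma integrable_mul_le1 (f b : T -> R) : measurable_fun setT b ->
  (forall x, `|b x| <= 1) -> mu.-integrable setT (EFin \o f) ->
  mu.-integrable setT (EFin \o (fun x => f x * b x)).
Proof.
move=> mb b1 fi; have mf : measurable_fun setT f by apply/measurable_EFinP; exact: measurable_int fi.
apply: (integrable_dom (g := fun x => `|f x|)).
- exact: measurable_funM.
- by move=> x; rewrite normrM ler_piMr.
- exact: integrable_norm.
Qed.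

Lemma integrableZl_fun (f : T -> R) c : mu.-integrable setT (EFin \o f) ->
  mu.-integrable setT (EFin \o (fun x => c * f x)).
Proof.
move=> fi; rewrite (_ : EFin \o _ = (fun x => c%:E * (EFin \o f) x)%E).
  exact: integrableZl.
by apply/funext => x /=; rewrite EFinM.
Qed.

Lemma Rintegral_dominated_convergence (f_ : nat -> T -> R) (f g : T -> R) :
  (forall n, measurable_fun setT (f_ n)) -> measurable_fun setT f ->
  (forall x, f_ ^~ x @ \oo --> f x) ->
  mu.-integrable setT (EFin \o g) -> (forall n x, `|f_ n x| <= g x) ->
  (fun n => \int[mu]_x f_ n x) @ \oo --> \int[mu]_x f x.
Proof.
move=> mf_ mf fcv gi fg.
have [|||||fi _ cv] := @dominated_convergence _ _ _ mu setT measurableT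
  (fun n => EFin \o f_ n) (EFin \o f) (EFin \o g).
- by move=> n; exact/measurable_EFinP.
- exact/measurable_EFinP.
- by apply: aeW => x _; apply: cvg_EFin; [exact: nearW|exact: fcv].
- exact: gi.
- by apply: aeW => x n _; rewrite /= lee_fin.
apply: fine_cvg; rewrite (_ : (\int[mu]_x f x)%:E = (\int[mu]_x (EFin \o f) x)%E).
  exact: cv.
by rewrite -EFin_Rintegral.
Qed.

End Rintegral_extra.

Section fubini_extra.
Context {d1 d2} {T1 : measurableType d1} {T2 : measurableType d2} {R : realType}.

(** No integrability is involved: positive and negative parts are handled by Tonelli, and [fine] is
    measurable. *)
Lemma measurable_Rintegral_param (m2 : {sigma_finite_measure set T2 -> \bar R}) (g : T1 * T2 -> R) :
  measurable_fun setT g -> measurable_fun setT (fun x => \int[m2]_y g (x, y)).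
Proof.
move=> mg; have mg' : measurable_fun setT (EFin \o g) by exact/measurable_EFinP.
rewrite /Rintegral; apply: (@measurableT_comp _ _ _ _ _ _ fine); first exact: fine_measurable.
under eq_fun => x do rewrite integralE.
apply: emeasurable_funB.
  apply: (eq_measurable_fun (fun x => \int[m2]_y ((EFin \o g)^\+ (x, y)))%E).
    move=> x _; apply: eq_integral => y _.
    exact: (esym (congr1 (@^~ y) (funepos_comp (EFin \o g) (pair x)))).
  by apply: measurable_fun_fubini_tonelli_F; [exact: measurable_funepos|exact: funepos_ge0].
apply: (eq_measurable_fun (fun x => \int[m2]_y ((EFin \o g)^\- (x, y)))%E).
  move=> x _; apply: eq_integral => y _.
  exact: (esym (congr1 (@^~ y) (funeneg_comp (EFin \o g) (pair x)))).
by apply: measurable_fun_fubini_tonelli_F; [exact: measurable_funeneg|exact: funeneg_ge0].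
Qed.

Variables (m1 : {sigma_finite_measure set T1 -> \bar R}) (m2 : {sigma_finite_measure set T2 -> \bar R}).
Variables (u : T1 -> R) (v : T2 -> R) (b : T1 * T2 -> R).
Hypotheses (ui : m1.-integrable setT (EFin \o u)) (vi : m2.-integrable setT (EFin \o v)).
Hypotheses (mb : measurable_fun setT b) (b1 : forall z, `|b z| <= 1).

Let mu' : measurable_fun setT u. Proof. by apply/measurable_EFinP; exact: measurable_int ui. Qed.
Let mv' : measurable_fun setT v. Proof. by apply/measurable_EFinP; exact: measurable_int vi. Qed.

Let f (z : T1 * T2) : R := u z.1 * (v z.2 * b z).

Let mf : measurable_fun setT f.
Proof.
apply: measurable_funM; first exact: (measurableT_comp mu' measurable_fst).
by apply: measurable_funM => //; exact: (measurableT_comp mv' measurable_snd).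
Qed.

Let vbi x : m2.-integrable setT (EFin \o (fun y => v y * b (x, y))).
Proof.
apply: integrable_mul_le1 => //; apply: (measurableT_comp mb); exact: pair1_measurable.
Qed.

Let ubi y : m1.-integrable setT (EFin \o (fun x => u x * b (x, y))).
Proof.
apply: integrable_mul_le1 => //; apply: (measurableT_comp mb); exact: pair2_measurable.
Qed.

Lemma integrable_prod_dom : (m1 \x m2)%E.-integrable setT (EFin \o f).
Proof.
apply/(integrable12ltyP m1 m2); first exact/measurable_EFinP.
apply: (@le_lt_trans _ _ (\int[m1]_x (`|u x|%:E * (\int[m2]_y `|v y|)%:E))%E).
  apply: ge0_le_integral => //.
  - by move=> x _; apply: integral_ge0.
  - apply: (measurable_fun_fubini_tonelli_F (fun z => `|(f z)%:E|)%E) => //.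
    by apply: measurableT_comp => //; exact/measurable_EFinP.
  - apply: emeasurable_funM => //; apply/measurable_EFinP; exact: measurableT_comp.
  - move=> x _; rewrite -EFin_Rintegral; last exact: integrable_norm vi.
    rewrite -ge0_integralZl //; last by apply/measurable_EFinP; exact: measurableT_comp.
    apply: ge0_le_integral => //.
    + apply: measurableT_comp => //; apply/measurable_EFinP.
      by apply: (measurableT_comp mf); exact: pair1_measurable.
    + by apply: emeasurable_funM => //; apply/measurable_EFinP; exact: measurableT_comp.
    + by move=> y _; rewrite -EFinM lee_fin /f /= !normrM ler_wpM2l // ler_piMr.
rewrite ge0_integralZr //; last 2 first.
- by apply/measurable_EFinP; exact: measurableT_comp.
- by rewrite lee_fin Rintegral_ge0.
have /integrableP[_ fu] := ui.
apply: lte_mul_pinfty; [exact: integral_ge0| |exact: ltry].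
by rewrite ge0_fin_numE; [exact: fu|exact: integral_ge0].
Qed.

(** A bounded kernel b against integrable u and v: the product |u(x)| |v(y)| dominates. Later
    exchanges of a Fourier kernel with an expectation or an integral take this form. *)
Lemma Rintegral_fubini_dom :
  \int[m1]_x (u x * \int[m2]_y (v y * b (x, y))) =
  \int[m2]_y (v y * \int[m1]_x (u x * b (x, y))).
Proof.
rewrite /Rintegral; congr fine.
transitivity (\int[m1]_x \int[m2]_y (EFin \o f) (x, y))%E.
  apply: eq_integral => x _; rewrite EFinM fineK; last by apply: integrable_fin_num => //; exact: vbi.
  by rewrite -integralZl; [apply: eq_integral => y _; rewrite -EFinM|exact: measurableT|exact: vbi].
rewrite Fubini; last exact: integrable_prod_dom.
apply: eq_integral => y _; rewrite EFinM fineK; last by apply: integrable_fin_num => //; exact: ubi.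
rewrite -integralZl //; last exact: ubi.
by apply: eq_integral => x _; rewrite -EFinM /f /=; congr EFin; ring.
Qed.

End fubini_extra.

Section tensor.
Context {R : realType}.
Local Notation lam := (@lebesgue_measure R).

Lemma integrable_tensor n (p : R -> R) (q : borelV R n -> R) (h : borelV R n.+1 -> R) :
  lam.-integrable setT (EFin \o p) -> (LV n).-integrable setT (EFin \o q) ->
  measurable_fun setT h -> (forall s y, h (glue (s, y)) = p s * q y) ->
  (LV n.+1).-integrable setT (EFin \o h).
Proof.
move=> ip iq mh hE; apply/integrableP; split; first exact/measurable_EFinP.
have mp : measurable_fun setT p by apply/measurable_EFinP; exact: measurable_int ip.
have mq : measurable_fun setT q by apply/measurable_EFinP; exact: measurable_int iq.
rewrite ge0_integral_LVS //; last by apply: measurableT_comp => //; exact/measurable_EFinP.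
rewrite (eq_integral (fun s : measurableTypeR R => `|p s|%:E * \int[LV n]_y `|q y|%:E)%E); last first.
  move=> s _; rewrite -ge0_integralZl //; last by apply/measurable_EFinP; exact: measurableT_comp.
  by apply: eq_integral => y _; rewrite /= hE normrM EFinM.
have /integrableP[_ ip'] := ip; have /integrableP[_ iq'] := iq.
rewrite ge0_integralZr //; last 2 first.
- by apply/measurable_EFinP; exact: measurableT_comp.
- exact: integral_ge0.
apply: lte_mul_pinfty; [exact: integral_ge0| |exact: iq'].
by rewrite ge0_fin_numE; [exact: ip'|exact: integral_ge0].
Qed.

Lemma Rintegral_tensor n (p : R -> R) (q : borelV R n -> R) (h : borelV R n.+1 -> R) :
  lam.-integrable setT (EFin \o p) -> (LV n).-integrable setT (EFin \o q) ->
  measurable_fun setT h -> (forall s y, h (glue (s, y)) = p s * q y) ->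
  \int[LV n.+1]_x h x = (\int[lam]_s p s) * \int[LV n]_y q y.
Proof.
move=> ip iq mh hE; have ih := integrable_tensor ip iq mh hE.
have mg := @measurable_glue R n.
have i2 : (lam \x LV n)%E.-integrable setT ((EFin \o h) \o @glue R n).
  have /integrableP[m' f'] := ih; apply/integrableP; split.
    exact: (measurableT_comp m' mg).
  rewrite (fubini_tonelli1 (fun z => `|(EFin \o h) (glue z)|)%E) //; last first.
    by apply: measurableT_comp => //; exact: (measurableT_comp m' mg).
  by rewrite ge0_integral_LVS // in f'; exact: measurableT_comp.
have e : (\int[LV n.+1]_x (h x)%:E = \int[lam]_s \int[LV n]_y (h (glue (s, y)))%:E)%E.
  rewrite (integral12_prod_meas1 i2).
  have i3 : (lam \x LV n)%E.-integrable (@glue R n @^-1` setT) ((EFin \o h) \o @glue R n).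
    by rewrite preimage_setT.
  have <- := integral_pushforward mg (measurable_int _ ih) i3 measurableT.
  apply: eq_measure_integral => A mA _.
  exact: LVS.
have e2 : (\int[lam]_s \int[LV n]_y (h (glue (s, y)))%:E =
   \int[lam]_s (p s * \int[LV n]_y q y)%:E)%E.
  apply: eq_integral => s _; rewrite EFinM -EFin_Rintegral // -integralZl //.
  by apply: eq_integral => y _; rewrite hE EFinM.
by rewrite {1}/Rintegral e e2 -/(Rintegral _ _ _) RintegralZr.
Qed.

End tensor.

Section product_cos.
Context {R : realType}.
Local Notation lam := (@lebesgue_measure R).
Variable w : R -> R.
Hypotheses (wi : lam.-integrable setT (EFin \o w)) (w_even : forall s, w (- s) = w s).

Let mw : measurable_fun setT w. Proof. by apply/measurable_EFinP; exact: measurable_int wi. Qed.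

Lemma integral_lebesgueN (f : R -> R) : lam.-integrable setT (EFin \o f) ->
  \int[lam]_s f (- s) = \int[lam]_s f s.
Proof.
move=> fi; rewrite /Rintegral; congr fine.
have mN : measurable_fun setT (-%R : measurableTypeR R -> measurableTypeR R).
  by apply: continuous_measurable_fun; exact: opp_continuous.
have fi' : lam.-integrable ((-%R : measurableTypeR R -> measurableTypeR R) @^-1` setT)
    ((EFin \o f) \o (-%R : measurableTypeR R -> measurableTypeR R)).
  rewrite preimage_setT; have /integrableP[mf foo] := fi; apply/integrableP; split.
    exact: (measurableT_comp mf mN).
  have mf' : measurable_fun setT (abse \o (EFin \o f)) by exact: measurableT_comp.
  have := ge0_integral_pushforward mN lam measurableT mf' (fun y _ => abse_ge0 _).
  rewrite preimage_setT => <-; apply: le_lt_trans foo; rewrite le_eqVlt; apply/orP; left.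
  apply/eqP; apply: eq_measure_integral => A mA _.
  exact: lebesgue_measureN.
have := integral_pushforward mN (measurable_int _ fi) fi' measurableT.
rewrite preimage_setT => <-.
apply: eq_measure_integral => A mA _.
exact: lebesgue_measureN.
Qed.

Lemma measurable_cosM (y : R) : measurable_fun setT (fun s : R => cos (s * y)).
Proof.
apply: (measurableT_comp (f := @cos R)).
  by apply: continuous_measurable_fun; exact: continuous_cos.
exact: measurable_funM.
Qed.

Lemma measurable_sinM (y : R) : measurable_fun setT (fun s : R => sin (s * y)).
Proof.
apply: (measurableT_comp (f := @sin R)).
  by apply: continuous_measurable_fun; exact: continuous_sin.
exact: measurable_funM.
Qed.

Lemma norm_sin_le1 (x : R) : `|sin x| <= 1.
Proof. by rewrite ler_norml sin_geN1 sin_le1. Qed.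

Let wci y : lam.-integrable setT (EFin \o (fun s => w s * cos (s * y))).
Proof. by apply: integrable_mul_le1 => //; [exact: measurable_cosM|move=> x; exact: cos_max]. Qed.

Let wsi y : lam.-integrable setT (EFin \o (fun s => w s * sin (s * y))).
Proof. by apply: integrable_mul_le1 => //; [exact: measurable_sinM|move=> x; exact: norm_sin_le1]. Qed.

Lemma Rintegral_even_sin y : \int[lam]_s (w s * sin (s * y)) = 0.
Proof.
have := integral_lebesgueN (wsi y).
have -> : \int[lam]_s (w (- s) * sin (- s * y)) = \int[lam]_s (-1 * (w s * sin (s * y))).
  by apply: eq_Rintegral => s _; rewrite w_even (mulNr s) sinN; ring.
by rewrite RintegralZl //; lra.
Qed.

Definition prodw d (x : borelV R d) : R := \prod_(j < d) w ((x : 'rV[R]_d) 0 j).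

Lemma measurable_prodw d : measurable_fun setT (@prodw d).
Proof.
by apply: measurable_prod => j _; exact: (measurableT_comp mw (measurable_coord j)).
Qed.

Lemma prodw_glue n s (y : 'rV[R]_n) : @prodw n.+1 (glue (s, y)) = w s * prodw y.
Proof.
rewrite /prodw big_ord_recl glue0; congr (_ * _).
by apply: eq_bigr => j _; rewrite glueS.
Qed.

Lemma LV0_setT : @LV R 0 setT = 1%E.
Proof. by rewrite LVE /= diracT. Qed.

Lemma integrable_prodw d : (LV d).-integrable setT (EFin \o @prodw d).
Proof.
elim: d => [|n IH]; last first.
  by apply: (integrable_tensor wi IH) => [|s y]; [exact: measurable_prodw|exact: prodw_glue].
apply/integrableP; split; first by apply/measurable_EFinP; exact: measurable_prodw.
rewrite (eq_integral (fun _ => 1%E)); last by move=> x _; rewrite /= /prodw big_ord0 normr1.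
rewrite integral_cst // mul1e; apply: (@le_lt_trans _ _ 1%E); last exact: ltry.
by rewrite le_eqVlt; apply/orP; left; apply/eqP; exact: LV0_setT.
Qed.

Lemma measurable_cos_dot d (y : 'rV[R]_d) :
  measurable_fun setT (fun x : borelV R d => cos (dotv (x : 'rV[R]_d) y)).
Proof.
apply: (measurableT_comp (f := @cos R)).
  by apply: continuous_measurable_fun; exact: continuous_cos.
by apply: measurable_sum => k; apply: measurable_funM => //; exact: measurable_coord.
Qed.

Lemma measurable_sin_dot d (y : 'rV[R]_d) :
  measurable_fun setT (fun x : borelV R d => sin (dotv (x : 'rV[R]_d) y)).
Proof.
apply: (measurableT_comp (f := @sin R)).
  by apply: continuous_measurable_fun; exact: continuous_sin.
by apply: measurable_sum => k; apply: measurable_funM => //; exact: measurable_coord.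
Qed.

Lemma dotv_glue n s (z : 'rV[R]_n) (y : 'rV[R]_n.+1) :
  dotv (glue (s, z) : 'rV[R]_n.+1) y = s * y 0 0 + dotv z (\row_j y 0 (lift ord0 j)).
Proof.
rewrite /dotv big_ord_recl glue0; congr (_ + _).
by apply: eq_bigr => j _; rewrite glueS mxE.
Qed.

(** The two identities are proved together because the addition formula for the split of y into
    first coordinate and rest mixes cosine and sine; evenness of w removes every term with a
    sine. *)
Lemma Rintegral_prod_trig d (y : 'rV[R]_d) :
  \int[LV d]_x (prodw x * cos (dotv (x : 'rV[R]_d) y)) =
    \prod_(j < d) \int[lam]_s (w s * cos (s * y 0 j)) /\
  \int[LV d]_x (prodw x * sin (dotv (x : 'rV[R]_d) y)) = 0.
Proof.
elim: d y => [|n IH] y.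
  have e (x : 'rV[R]_0) : dotv x y = 0 by rewrite /dotv big_ord0.
  have cst1 (c : R) : \int[LV 0]_x c = c.
    rewrite Rintegral_cst // -[RHS]mulr1; congr (_ * _).
    exact: (congr1 fine LV0_setT).
  rewrite big_ord0; split.
    rewrite -[RHS]cst1; apply: eq_Rintegral => x _.
    by rewrite e cos0 mulr1 /prodw big_ord0.
  rewrite -[RHS]cst1; apply: eq_Rintegral => x _.
  by rewrite e sin0 mulr0.
pose y' : 'rV[R]_n := \row_j y 0 (lift ord0 j).
have [IHc IHs] := IH y'.
have qc : (LV n).-integrable setT (EFin \o (fun x : borelV R n => prodw x * cos (dotv (x : 'rV[R]_n) y'))).
  by apply: integrable_mul_le1; [exact: measurable_cos_dot|move=> x; exact: cos_max|exact: integrable_prodw].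
have qs : (LV n).-integrable setT (EFin \o (fun x : borelV R n => prodw x * sin (dotv (x : 'rV[R]_n) y'))).
  by apply: integrable_mul_le1; [exact: measurable_sin_dot|move=> x; exact: norm_sin_le1|exact: integrable_prodw].
pose tl (x : borelV R n.+1) : borelV R n := \row_j (x : 'rV[R]_n.+1) 0 (lift ord0 j).
have mtl : measurable_fun setT tl.
  apply: measurable_to_borelV => j; under eq_fun do rewrite mxE; exact: measurable_coord.
have tlE s z : tl (glue (s, z)) = z.
  by apply/rowP => j; rewrite mxE glueS.
have mhd : measurable_fun setT (fun x : borelV R n.+1 => (x : 'rV[R]_n.+1) 0 0 : R) by exact: measurable_coord.
pose T (p : R -> R) (q : borelV R n -> R) (x : borelV R n.+1) : R := p ((x : 'rV[R]_n.+1) 0 0) * q (tl x).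
have TE p q s z : T p q (glue (s, z)) = p s * q z by rewrite /T glue0 tlE.
have mT p q : lam.-integrable setT (EFin \o p) -> (LV n).-integrable setT (EFin \o q) ->
    measurable_fun setT (T p q).
  move=> ip iq.
  have mp : measurable_fun setT p by apply/measurable_EFinP; exact: measurable_int ip.
  have mq : measurable_fun setT q by apply/measurable_EFinP; exact: measurable_int iq.
  by apply: measurable_funM; [exact: (measurableT_comp mp mhd)|exact: (measurableT_comp mq mtl)].
have TI p q (ip : lam.-integrable setT (EFin \o p)) (iq : (LV n).-integrable setT (EFin \o q)) :=
  Rintegral_tensor ip iq (mT p q ip iq) (TE p q).
have Ti p q (ip : lam.-integrable setT (EFin \o p)) (iq : (LV n).-integrable setT (EFin \o q)) :=
  integrable_tensor ip iq (mT p q ip iq) (TE p q).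
have xE (x : borelV R n.+1) : exists s z, x = glue (s, z).
  by exists (unglue x).1, (unglue x).2; rewrite -[LHS]unglueK; case: (unglue x).
split.
  transitivity (\int[LV n.+1]_x (
      T (fun s => w s * cos (s * y 0 0)) (fun z => prodw z * cos (dotv (z : 'rV[R]_n) y')) x -
      T (fun s => w s * sin (s * y 0 0)) (fun z => prodw z * sin (dotv (z : 'rV[R]_n) y')) x)).
    apply: eq_Rintegral => x _; have [s [z ->]] := xE x.
    by rewrite !TE dotv_glue prodw_glue cosD -/y'; ring.
  rewrite RintegralB //; [|exact: Ti (wci _) qc|exact: Ti (wsi _) qs].
  rewrite (TI _ _ (wci _) qc) (TI _ _ (wsi _) qs) IHc IHs mulr0 subr0 big_ord_recl.
  by congr (_ * _); apply: eq_bigr => j _; apply: eq_Rintegral => s _; rewrite mxE.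
transitivity (\int[LV n.+1]_x (
    T (fun s => w s * sin (s * y 0 0)) (fun z => prodw z * cos (dotv (z : 'rV[R]_n) y')) x +
    T (fun s => w s * cos (s * y 0 0)) (fun z => prodw z * sin (dotv (z : 'rV[R]_n) y')) x)).
  apply: eq_Rintegral => x _; have [s [z ->]] := xE x.
  by rewrite !TE dotv_glue prodw_glue sinD -/y'; ring.
rewrite RintegralD //; [|exact: Ti (wsi _) qc|exact: Ti (wci _) qs].
by rewrite (TI _ _ (wsi _) qc) (TI _ _ (wci _) qs) IHs mulr0 addr0 Rintegral_even_sin mul0r.
Qed.

End product_cos.

(** * The Fourier pair of exp (-e |s|) and the Cauchy kernel *)

Section cauchy_kernel.
Context {R : realType}.
Local Notation lam := (@lebesgue_measure R).

(** [exp_abs e] regularizes the inversion integral, and its Fourier transform [cauchy e] is an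
    explicit nonnegative integrable kernel that concentrates at 0 as e decreases to 0. *)
Definition exp_abs (e s : R) : R := expR (- (e * `|s|)).
Definition cauchy (e y : R) : R := 2 * e / (e ^+ 2 + y ^+ 2).

Lemma continuous_exp_abs e : continuous (exp_abs e).
Proof.
move=> x; apply: (@continuous_comp _ _ _ (fun s : R => - (e * `|s|)) expR); last exact: continuous_expR.
apply: cvgN; apply: cvgM; first exact: cvg_cst.
exact: norm_continuous.
Qed.

Lemma exp_abs_even e s : exp_abs e (- s) = exp_abs e s.
Proof. by rewrite /exp_abs normrN. Qed.

(** The primitive of exp (- e s) (1 + cos (y s)) that vanishes at +oo. *)
Let F (e y s : R) : R :=
  expR (- (e * s)) * (- e^-1 + (y * sin (y * s) - e * cos (y * s)) / (e ^+ 2 + y ^+ 2)).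

(** As for the ball, 1 + cos is used because it is nonnegative, here to evaluate the improper
    integral on a half-line by its primitive; the 1 is removed afterwards by comparison with y =
    0. *)
Lemma integral_exp_abs_one_add_cos (e y : R) : 0 < e ->
  (\int[lam]_s (exp_abs e s * (1 + cos (s * y)))%:E = (2 / e + cauchy e y)%:E)%E.
Proof.
move=> e0; have en0 : e != 0 by rewrite gt_eqF.
have q0 : e ^+ 2 + y ^+ 2 != 0 by rewrite gt_eqF // ltr_pwDl ?exprn_gt0 // sqr_ge0.
have ccos : continuous (fun s : R => cos (s * y)).
  move=> x; apply: (@continuous_comp _ _ _ (fun s : R => s * y) cos); last exact: continuous_cos.
  by apply: cvgM; [exact: cvg_id|exact: cvg_cst].
have cf : continuous (fun s : R => exp_abs e s * (1 + cos (s * y))).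
  move=> x; apply: cvgM; first exact: continuous_exp_abs.
  by apply: cvgD; [exact: cvg_cst|exact: ccos].
have f0 s : 0 <= exp_abs e s * (1 + cos (s * y)).
  by rewrite mulr_ge0 ?expR_ge0 //; have := cos_geN1 (s * y); lra.
rewrite ge0_symfun_integralT //; last first.
  by move=> s /=; rewrite exp_abs_even mulNr cosN.
have dF (s : R) : is_derive s 1 (F e y) (expR (- (e * s)) * (1 + cos (s * y))).
  have dl (c : R) : is_derive s 1 (fun s : R => c * s) c.
    by apply: (is_derive_eq (is_deriveZ c (is_derive_id s 1))); rewrite /GRing.scale /= mulr1.
  have d1 : is_derive s 1 (fun s : R => expR (- (e * s))) (expR (- (e * s)) * - e).
    by apply: (@is_derive1_comp _ expR (fun s : R => - (e * s))); exact: is_deriveN.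
  have d2 := @is_derive1_comp _ sin (fun s : R => y * s) s _ _ (is_derive_sin _) (dl y).
  have d3 := @is_derive1_comp _ cos (fun s : R => y * s) s _ _ (is_derive_cos _) (dl y).
  have d4 := is_deriveM d1 (is_deriveD (is_derive_cst (- e^-1) s 1)
     (is_deriveZ ((e ^+ 2 + y ^+ 2)^-1) (is_deriveB (is_deriveZ y d2) (is_deriveZ e d3)))).
  rewrite (_ : F e y = (fun s : R => expR (- (e * s))) * (cst (- e^-1) + (e ^+ 2 + y ^+ 2)^-1 *:
     (y *: (sin \o (fun s : R => y * s)) - e *: (cos \o (fun s : R => y * s))))); last first.
    by apply/funext => x; rewrite /F !fctE /GRing.scale /=; ring.
  apply: (is_derive_eq d4); rewrite !fctE /GRing.scale /= (mulrC s y) /GRing.scale /=; field.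
  by rewrite q0 en0.
have F_lim : F e y s @[s --> +oo%R] --> 0.
  have lim1 : expR (- (e * s)) @[s --> +oo%R] --> (0 : R).
    apply: (@cvg_comp _ _ _ (fun s : R => e * s) (fun x => expR (- x)) _ (pinfty_nbhs R)); last exact: cvgr_expR.
    exact: gt0_cvgMry.
  pose B := e^-1 + (`|y| + e) / (e ^+ 2 + y ^+ 2).
  have FB s : `|F e y s| <= B * expR (- (e * s)).
    rewrite /F normrM (ger0_norm (expR_ge0 _)) mulrC ler_wpM2r ?expR_ge0 //.
    apply: (le_trans (ler_normD _ _)); apply: lerD.
      by rewrite normrN ger0_norm // invr_ge0 ltW.
    have qg : 0 < e ^+ 2 + y ^+ 2 by rewrite lt0r q0 addr_ge0 // sqr_ge0.
    rewrite normrM (ger0_norm (x := (_ + _)^-1)) ?invr_ge0 ?(ltW qg) // ler_wpM2r ?invr_ge0 ?(ltW qg) //.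
    apply: (le_trans (ler_normB _ _)); apply: lerD; rewrite normrM.
      by rewrite ler_piMr // norm_sin_le1.
    by rewrite (gtr0_norm e0) ler_piMr ?(ltW e0) // cos_max.
  apply: norm_cvg0; apply: (@squeeze_cvgr _ _ _ _ (cst 0) (fun s => B * expR (- (e * s)))).
  - by apply: nearW => s; rewrite normr_ge0 FB.
  - exact: cvg_cst.
  - by rewrite -[X in _ --> X](mulr0 B); apply: cvgM; [exact: cvg_cst|exact: lim1].
rewrite -set_itvcy (@ge0_continuous_FTC2y R _ (F e y) 0 0) //.
- rewrite /F !mulr0 oppr0 expR0 sin0 cos0 -EFinB -EFinM /cauchy; congr EFin; field.
  by rewrite q0 en0.
- by apply: continuous_subspaceT.
- apply: cvg_at_right_filter; apply: differentiable_continuous; apply/derivable1_diffP.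
  exact: (@ex_derive _ _ _ _ _ _ _ (dF 0)).
- move=> x; rewrite in_itv /= andbT => x0; rewrite derive1E (@derive_val _ _ _ _ _ _ _ (dF x)).
  by rewrite /exp_abs gtr0_norm.
Qed.

Lemma integrable_exp_abs e : 0 < e -> lam.-integrable setT (EFin \o exp_abs e).
Proof.
move=> e0; have mE : measurable_fun setT (exp_abs e).
  by apply: continuous_measurable_fun; exact: continuous_exp_abs.
apply/integrableP; split; first exact/measurable_EFinP.
apply: (@le_lt_trans _ _ (\int[lam]_s (exp_abs e s * (1 + cos (s * 0)))%:E)%E); last first.
  by rewrite integral_exp_abs_one_add_cos // ltry.
apply: ge0_le_integral => //.
- by apply: measurableT_comp => //; exact/measurable_EFinP.
- apply/measurable_EFinP; apply: measurable_funM => //; apply: measurable_funD => //.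
  exact: measurable_cosM.
- move=> s _; rewrite lee_fin mulr0 cos0 ger0_norm ?expR_ge0 // ler_peMr ?expR_ge0 //; lra.
Qed.

Lemma Rintegral_exp_abs_cos e y : 0 < e ->
  \int[lam]_s (exp_abs e s * cos (s * y)) = cauchy e y.
Proof.
have aux (I J t c : R) : I + I = t + t -> I + J = t + c -> J = c by lra.
move=> e0; have ie := integrable_exp_abs e0.
have ic k : lam.-integrable setT (EFin \o (fun s : R => exp_abs e s * cos (s * k))).
  by apply: integrable_mul_le1 => //; [exact: measurable_cosM|move=> x; exact: cos_max].
have h k : \int[lam]_s exp_abs e s + \int[lam]_s (exp_abs e s * cos (s * k)) = 2 / e + cauchy e k.
  rewrite -RintegralD // -[RHS]/(fine (2 / e + cauchy e k)%:E) -integral_exp_abs_one_add_cos //.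
  by congr fine; apply: eq_integral => s _; congr EFin; ring.
have h0 := h 0; have hy := h y.
have e1 : \int[lam]_s (exp_abs e s * cos (s * 0)) = \int[lam]_s exp_abs e s.
  by apply: eq_Rintegral => s _; rewrite mulr0 cos0 mulr1.
have e2 : cauchy e 0 = 2 / e by rewrite /cauchy expr0n addr0; field; rewrite gt_eqF.
by move: h0 hy; rewrite e1 e2; exact: aux.
Qed.

Lemma integral_cauchy1 : (\int[lam]_y (cauchy 1 y)%:E = (2 * pi)%:E)%E.
Proof.
have cE y : cauchy 1 y = 2 * (oneDsqr y)^-1 by rewrite /cauchy /oneDsqr expr1n mulr1.
have cv : continuous (fun y : R => (oneDsqr y)^-1) by exact: continuous_oneDsqrV.
have p0 (y : R) : 0 <= (oneDsqr y)^-1 by rewrite invr_ge0 (le_trans ler01) // oneDsqr_ge1.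
transitivity (\int[lam]_y (2%:E * ((oneDsqr y)^-1)%:E))%E.
  by apply: eq_integral => y _; rewrite cE EFinM.
rewrite ge0_integralZl //; last first.
  by apply/measurable_EFinP; exact: continuous_measurable_fun.
rewrite ge0_symfun_integralT; [|exact: p0|exact: cv|].
  by rewrite -set_itvcy integral0y_oneDsqr -!EFinM; congr EFin; field.
by move=> y /=; rewrite /oneDsqr sqrrN.
Qed.

End cauchy_kernel.

(** * Orthogonality of characters over full periods *)

Section cube_cos.
Context {R : realType}.
Local Notation lam := (@lebesgue_measure R).

Lemma sin_natpi (n : nat) : sin (n%:R * pi) = 0 :> R.
Proof.
elim: n => [|n IH]; first by rewrite mul0r sin0.
by rewrite -natr1 mulrDl mul1r sinD IH mul0r sinpi mulr0 addr0.
Qed.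

Lemma sin_intpi (k : int) : sin (k%:~R * pi) = 0 :> R.
Proof.
case: k => n; first exact: sin_natpi.
by rewrite NegzE mulrNz mulNr sinN sin_natpi oppr0.
Qed.

(** Half the side: [- pi N, pi N] consists of whole periods of s -> cos (k s) for every nonzero
    integer k. *)
Definition cube_side (N : nat) : R := pi * N%:R.

Definition cube_indic N (s : R) : R := \1_(`[- cube_side N, cube_side N]%classic) s.

Lemma cube_side_ge0 N : 0 <= cube_side N.
Proof. by rewrite mulr_ge0 // pi_ge0. Qed.

Lemma measurable_cube_indic N : measurable_fun setT (cube_indic N).
Proof. by apply: measurable_indic; exact: measurable_itv. Qed.

Lemma integrable_cube_indic N : lam.-integrable setT (EFin \o cube_indic N).
Proof.
apply/integrableP; split; first by apply/measurable_EFinP; exact: measurable_cube_indic.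
apply: (@le_lt_trans _ _ (\int[lam]_s (cube_indic N s)%:E)%E).
  rewrite le_eqVlt; apply/orP; left; apply/eqP; apply: eq_integral => s _.
  by rewrite /= ger0_norm // /cube_indic indicE.
apply: (@le_lt_trans _ _ (lam `[(- cube_side N)%R, cube_side N]%classic)).
  by rewrite /cube_indic integral_indic // setIT.
by rewrite lebesgue_measure_itv /=; case: ifP => _; rewrite -?EFinB ltry.
Qed.

Lemma cube_indic_even N s : cube_indic N (- s) = cube_indic N s.
Proof.
rewrite /cube_indic !indicE; congr (nat_of_bool _)%:R.
by apply/idP/idP; rewrite !inE /= !in_itv /= -!ler_norml normrN.
Qed.

Lemma Rintegral_cube_indic_cos N (k : int) : (0 < N)%N ->
  \int[lam]_s (cube_indic N s * cos (s * k%:~R)) = if k == 0 then 2 * cube_side N else 0.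
Proof.
move=> N0; have a0 : 0 < cube_side N by rewrite mulr_gt0 ?pi_gt0 // ltr0n.
have aa : - cube_side N < cube_side N by lra.
transitivity (\int[lam]_(s in `[- cube_side N, cube_side N]) cos (s * k%:~R)).
  rewrite [RHS]Rintegral_mkcond; apply: eq_Rintegral => s _; rewrite patchE /cube_indic indicE.
  by case: (s \in _); rewrite ?mul1r ?mul0r.
have [->|k0] := eqVneq k 0.
  transitivity (\int[lam]_(s in `[- cube_side N, cube_side N]) (1 : R)).
    by apply: eq_Rintegral => s _; rewrite mulr0 cos0.
  transitivity (fine (lam `[- cube_side N, cube_side N]%classic)).
    by rewrite Rintegral_cst // mul1r.
  rewrite lebesgue_measure_itv /= lte_fin aa -EFinB /=; ring.
have kn0 : k%:~R != 0 :> R by rewrite intr_eq0.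
have ds (s : R) : is_derive s 1 (fun s : R => k%:~R^-1 * sin (s * k%:~R)) (cos (s * k%:~R)).
  have d1 : is_derive s 1 (fun s : R => s * k%:~R) (k%:~R : R).
    rewrite (_ : (fun s : R => s * k%:~R) = k%:~R *: (@id R)); last first.
      by apply/funext => x; rewrite !fctE /GRing.scale /= mulrC.
    by apply: (is_derive_eq (is_deriveZ k%:~R (is_derive_id s 1))); rewrite /GRing.scale /= mulr1.
  have d2 := @is_derive1_comp _ sin (fun s : R => s * k%:~R) s _ _ (is_derive_sin _) d1.
  apply: (is_derive_eq (is_deriveZ k%:~R^-1 d2)); rewrite /GRing.scale /=.
  by field.
have cds (x : R) : {for x, continuous (fun s : R => k%:~R^-1 * sin (s * k%:~R))}.
  apply: differentiable_continuous; apply/derivable1_diffP.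
  exact: (@ex_derive _ _ _ _ _ _ _ (ds x)).
rewrite /Rintegral (@continuous_FTC2 R _ (fun s : R => k%:~R^-1 * sin (s * k%:~R))) //.
- have sa : sin (cube_side N * k%:~R) = 0.
    rewrite /cube_side (_ : pi * N%:R * k%:~R = (N%:Z * k)%:~R * pi); first exact: sin_intpi.
    by rewrite intrM; ring.
  by rewrite -EFinB /= mulNr sinN sa; ring.
- apply: continuous_subspaceT => x.
  apply: (@continuous_comp _ _ _ (fun s : R => s * k%:~R) cos); last exact: continuous_cos.
  by apply: cvgM; [exact: cvg_id|exact: cvg_cst].
- split; [by move=> x _; exact: (@ex_derive _ _ _ _ _ _ _ (ds x))| |].
    by apply: cvg_at_right_filter; exact: cds.
  by apply: cvg_at_left_filter; exact: cds.
- by move=> x _; rewrite derive1E; exact: (@derive_val _ _ _ _ _ _ _ (ds x)).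
Qed.

Definition ivec d (k : 'rV[int]_d) : 'rV[R]_d := map_mx intr k.

Lemma ivecE d (k : 'rV[int]_d) j : ivec k 0 j = (k 0 j)%:~R.
Proof. by rewrite mxE. Qed.

Lemma ivecD d (k l : 'rV[int]_d) : ivec (k + l) = ivec k + ivec l.
Proof. by apply/rowP => j; rewrite !mxE intrD. Qed.

Lemma ivecB d (k l : 'rV[int]_d) : ivec (k - l) = ivec k - ivec l.
Proof. by apply/rowP => j; rewrite !mxE intrB. Qed.

Lemma prodw_cube_indic d N (x : borelV R d) :
  prodw (cube_indic N) x = \1_(cube (cube_side N)) x.
Proof. by rewrite /cube indic_box. Qed.

Lemma Rintegral_cube_cos d N (k : 'rV[int]_d) : (0 < N)%N ->
  \int[LV d]_x (\1_(cube (cube_side N)) x * cos (dotv (x : 'rV[R]_d) (ivec k))) =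
  if k == 0 then (2 * cube_side N) ^+ d else 0.
Proof.
move=> N0.
have [h _] := Rintegral_prod_trig (integrable_cube_indic N) (@cube_indic_even N) (ivec k).
transitivity (\int[LV d]_x (prodw (cube_indic N) x * cos (dotv (x : 'rV[R]_d) (ivec k)))).
  by apply: eq_Rintegral => x _; rewrite prodw_cube_indic.
rewrite h; under eq_bigr do rewrite ivecE Rintegral_cube_indic_cos //.
have [->|k0] := eqVneq k 0.
  by under eq_bigr do rewrite mxE eqxx; rewrite prodr_const card_ord.
have [j kj] : exists j, k 0 j != 0.
  by apply/existsP; apply: contraNT k0 => /existsPn h'; apply/eqP/rowP => j; rewrite mxE; apply/eqP; have := h' j; rewrite negbK.
by rewrite (bigD1 j) //= (negbTE kj) mul0r.
Qed.

End cube_cos.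

Section reflection.
Context {R : realType} {d : nat}.
Local Notation bV := (borelV R d).

Lemma measurable_dotv2 {disp} {S : measurableType disp} (f g : S -> 'rV[R]_d) :
  measurable_fun setT (f : S -> bV) -> measurable_fun setT (g : S -> bV) ->
  measurable_fun setT (fun w => dotv (f w) (g w)).
Proof.
move=> mf mg; apply: measurable_sum => k; apply: measurable_funM; exact: measurable_borelV_coord.
Qed.

Lemma measurable_cosT {disp} {S : measurableType disp} (f : S -> R) :
  measurable_fun setT f -> measurable_fun setT (fun w => cos (f w)).
Proof.
by move=> mf; apply: (measurableT_comp _ mf); apply: continuous_measurable_fun; exact: continuous_cos.
Qed.

Lemma measurable_sinT {disp} {S : measurableType disp} (f : S -> R) :
  measurable_fun setT f -> measurable_fun setT (fun w => sin (f w)).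
Proof.
by move=> mf; apply: (measurableT_comp _ mf); apply: continuous_measurable_fun; exact: continuous_sin.
Qed.

Lemma LV_oppr : forall B : set bV, measurable B ->
  LV d [set y | B ((y : 'rV[R]_d) *m (-1)%:M)] = (1%:E * LV d B)%E.
Proof.
have u : ((-1)%:M : 'M[R]_d) \in unitmx.
  by rewrite unitmxE det_scalar unitrX // unitrN1.
have [c c0 cE] := LV_mulmx u; suff c1 : c = 1 by move: cE; rewrite c1.
have := cE (cube 1) (measurable_cube 1).
have -> : [set y : bV | cube 1 ((y : 'rV[R]_d) *m (-1)%:M)] = cube 1.
  by apply/seteqP; split => x /cubeP h; apply/cubeP => j; have := h j;
    rewrite mul_mx_scalar scaleN1r mxE normrN.
have p : 0 < (2 * 1) ^+ d :> R by rewrite exprn_gt0 // mulr1.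
rewrite LV_cube // -EFinM => -[] /esym/eqP; rewrite -subr_eq0.
by rewrite -{2}[(2 * 1) ^+ d]mul1r -mulrBl mulf_eq0 (gt_eqF p) orbF subr_eq0 => /eqP.
Qed.

Lemma Rintegral_LVN (f : bV -> R) : (LV d).-integrable setT (EFin \o f) ->
  \int[LV d]_x f (- (x : 'rV[R]_d)) = \int[LV d]_x f x.
Proof.
move=> fi; rewrite /Rintegral; congr fine.
rewrite -[RHS]mul1e -(integral_mulmx ltr01 LV_oppr fi).
by apply: eq_integral => x _; rewrite /= mul_mx_scalar scaleN1r.
Qed.

Lemma Rintegral_LVD (h : 'rV[R]_d) (f : bV -> R) : measurable_fun setT f -> (forall x, 0 <= f x) ->
  \int[LV d]_x f ((x : 'rV[R]_d) + h) = \int[LV d]_x f x.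
Proof.
move=> mf f0; rewrite /Rintegral; congr fine.
rewrite (ge0_integral_LVD h (f := EFin \o f)) //; exact/measurable_EFinP.
Qed.

End reflection.

Section fourier_inversion.
Context {R : realType} {d : nat}.
Local Notation bV := (borelV R d).
Local Notation lam := (@lebesgue_measure R).
Variable E : set bV.
Hypotheses (mE : measurable E) (fE : (LV d E < +oo)%E).
Hypothesis symE : forall x : 'rV[R]_d, E (- x) <-> E x.

(** The full Fourier transform of the indicator: E is symmetric, so the sine part vanishes
    ([fourier_sin_eq0]). *)
Definition fourier (xi : 'rV[R]_d) : R := \int[LV d]_x (\1_E x * cos (dotv xi (x : 'rV[R]_d))).
Definition covariogram (z : 'rV[R]_d) : R := \int[LV d]_x (\1_E x * \1_E ((x : 'rV[R]_d) + z : bV)).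

Let e (x : bV) : R := \1_E x.

Let me : measurable_fun setT e. Proof. exact: measurable_indic. Qed.

Let e01 x : 0 <= e x <= 1. Proof. by rewrite /e indicE; case: (_ \in _); rewrite ?ler01 ?lexx. Qed.

Let e_ge0 x : 0 <= e x. Proof. by have /andP[] := e01 x. Qed.

Let e_le1 x : `|e x| <= 1. Proof. by rewrite ger0_norm //; have /andP[] := e01 x. Qed.

Let ei : (LV d).-integrable setT (EFin \o e).
Proof.
apply/integrableP; split; first exact/measurable_EFinP.
apply: (@le_lt_trans _ _ (\int[LV d]_x (e x)%:E)%E).
  rewrite le_eqVlt; apply/orP; left; apply/eqP; apply: eq_integral => x _.
  by rewrite /= ger0_norm.
by rewrite integral_indic // setIT.
Qed.

Lemma indic_integrable : (LV d).-integrable setT (EFin \o (\1_E : bV -> R)).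
Proof. exact: ei. Qed.

Lemma Rintegral_indicE : \int[LV d]_x (\1_E x : R) = fine (LV d E).
Proof. by rewrite /Rintegral integral_indic // setIT. Qed.

Let mid : measurable_fun setT (fun x : bV => (x : 'rV[R]_d) : bV). Proof. exact: measurable_id. Qed.

Let mcst (c : 'rV[R]_d) {disp} {S : measurableType disp} : measurable_fun setT (fun _ : S => c : bV).
Proof. exact: measurable_cst. Qed.

Let icos (f : bV -> R) : measurable_fun setT f ->
  (LV d).-integrable setT (EFin \o (fun x => e x * cos (f x))).
Proof.
move=> mf; apply: integrable_mul_le1 => //; first exact: measurable_cosT.
by move=> x; exact: cos_max.
Qed.

Let isin (f : bV -> R) : measurable_fun setT f ->
  (LV d).-integrable setT (EFin \o (fun x => e x * sin (f x))).
Proof.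
move=> mf; apply: integrable_mul_le1 => //; first exact: measurable_sinT.
by move=> x; exact: norm_sin_le1.
Qed.

Let mdot (xi : 'rV[R]_d) : measurable_fun setT (fun x : bV => dotv xi (x : 'rV[R]_d)).
Proof. by apply: measurable_dotv2; [exact: mcst|exact: mid]. Qed.

Lemma fourier_sin_eq0 (xi : 'rV[R]_d) : \int[LV d]_x (e x * sin (dotv xi (x : 'rV[R]_d))) = 0.
Proof.
have aux (a : R) : - a = a -> a = 0 by lra.
apply: aux; rewrite -[RHS](Rintegral_LVN (isin (mdot xi))) -[LHS]mulN1r.
rewrite -RintegralZl //; last exact: isin (mdot xi).
apply: eq_Rintegral => x _; rewrite dotvNr sinN mulrN mulN1r.
by congr (- (_ * _)); rewrite /e !indicE; congr (nat_of_bool _)%:R;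
  apply/idP/idP; rewrite !inE => /symE.
Qed.

Lemma fourier_shift (xi : 'rV[R]_d) (c : R) :
  \int[LV d]_x (e x * cos (dotv xi (x : 'rV[R]_d) + c)) = fourier xi * cos c.
Proof.
transitivity (\int[LV d]_x (cos c * (e x * cos (dotv xi (x : 'rV[R]_d))) -
    sin c * (e x * sin (dotv xi (x : 'rV[R]_d))))).
  by apply: eq_Rintegral => x _; rewrite cosD; ring.
rewrite RintegralB //; [|exact: integrableZl_fun (icos (mdot xi))|exact: integrableZl_fun (isin (mdot xi))].
rewrite !RintegralZl //; [|exact: isin (mdot xi)|exact: icos (mdot xi)].
by rewrite fourier_sin_eq0 mulr0 subr0 mulrC.
Qed.

Lemma measurable_fourier : measurable_fun setT (fourier : bV -> R).
Proof.
apply: (@measurable_Rintegral_param _ _ bV bV R (LV d)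
  (fun z => e z.2 * cos (dotv (z.1 : 'rV[R]_d) z.2))).
apply: measurable_funM; first exact: (measurableT_comp me measurable_snd).
by apply: measurable_cosT; apply: measurable_dotv2; [exact: measurable_fst|exact: measurable_snd].
Qed.

Lemma fourier_le xi : `|fourier xi| <= fine (LV d E).
Proof.
apply: (le_trans (le_normr_Rintegral measurableT (icos (mdot xi)))).
rewrite -Rintegral_indicE; apply: le_Rintegral => //.
  exact: integrable_norm (icos (mdot xi)).
by move=> x _; rewrite normrM (ger0_norm (e_ge0 x)) ler_piMr // cos_max.
Qed.

Lemma covariogram_ge0 z : 0 <= covariogram z.
Proof. by apply: Rintegral_ge0 => x _; rewrite mulr_ge0 ?e_ge0. Qed.

Lemma covariogram_le z : `|covariogram z| <= fine (LV d E).
Proof.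
have mez : measurable_fun setT (fun x : bV => e ((x : 'rV[R]_d) + z)).
  by apply: (measurableT_comp me); apply: measurable_borelVD; [exact: mid|exact: mcst].
have i1 : (LV d).-integrable setT (EFin \o (fun x : bV => e x * e ((x : 'rV[R]_d) + z))).
  by apply: integrable_mul_le1 => //.
apply: (le_trans (le_normr_Rintegral measurableT i1)).
rewrite -Rintegral_indicE; apply: le_Rintegral => //; first exact: integrable_norm i1.
by move=> x _; rewrite normrM (ger0_norm (e_ge0 x)) ler_piMr //; exact: e_le1.
Qed.

Lemma measurable_covariogram : measurable_fun setT (covariogram : bV -> R).
Proof.
apply: (@measurable_Rintegral_param _ _ bV bV R (LV d)
  (fun z => e z.2 * e ((z.2 : 'rV[R]_d) + z.1))).
apply: measurable_funM; first exact: (measurableT_comp me measurable_snd).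
by apply: (measurableT_comp me); apply: measurable_borelVD; [exact: measurable_snd|exact: measurable_fst].
Qed.

(* K eps is, up to (2 pi)^d, an approximate identity, and the Fourier
   transform of W eps, which increases to 1 as eps decreases to 0. *)
Let W (eps : R) : bV -> R := @prodw R (exp_abs eps) d.
Let K (eps : R) : bV -> R := @prodw R (cauchy eps) d.

Let cauchy_ge0 (eps y : R) : 0 < eps -> 0 <= cauchy eps y.
Proof. by move=> e0; rewrite /cauchy divr_ge0 ?mulr_ge0 ?addr_ge0 ?sqr_ge0 // ltW. Qed.

Let mcauchy (eps : R) : 0 < eps -> measurable_fun setT (cauchy eps).
Proof.
move=> e0; apply: continuous_measurable_fun => x; apply: cvgM; first exact: cvg_cst.
apply: cvgV; first by rewrite gt_eqF // ltr_pwDl ?exprn_gt0 // sqr_ge0.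
by apply: cvgD; [exact: cvg_cst|exact: exprn_continuous].
Qed.

Let mK eps : 0 < eps -> measurable_fun setT (K eps).
Proof.
move=> e0; apply: measurable_prod => j _.
exact: (measurableT_comp (mcauchy e0) (measurable_coord j)).
Qed.

Let K_ge0 eps x : 0 < eps -> 0 <= K eps x.
Proof. by move=> e0; apply: prodr_ge0 => j _; exact: cauchy_ge0. Qed.

Let WK eps (y : 'rV[R]_d) : 0 < eps ->
  \int[LV d]_x (W eps x * cos (dotv (x : 'rV[R]_d) y)) = K eps y.
Proof.
move=> e0; have [-> _] := Rintegral_prod_trig (integrable_exp_abs e0) (exp_abs_even eps) y.
by apply: eq_bigr => j _; exact: Rintegral_exp_abs_cos.
Qed.

Let Wi eps : 0 < eps -> (LV d).-integrable setT (EFin \o W eps).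
Proof. by move=> e0; exact: integrable_prodw (integrable_exp_abs e0) d. Qed.

Let mW eps : 0 < eps -> measurable_fun setT (W eps).
Proof. by move=> e0; exact: measurable_prodw (integrable_exp_abs e0) d. Qed.

(** Write [K eps] as the cosine transform of [W eps] and integrate over y, then over x: by
    [fourier_shift] each integration produces one factor [fourier xi]. *)
Let smoothed_fourier eps z : 0 < eps ->
  \int[LV d]_x (e x * \int[LV d]_y (e y * K eps ((y : 'rV[R]_d) - (x : 'rV[R]_d) - z))) =
  \int[LV d]_xi (W eps xi * fourier xi * (fourier xi * cos (dotv (xi : 'rV[R]_d) z))).
Proof.
move=> e0.
have inner (x : 'rV[R]_d) : \int[LV d]_y (e y * K eps ((y : 'rV[R]_d) - x - z)) =
    \int[LV d]_xi (W eps xi * fourier xi * cos (dotv (xi : 'rV[R]_d) (x + z))).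
  transitivity (\int[LV d]_y (e y * \int[LV d]_xi (W eps xi * cos (dotv (xi : 'rV[R]_d) ((y : 'rV[R]_d) - x - z))))).
    by apply: eq_Rintegral => y _; rewrite WK.
  rewrite (@Rintegral_fubini_dom _ _ bV bV R (LV d) (LV d) e (W eps)
    (fun p => cos (dotv (p.2 : 'rV[R]_d) ((p.1 : 'rV[R]_d) - x - z)))) //.
  - apply: eq_Rintegral => xi _; rewrite -mulrA; congr (_ * _).
    transitivity (\int[LV d]_y (e y * cos (dotv (xi : 'rV[R]_d) (y : 'rV[R]_d) + - dotv (xi : 'rV[R]_d) (x + z)))).
      by apply: eq_Rintegral => y _; rewrite -dotvNr -dotvDr opprD addrA.
    by rewrite fourier_shift cosN.
  - exact: Wi.
  - apply: measurable_cosT; apply: measurable_dotv2; first exact: measurable_snd.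
    apply: measurable_borelVD; last exact: mcst.
    by apply: measurable_borelVD; [exact: measurable_fst|exact: mcst].
  - by move=> p; exact: cos_max.
transitivity (\int[LV d]_x (e x * \int[LV d]_xi (W eps xi * fourier xi * cos (dotv (xi : 'rV[R]_d) ((x : 'rV[R]_d) + z))))).
  by apply: eq_Rintegral => x _; rewrite inner.
rewrite (@Rintegral_fubini_dom _ _ bV bV R (LV d) (LV d) e (fun xi => W eps xi * fourier xi)
    (fun p => cos (dotv (p.2 : 'rV[R]_d) ((p.1 : 'rV[R]_d) + z)))) //.
- apply: eq_Rintegral => xi _; congr (_ * _).
  transitivity (\int[LV d]_y (e y * cos (dotv (xi : 'rV[R]_d) (y : 'rV[R]_d) + dotv (xi : 'rV[R]_d) z))).
    by apply: eq_Rintegral => y _; rewrite dotvDr.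
  exact: fourier_shift.
- set v := fine (LV d E).
  have v0 : 0 <= v by apply: fine_ge0; exact: measure_ge0.
  apply: (integrable_dom (g := fun x => v * `|W eps x|)).
  + by apply: measurable_funM; [exact: mW|exact: measurable_fourier].
  + by move=> x; rewrite normrM mulrC ler_wpM2r // fourier_le.
  + by apply: integrableZl_fun; apply: (integrable_norm (f := W eps)); exact: Wi.
- apply: measurable_cosT; apply: measurable_dotv2; first exact: measurable_snd.
  by apply: measurable_borelVD; [exact: measurable_fst|exact: mcst].
- by move=> p; exact: cos_max.
Qed.

Let K1i : (LV d).-integrable setT (EFin \o K 1).
Proof.
apply: integrable_prodw; apply/integrableP; split.
  by apply/measurable_EFinP; apply: mcauchy.
apply: (@le_lt_trans _ _ (\int[lam]_y (cauchy 1 y)%:E)%E); last first.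
  by rewrite integral_cauchy1 ltry.
rewrite le_eqVlt; apply/orP; left; apply/eqP; apply: eq_integral => y _.
by rewrite /= ger0_norm // cauchy_ge0.
Qed.

Let K1_total : \int[LV d]_x K 1 x = (2 * pi) ^+ d.
Proof.
rewrite /Rintegral (ge0_integral_LV_prod (w := fun _ => cauchy 1)); last 2 first.
- by move=> _; exact: mcauchy.
- by move=> _ y; exact: cauchy_ge0.
under eq_bigr do rewrite integral_cauchy1.
by rewrite prodEFin prodr_const card_ord.
Qed.

(** The same double integral under the substitution y = x + z + eps u, for which [K eps] at eps u is
    eps^-d times [K 1] at u; integrating over x first leaves the covariogram. *)
Let smoothed_covariogram eps z : 0 < eps ->
  \int[LV d]_x (e x * \int[LV d]_y (e y * K eps ((y : 'rV[R]_d) - (x : 'rV[R]_d) - z))) =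
  \int[LV d]_u (K 1 u * covariogram (z + eps *: (u : 'rV[R]_d))).
Proof.
move=> e0.
have inner (x : 'rV[R]_d) : \int[LV d]_y (e y * K eps ((y : 'rV[R]_d) - x - z)) =
    \int[LV d]_u (K 1 u * e (x + (z + eps *: (u : 'rV[R]_d)))).
  pose f (y : bV) : R := e ((y : 'rV[R]_d) + (x + z)) * K eps y.
  have mf : measurable_fun setT f.
    apply: measurable_funM; last exact: mK.
    by apply: (measurableT_comp me); apply: measurable_borelVD; [exact: mid|exact: mcst].
  have f0 y : 0 <= f y by rewrite mulr_ge0 ?e_ge0 ?K_ge0.
  transitivity (\int[LV d]_y f y).
    rewrite -[RHS](Rintegral_LVD (- (x + z)) mf f0).
    by apply: eq_Rintegral => y _; rewrite /f subrK opprD addrA.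
  have ed : 0 < eps ^- d by rewrite invr_gt0 exprn_gt0.
  have := @ge0_integral_mulmx R d eps%:M (eps ^- d) ed (LV_scale e0) (EFin \o f).
  have mf' : measurable_fun setT (EFin \o f) by exact/measurable_EFinP.
  have f0' y : (0 <= (EFin \o f) y)%E by rewrite lee_fin f0.
  move=> /(_ mf' f0') h2.
  have h3 : (\int[LV d]_u (K 1 u * e (x + (z + eps *: (u : 'rV[R]_d))))%:E = \int[LV d]_y (f y)%:E)%E.
    have e1 : (\int[LV d]_y (EFin \o f) ((y : 'rV[R]_d) *m eps%:M) =
      \int[LV d]_u ((eps ^- d)%:E * (K 1 u * e (x + (z + eps *: (u : 'rV[R]_d))))%:E))%E.
      apply: eq_integral => u _; rewrite /= /f mul_mx_scalar -EFinM; congr EFin.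
      have -> : K eps (eps *: (u : 'rV[R]_d)) = eps ^- d * K 1 u.
        rewrite /K /prodw -exprVn -[d in eps^-1 ^+ d]card_ord -prodr_const -big_split /=.
        apply: eq_bigr => j _; rewrite mxE /cauchy.
        have en0 : eps != 0 by rewrite gt_eqF.
        have q0 : 1 + (u : 'rV[R]_d) 0 j ^+ 2 != 0 by rewrite gt_eqF // ltr_pwDl // sqr_ge0.
        field; rewrite ?en0 ?q0 /=.
        by rewrite (_ : _ + _ = eps ^+ 2 * (1 + (u : 'rV[R]_d) 0 j ^+ 2)); [rewrite mulf_neq0 ?expf_neq0|ring].
      rewrite (_ : x + (z + eps *: (u : 'rV[R]_d)) = eps *: (u : 'rV[R]_d) + (x + z)); first by ring.
      by rewrite [RHS]addrC addrA.
    rewrite e1 ge0_integralZl // in h2; last 3 first.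
    - apply/measurable_EFinP; apply: measurable_funM; first exact: mK.
      apply: (measurableT_comp me); apply: measurable_borelVD; first exact: mcst.
      by apply: measurable_borelVD; [exact: mcst|exact: measurable_borelVZ].
    - by move=> u _; rewrite lee_fin mulr_ge0 ?K_ge0 ?e_ge0.
    - by rewrite lee_fin ltW.
    move: h2 => /(congr1 (fun t => (eps ^+ d)%:E * t)%E).
    by rewrite !muleA -!EFinM divff ?mul1e // gt_eqF // exprn_gt0.
  by rewrite /Rintegral h3.
transitivity (\int[LV d]_x (e x * \int[LV d]_u (K 1 u * e ((x : 'rV[R]_d) + (z + eps *: (u : 'rV[R]_d)))))).
  by apply: eq_Rintegral => x _; rewrite inner.
rewrite (@Rintegral_fubini_dom _ _ bV bV R (LV d) (LV d) e (K 1)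
    (fun p => e ((p.1 : 'rV[R]_d) + (z + eps *: (p.2 : 'rV[R]_d))))) //.
apply: (measurableT_comp me); apply: measurable_borelVD; first exact: measurable_fst.
by apply: measurable_borelVD; [exact: mcst|apply: measurable_borelVZ; exact: measurable_snd].
Qed.

Lemma prodw_exp_abs eps (x : 'rV[R]_d) : W eps x = expR (- (eps * \sum_(j < d) `|x 0 j|)).
Proof.
rewrite /W /prodw mulr_sumr -sumrN expR_sum.
by apply: eq_bigr => j _.
Qed.

(** Equate the two evaluations of the smoothed double integral at eps = 1/(n + 1) and let n grow.
    Both sides converge by domination: the covariogram is bounded and [K 1] has mass (2 pi)^d, while
    [W eps] lies in [0, 1] and tends to 1. *)
Theorem fourier_inversion :
  (LV d).-integrable setT (EFin \o (fun xi : bV => fourier xi ^+ 2)) ->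
  (forall z u : 'rV[R]_d, (fun n : nat => covariogram (z + n.+1%:R^-1 *: u)) @ \oo --> covariogram z) ->
  forall z : 'rV[R]_d, (2 * pi) ^+ d * covariogram z =
    \int[LV d]_xi (fourier xi ^+ 2 * cos (dotv (xi : 'rV[R]_d) z)).
Proof.
move=> iC2 ccov z.
have en (n : nat) : 0 < n.+1%:R^-1 :> R by rewrite invr_gt0.
set v := fine (LV d E).
have v0 : 0 <= v by apply: fine_ge0; exact: measure_ge0.
have L : (fun n : nat => \int[LV d]_u (K 1 u * covariogram (z + n.+1%:R^-1 *: (u : 'rV[R]_d)))) @ \oo -->
    \int[LV d]_u (K 1 u * covariogram z).
  apply: (@Rintegral_dominated_convergence _ _ _ _ _ _ (fun u => v * K 1 u)).
  - move=> n; apply: measurable_funM; first exact: mK.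
    apply: (measurableT_comp measurable_covariogram); apply: measurable_borelVD; first exact: mcst.
    exact: measurable_borelVZ.
  - by apply: measurable_funM; [exact: mK|exact: measurable_cst].
  - by move=> u; apply: cvgM; [exact: cvg_cst|exact: ccov].
  - exact: integrableZl_fun K1i.
  - by move=> n u; rewrite normrM mulrC (ger0_norm (K_ge0 _ ltr01)) ler_wpM2r ?K_ge0 // covariogram_le.
have W01 eps x : 0 < eps -> 0 <= W eps x <= 1.
  move=> e0; rewrite prodw_exp_abs expR_ge0 /= -expR0 ler_expR oppr_le0 mulr_ge0 ?(ltW e0) //.
  by apply: sumr_ge0.
have M : (fun n : nat => \int[LV d]_xi (W n.+1%:R^-1 xi * (fourier xi ^+ 2 * cos (dotv (xi : 'rV[R]_d) z)))) @ \oo -->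
    \int[LV d]_xi (fourier xi ^+ 2 * cos (dotv (xi : 'rV[R]_d) z)).
  have mcos : measurable_fun setT (fun xi : bV => cos (dotv (xi : 'rV[R]_d) z)).
    by apply: measurable_cosT; apply: measurable_dotv2; [exact: mid|exact: mcst].
  have mC2 : measurable_fun setT (fun xi : bV => fourier xi ^+ 2 * cos (dotv (xi : 'rV[R]_d) z)).
    by apply: measurable_funM => //; apply: measurable_funX; exact: measurable_fourier.
  apply: (@Rintegral_dominated_convergence _ _ _ _ _ _ (fun xi : bV => fourier xi ^+ 2)) => //.
  - by move=> n; apply: measurable_funM => //; exact: mW.
  - move=> xi; rewrite -[X in _ --> X]mul1r; apply: cvgM; last exact: cvg_cst.
    pose l := \sum_(j < d) `|(xi : 'rV[R]_d) 0 j|.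
    have h : (fun n : nat => expR (- (n.+1%:R^-1 * l))) @ \oo --> expR (- (0 * l)).
      apply: continuous_cvg; first exact: continuous_expR.
      by apply: cvgN; apply: cvgM; [exact: cvg_harmonic|exact: cvg_cst].
    move: h; rewrite mul0r oppr0 expR0; apply: cvg_trans; apply: near_eq_cvg.
    by apply: nearW => n /=; rewrite prodw_exp_abs.
  - move=> n xi; have /andP[w0 w1] := W01 _ xi (en n).
    rewrite normrM (ger0_norm w0) normrM (ger0_norm (sqr_ge0 (fourier xi))).
    apply: (@le_trans _ _ (1 * (fourier xi ^+ 2 * 1))); last by rewrite mul1r mulr1.
    by apply: ler_pM => //; [rewrite mulr_ge0 // sqr_ge0|rewrite ler_wpM2l ?sqr_ge0 // cos_max].
have e1 : \int[LV d]_u (K 1 u * covariogram z) = (2 * pi) ^+ d * covariogram z.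
  by rewrite RintegralZr // K1_total.
rewrite -e1; apply: (@cvg_unique _ (@norm_hausdorff _ R^o) _ _ _ _ _ M).
rewrite (_ : (fun n : nat => _) = (fun n : nat => \int[LV d]_u (K 1 u * covariogram (z + n.+1%:R^-1 *: (u : 'rV[R]_d))))) //.
apply/funext => n; rewrite -(smoothed_covariogram _ (en n)) (smoothed_fourier _ (en n)).
by apply: eq_Rintegral => xi _; ring.
Qed.

End fourier_inversion.

(** * Ellipsoids *)

Section ellipsoid.
Context {R : realType} (n : nat).
Local Notation d := n.+1.
Local Notation bV := (borelV R d).
Variable A : 'M[R]_d.
Hypothesis uA : A \in unitmx.

(* The ball of radius r, in the coordinates in which the lattice is Z^d. *)
Definition ellipsoid (r : R) : set bV := [set x : bV | eballV r ((x : 'rV[R]_d) *m A)].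

Lemma measurable_ellipsoid r : measurable (ellipsoid r).
Proof. exact: (measurable_preimage_mulmx A (measurable_eball r)). Qed.

Lemma LV_ellipsoid : exists2 c : R, 0 < c & forall r, 0 <= r -> LV d (ellipsoid r) = (c * r ^+ d)%:E.
Proof.
have [c c0 cE] := LV_mulmx uA; exists (c * @unit_ball_volume R d).
  by rewrite mulr_gt0 ?unit_ball_volume_gt0.
by move=> r r0; rewrite (cE _ (measurable_eball r)) LV_eball_ge0 // -EFinM mulrA.
Qed.

Lemma LV_ellipsoid_lty r : 0 <= r -> (LV d (ellipsoid r) < +oo)%E.
Proof. by move=> r0; have [c _ ->] := LV_ellipsoid; rewrite ?ltry. Qed.

Lemma ellipsoidN r (x : 'rV[R]_d) : ellipsoid r (- x) <-> ellipsoid r x.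
Proof. by rewrite /ellipsoid /eballV /eball /= mulNmx enormN. Qed.

(** The map y -> y (r^-1 A) carries the ellipsoid to the unit ball, and the product of z A^T with y
    equals that of r z with the image of y. This is why frequencies are written z A^T. *)
Lemma fourier_ellipsoid : exists2 c : R, 0 < c & forall r z, 0 < r ->
  fourier (ellipsoid r) (z *m A^T) = c * r ^+ d * bessel0 n (r * enorm z).
Proof.
have [c c0 cE] := LV_mulmx uA; exists (c * @unit_ball_volume R n).
  by rewrite mulr_gt0 ?unit_ball_volume_gt0.
move=> r z r0.
have ri : 0 < r^-1 by rewrite invr_gt0.
have rc : 0 < c * r ^+ d by rewrite mulr_gt0 ?exprn_gt0.
have cM (B : set bV) : measurable B ->
    LV d [set y | B ((y : 'rV[R]_d) *m (r^-1 *: A))] = ((c * r ^+ d)%:E * LV d B)%E.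
  move=> mB; rewrite mulrC EFinM -muleA -(cE B mB).
  have mB' := measurable_preimage_mulmx A mB.
  have := LV_scale ri mB'; rewrite exprVn invrK => <-; congr (LV d _).
  by apply/seteqP; split => y /=; rewrite mul_mx_scalar -scalemxAl scalemxAr.
have mE := @measurable_eball R d 1.
have fi := bounded_on_integrable mE (_ : (LV d (eballV 1) < +oo)%E) (measurable_cos_dotv (r *: z)) (fun x => cos_max _).
have lt1 : (LV d (@eballV R d 1) < +oo)%E by rewrite -ge0_fin_numE ?eball_fin_num.
have := Rintegral_mulmx rc cM mE (fi lt1); rewrite ball_cos enormZ (gtr0_norm r0) => e.
rewrite [RHS](_ : _ = c * r ^+ d * (@unit_ball_volume R n * bessel0 n (r * enorm z))); last by ring.
rewrite -e /fourier [in RHS]Rintegral_mkcond; apply: eq_Rintegral => x _.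
rewrite patchE indicE.
have -> : [set y : bV | eballV 1 ((y : 'rV[R]_d) *m (r^-1 *: A))] = ellipsoid r.
  apply/seteqP; split => y /=; rewrite /ellipsoid /eballV /eball /= -scalemxAr enormZ gtr0_norm //;
  by rewrite ler_pdivrMl // mulr1.
case: (x \in ellipsoid r); last by rewrite mul0r.
rewrite mul1r dotv_mulmx trmxK -scalemxAr dotvZl dotvZr mulrA mulfV ?mul1r // gt_eqF //.
Qed.

Lemma enorm_mulmx_tr (z : 'rV[R]_d) : enorm (z *m A^T) <= d%:R * mx_abs_sum A^T * enorm z.
Proof.
rewrite -mulrA; apply: enorm_le_box => j; rewrite mulrC; apply: mulmx_coord_le => i.
exact: coord_le_enorm.
Qed.

(** Let t = r |z| with xi = z A^T. For t >= 1, Bessel decay of order d + 1 gives the weaker order d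
    + k because k <= 1; for t < 1 the trivial bound by the squared volume suffices, since t^-(d+k)
    >= 1. *)
Lemma fourier_ellipsoid_decay (k : R) : 0 <= k <= 1 -> exists2 K : R, 0 < K &
  forall r xi, 0 < r -> xi != 0 ->
  fourier (ellipsoid r) xi ^+ 2 <= K * r `^ (d%:R - k) * enorm xi `^ (- (d%:R + k)).
Proof.
move=> /andP[k0 k1].
have [c c0 cE] := LV_ellipsoid; have [c' c'0 fE] := fourier_ellipsoid.
have [K K0 KE] := @bessel_decay R n.
(* S bounds the operator norm of A^T and gives |xi| <= S |z|; adding 1 keeps it positive. *)
pose S := d%:R * mx_abs_sum A^T + 1; pose p := d%:R + k.
have p0 : 0 <= p by rewrite addr_ge0.
have S0 : 0 < S by rewrite ltr_wpDl // mulr_ge0 // mx_abs_sum_ge0.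
(* One summand for each of the regimes t < 1 and t >= 1. *)
pose K2 := c ^+ 2 + c' ^+ 2 * K.
have K20 : 0 < K2 by rewrite ltr_pwDl ?exprn_gt0 // mulr_ge0 // sqr_ge0.
exists (K2 * S `^ p); first by rewrite mulr_gt0 // powR_gt0.
move=> r xi r0 xi0; pose z := xi *m invmx A^T.
have uAT : A^T \in unitmx by rewrite unitmx_tr.
have zE : z *m A^T = xi by rewrite /z mulmxKV.
have ex0 : 0 < enorm xi by rewrite lt_def enorm_eq0 xi0 enorm_ge0.
have xz : enorm xi <= S * enorm z.
  by rewrite -zE; apply: (le_trans (enorm_mulmx_tr z)); rewrite ler_wpM2r ?enorm_ge0 // lerDl.
have ez0 : 0 < enorm z by rewrite -(pmulr_rgt0 _ S0) (lt_le_trans ex0).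
pose t := r * enorm z; have t0 : 0 < t by rewrite mulr_gt0.
(* As r^(d - k) = r^(2d) r^-p, the bound is a decreasing function of r |xi| / S, which is at most
   t. *)
have -> : K2 * S `^ p * r `^ (d%:R - k) * enorm xi `^ (- p) =
    K2 * (r ^+ d) ^+ 2 * (r * (enorm xi / S)) `^ (- p).
  rewrite (powRM _ (ltW r0)) ?divr_ge0 ?ltW //.
  have -> : enorm xi `^ (- p) = (enorm xi / S) `^ (- p) * (S `^ p)^-1.
    by rewrite -powRN -powRM ?divr_ge0 ?(ltW S0) ?(ltW ex0) // divfK // gt_eqF.
  have -> : r `^ (d%:R - k) = (r ^+ d) ^+ 2 * r `^ (- p).
    rewrite -exprM -powR_mulrn ?(ltW r0) // -powRD; last by rewrite (gt_eqF r0) implybT.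
    by congr (_ `^ _); rewrite /p natrM; ring.
  have Sp : S `^ p != 0 by rewrite gt_eqF // powR_gt0.
  by field.
have le1 : t `^ (- p) <= (r * (enorm xi / S)) `^ (- p).
  rewrite !powRN lef_pV2 ?posrE ?powR_gt0 // ?mulr_gt0 ?divr_gt0 ?invr_gt0 //.
  apply: ge0_ler_powR => //.
  - by rewrite nnegrE mulr_ge0 // ?divr_ge0 // ltW.
  - by rewrite nnegrE ltW.
  - by rewrite ler_pM2l // ler_pdivrMr // mulrC.
apply: (@le_trans _ _ (K2 * (r ^+ d) ^+ 2 * t `^ (- p))); last first.
  by rewrite ler_wpM2l // mulr_ge0 ?sqr_ge0 // ltW.
have rd : 0 <= (r ^+ d) ^+ 2 by exact: sqr_ge0.
have [t1|t1] := leP 1 t.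
  rewrite -zE fE // !exprMn.
  have b := KE t t1.
  apply: (@le_trans _ _ (c' ^+ 2 * (r ^+ d) ^+ 2 * (K * t `^ (- p)))).
    rewrite ler_wpM2l ?(mulr_ge0 (sqr_ge0 _) rd) //; apply: (le_trans b).
    rewrite ler_wpM2l // powRN lef_pV2 ?posrE ?powR_gt0 ?exprn_gt0 //.
    rewrite -powR_mulrn ?(ltW t0) //; apply: ler_powR => //.
    by rewrite /p -[n.+2%:R]natr1 lerD2l.
  rewrite [leLHS](_ : _ = c' ^+ 2 * K * ((r ^+ d) ^+ 2 * t `^ (- p))); last by ring.
  rewrite -[leRHS]mulrA ler_wpM2r ?(mulr_ge0 rd) ?powR_ge0 //.
  by rewrite lerDr sqr_ge0.
have f1 := fourier_le (measurable_ellipsoid r) (LV_ellipsoid_lty (ltW r0)) xi.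
rewrite cE ?(ltW r0) //= in f1.
apply: (@le_trans _ _ ((c * r ^+ d) ^+ 2)).
  by rewrite -real_normK ?num_real // lerXn2r ?nnegrE // mulr_ge0 ?exprn_ge0 ?ltW.
rewrite exprMn -[leLHS]mulr1; apply: ler_pM; rewrite ?(mulr_ge0 (sqr_ge0 _) rd) //.
  by rewrite ler_wpM2r // lerDl mulr_ge0 // sqr_ge0.
rewrite powRN invf_ge1 ?powR_gt0 // -[leRHS](_ : 1 `^ p = 1); last by rewrite powR1.
by apply: ge0_ler_powR; rewrite ?nnegrE // ltW.
Qed.

Lemma ellipsoid_translate r (h : 'rV[R]_d) x : 
  ellipsoid (r - enorm (h *m A)) x -> ellipsoid r x /\ ellipsoid r ((x : 'rV[R]_d) + h).
Proof.
rewrite /ellipsoid /eballV /eball /= => hx; split.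
  by apply: (le_trans hx); rewrite lerBlDr lerDl enorm_ge0.
by rewrite mulmxDl; apply: (le_trans (enormD _ _)); rewrite -lerBrDr.
Qed.

(** If x counts in the first covariogram but not in the second, then y = x + z is in the ellipsoid
    and y + h is not, so by the triangle inequality y lies outside the ellipsoid of radius r - |h
    A|. *)
Lemma covariogram_ellipsoid_diff (c r : R) (z h : 'rV[R]_d) : 
  (forall r, 0 <= r -> LV d (ellipsoid r) = (c * r ^+ d)%:E) ->
  enorm (h *m A) <= r ->
  covariogram (ellipsoid r) z - covariogram (ellipsoid r) (z + h) <=
  c * r ^+ d - c * (r - enorm (h *m A)) ^+ d.
Proof.
move=> cE hr; set s := r - _.
have s0 : 0 <= s by rewrite subr_ge0.
have r0 : 0 <= r by exact: le_trans (enorm_ge0 _) hr.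
have mE := measurable_ellipsoid r; have ms := measurable_ellipsoid s.
have fE := LV_ellipsoid_lty r0; have fs := LV_ellipsoid_lty s0.
have i1 t : 0 <= t -> (LV d).-integrable setT (EFin \o (\1_(ellipsoid t) : bV -> R)).
  move=> t0; by apply: indic_integrable; [exact: measurable_ellipsoid|exact: LV_ellipsoid_lty].
have mi t : measurable_fun setT (\1_(ellipsoid t) : bV -> R).
  by apply: measurable_indic; exact: measurable_ellipsoid.
have mtr (y : 'rV[R]_d) : measurable_fun setT (fun x : bV => \1_(ellipsoid r) ((x : 'rV[R]_d) + y : bV) : R).
  apply: (measurableT_comp (mi r)); apply: measurable_borelVD; [exact: measurable_id|exact: measurable_cst].
have b1 (x : bV) : `|\1_(ellipsoid r) x : R| <= 1 by rewrite indicE; case: (_ \in _); rewrite ?normr0 ?normr1.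
have i2 (y : 'rV[R]_d) : (LV d).-integrable setT (EFin \o (fun x : bV => \1_(ellipsoid r) x * \1_(ellipsoid r) ((x : 'rV[R]_d) + y : bV) : R)).
  by apply: integrable_mul_le1 => //; exact: i1.
rewrite /covariogram -RintegralB //; try exact: i2.
pose f (y : bV) : R := \1_(ellipsoid r) y * (1 - \1_(ellipsoid r) ((y : 'rV[R]_d) + h : bV)).
have f0 y : 0 <= f y.
  by rewrite /f !indicE; do 2 case: (_ \in _); rewrite ?subr0 ?subrr ?mulr0 ?mul0r ?mulr1.
have mf : measurable_fun setT f by apply: measurable_funM => //; apply: measurable_funB.
have fi : (LV d).-integrable setT (EFin \o f).
  apply: integrable_mul_le1; [exact: measurable_funB| |exact: i1].
  by move=> x; rewrite indicE; case: (_ \in _); rewrite ?subr0 ?subrr ?normr0 ?normr1.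
apply: (@le_trans _ _ (\int[LV d]_x f ((x : 'rV[R]_d) + z))).
  apply: le_Rintegral => //.
  - pose g (y : 'rV[R]_d) (x : bV) : R := \1_(ellipsoid r) x * \1_(ellipsoid r) ((x : 'rV[R]_d) + y : bV).
    pose g2 : bV -> R := g (z + h)%R; rewrite (_ : EFin \o _ = (EFin \o g z) \- (EFin \o g2))%E //.
    by apply: integrableB => //; exact: i2.
  - apply/integrableP; split.
      apply/measurable_EFinP; apply: (measurableT_comp mf); apply: measurable_borelVD; [exact: measurable_id|exact: measurable_cst].
    rewrite (ge0_integral_LVD z (f := fun x => `|(f x)%:E|%E)) //.
      by case/integrableP: fi.
    by apply: measurableT_comp => //; exact/measurable_EFinP.
  - move=> x _; rewrite /f addrA !indicE; do 3 case: (_ \in _);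
    by rewrite ?subr0 ?subrr ?mulr0 ?mul0r ?mulr1 ?sub0r ?subr0 ?oppr_le0 ?oppr0 ?ler01.
rewrite (Rintegral_LVD z mf f0).
apply: (@le_trans _ _ (\int[LV d]_x (\1_(ellipsoid r) x - \1_(ellipsoid s) x))).
  apply: le_Rintegral => //.
    rewrite (_ : EFin \o _ = (EFin \o \1_(ellipsoid r)) \- (EFin \o \1_(ellipsoid s)))%E //.
    by apply: integrableB => //; exact: i1.
  move=> x _; rewrite /f mulrBr mulr1 lerD2l lerN2 !indicE.
  case: (boolP (x \in ellipsoid s)) => [|_]; last by rewrite mulr_ge0.
  rewrite inE => /ellipsoid_translate[h1 h2].
  by rewrite !mem_set // mulr1.
rewrite RintegralB //; try exact: i1.
by rewrite !Rintegral_indicE // !cE.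
Qed.

Lemma covariogram_ellipsoid_cvg r (z u : 'rV[R]_d) : 0 < r ->
  (fun k : nat => covariogram (ellipsoid r) (z + k.+1%:R^-1 *: u)) @ \oo --> covariogram (ellipsoid r) z.
Proof.
move=> r0; have [c c0 cE] := LV_ellipsoid.
pose eta (k : nat) := enorm ((k.+1%:R^-1 *: u) *m A).
have etaE k : eta k = k.+1%:R^-1 * enorm (u *m A).
  by rewrite /eta -scalemxAl enormZ gtr0_norm // invr_gt0.
have eta0 : eta @ \oo --> 0.
  rewrite (funext etaE) -(mul0r (enorm (u *m A))).
  by apply: cvgM; [exact: cvg_harmonic|exact: cvg_cst].
have w0 : (fun k => c * r ^+ d - c * (r - eta k) ^+ d) @ \oo --> 0.
  rewrite -(subrr (c * r ^+ d)); apply: cvgB; first exact: cvg_cst.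
  apply: cvgM; first exact: cvg_cst.
  have h : (fun k => r - eta k) @ \oo --> r - 0 by apply: cvgB; [exact: cvg_cst|exact: eta0].
  by rewrite subr0 in h; exact: (cvg_comp _ _ h (@exprn_continuous R d r)).
have etar : \forall k \near \oo, eta k <= r.
  near=> k; apply/ltW; near: k; exact: (cvgr_lt 0 eta0).
apply/cvgrPdist_le => e e0; near=> k.
have hk : eta k <= r by near: k.
have h1 := @covariogram_ellipsoid_diff c r z (k.+1%:R^-1 *: u) cE hk.
have h2 : covariogram (ellipsoid r) (z + k.+1%:R^-1 *: u) - covariogram (ellipsoid r) z <= c * r ^+ d - c * (r - eta k) ^+ d.
  have hk' : enorm (- (k.+1%:R^-1 *: u) *m A) <= r by rewrite mulNmx enormN.
  have := @covariogram_ellipsoid_diff c r (z + k.+1%:R^-1 *: u) _ cE hk'.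
  by rewrite addrK mulNmx enormN.
apply: (@le_trans _ _ (c * r ^+ d - c * (r - eta k) ^+ d)).
  by rewrite ler_norml h1 andbT lerNl opprB.
by apply: (le_trans (ler_norm _)); near: k; exact: (cvgr0_norm_le _ w0).  
Unshelve. all: by end_near.
Qed.

End ellipsoid.

(** * One-sided Poisson summation *)

Section dyadic_shells.
Context {R : realType}.

Lemma sum_geom0_le (r : R) n : 0 <= r < 1 -> \sum_(k < n) r ^+ k <= (1 - r)^-1.
Proof.
move=> /andP[r0 r1]; have r1' : 0 < 1 - r by rewrite subr_gt0.
rewrite -[leRHS]mul1r ler_pdivlMr //.
have e : 1 - r ^+ n = (1 - r) * (\sum_(i < n) r ^+ i).
  by rewrite -opprB subrX1 -mulNr opprB.
by rewrite mulrC -e lerBlDr lerDl exprn_ge0.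
Qed.

Lemma dyadic_shell (x : R) : 1 <= x -> exists k : nat, 2 ^+ k <= x <= 2 ^+ k.+1.
Proof.
move=> x1.
have ex : exists k, x <= 2 ^+ k.+1.
  exists (Num.trunc x); apply/ltW; apply: (lt_le_trans (truncnS_gt x)).
  by rewrite -natrX ler_nat ltnW // ltn_expl.
exists (ex_minn ex); case: ex_minnP => m -> /= mP; rewrite andbT.
case: m mP => [_|m /(_ m)]; first by rewrite expr0.
by rewrite ltnn => mP; rewrite leNgt; apply/negP => /ltW /mP.
Qed.

End dyadic_shells.

Section countable_cover.
Context {disp} {T : measurableType disp} {R : realType} (mu : {measure set T -> \bar R}).

Lemma nneseries_le_of_partial (u : nat -> \bar R) (b : nat -> R) (B : R) :
  (forall k, 0 <= u k)%E -> (forall k, u k <= (b k)%:E)%E ->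
  (forall N, \sum_(k < N) b k <= B) -> (\sum_(0 <= k <oo) u k <= B%:E)%E.
Proof.
move=> u0 ub bB; apply: lime_le; first exact: is_cvg_nneseries.
apply: nearW => N; apply: (@le_trans _ _ (\sum_(0 <= k < N) (b k)%:E)%E).
  by apply: lee_sum => k _; exact: ub.
by rewrite big_mkord sumEFin lee_fin.
Qed.

(** It is enough that at each point one of the h k dominates f. Overlaps are harmless, so dyadic
    shells may be replaced by the full cubes that contain them. *)
Lemma integral_le_cover (f : T -> \bar R) (h : nat -> T -> \bar R) (b : nat -> R) (B : R) :
  measurable_fun setT f -> (forall x, 0 <= f x)%E ->
  (forall k, measurable_fun setT (h k)) -> (forall k x, 0 <= h k x)%E ->
  (forall x, exists k, (f x <= h k x)%E) ->
  (forall k, \int[mu]_x h k x <= (b k)%:E)%E ->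
  (forall N, \sum_(k < N) b k <= B) ->
  (\int[mu]_x f x <= B%:E)%E.
Proof.
move=> mf f0 mh h0 fh hb bB.
apply: (@le_trans _ _ (\int[mu]_x \sum_(0 <= k <oo) h k x)%E).
  apply: ge0_le_integral => //.
  - by apply: ge0_emeasurable_sum => // k; exact: mh.
  - move=> x _; have [k fk] := fh x; apply: (le_trans fk).
    apply: (@le_trans _ _ (\sum_(0 <= i < k.+1) h i x)%E).
      by rewrite big_nat_recr //= leeDr // sume_ge0.
    exact: nneseries_lim_ge.
rewrite integral_nneseries //.
by apply: nneseries_le_of_partial hb bB => k; apply: integral_ge0.
Qed.

Lemma Rintegral_sum_seq (I : Type) (s : seq I) (f : I -> T -> R) :
  (forall i, mu.-integrable setT (EFin \o f i)) ->
  mu.-integrable setT (EFin \o (fun x => \sum_(i <- s) f i x)) /\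
  \int[mu]_x (\sum_(i <- s) f i x) = \sum_(i <- s) \int[mu]_x f i x.
Proof.
move=> fi; elim: s => [|i s [IH1 IH2]].
  have e : (fun x => \sum_(i <- [::]) f i x) = cst 0 by apply/funext => x; rewrite big_nil.
  by rewrite e big_nil Rintegral_cst // mul0r; split => //; exact: integrable0.
have e : (fun x => \sum_(j <- i :: s) f j x) = (fun x => f i x + \sum_(j <- s) f j x).
  by apply/funext => x; rewrite big_cons.
rewrite e; split; last by rewrite RintegralD // IH2 big_cons.
rewrite (_ : EFin \o _ = (EFin \o f i) \+ (EFin \o (fun x => \sum_(j <- s) f j x)%R))%E //.
exact: integrableD.
Qed.

End countable_cover.

Section trig_kernel.
Context {R : realType} {d : nat}.
Local Notation bV := (borelV R d).

(* |sum_(k in s) exp (i xi.k)|^2 *)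
Definition trig_kernel (s : seq 'rV[int]_d) (xi : bV) : R :=
  (\sum_(k <- s) cos (dotv (xi : 'rV[R]_d) (ivec k))) ^+ 2 +
  (\sum_(k <- s) sin (dotv (xi : 'rV[R]_d) (ivec k))) ^+ 2.

Lemma trig_kernel_ge0 s xi : 0 <= trig_kernel s xi.
Proof. by rewrite addr_ge0 ?sqr_ge0. Qed.

(** Exchanging k and l changes the sign of sin (xi.(k - l)), so the sin c part cancels. *)
Lemma trig_kernelE s (xi : 'rV[R]_d) (c : R) :
  \sum_(k <- s) \sum_(l <- s) cos (dotv xi (ivec (k - l)) + c) = cos c * trig_kernel s xi.
Proof.
set C := \sum_(k <- s) cos (dotv xi (ivec k)); set S := \sum_(k <- s) sin (dotv xi (ivec k)).
have -> : cos c * trig_kernel s xi = cos c * (C * C + S * S) - sin c * (S * C - C * S).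
  by rewrite /trig_kernel -/C -/S; ring.
rewrite /C /S !big_distrlr /= -sumrB -big_split /= !mulr_sumr -sumrB; apply: eq_bigr => k _.
rewrite -sumrB -big_split /= !mulr_sumr -sumrB; apply: eq_bigr => l _.
by rewrite ivecB dotvBr !(cosD, sinD, cosN, sinN); ring.
Qed.

Lemma measurable_trig_kernel s : measurable_fun setT (trig_kernel s).
Proof.
by apply: measurable_funD; apply: measurable_funX; apply: measurable_sum => k;
  [exact: measurable_cos_dot|exact: measurable_sin_dot].
Qed.

(** Expand the kernel as a double sum over k and l: by orthogonality only the diagonal survives,
    each of its terms giving the volume of the cube. *)
Lemma integral_cube_trig_kernel N (s : seq 'rV[int]_d) : (0 < N)%N -> uniq s ->
  (\int[LV d]_x (\1_(cube (@cube_side R N)) x * trig_kernel s x)%:E =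
    ((size s)%:R * (2 * @cube_side R N) ^+ d)%:E)%E.
Proof.
move=> N0 us.
have i1 (k l : 'rV[int]_d) : (LV d).-integrable setT (EFin \o
    (fun x : bV => \1_(cube (@cube_side R N)) x * cos (dotv (x : 'rV[R]_d) (ivec (k - l))) : R)).
  apply: integrable_mul_le1; [exact: measurable_cos_dot|by move=> x; exact: cos_max|].
  apply: indic_integrable; first exact: measurable_cube.
  by rewrite LV_cube ?ltry // cube_side_ge0.
have i2 k := Rintegral_sum_seq s (i1 k).
have [i3 e3] := Rintegral_sum_seq s (fun k => (i2 k).1).
have e (x : bV) : \1_(cube (@cube_side R N)) x * trig_kernel s x =
    \sum_(k <- s) \sum_(l <- s) (\1_(cube (@cube_side R N)) x * cos (dotv (x : 'rV[R]_d) (ivec (k - l)))) :> R.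
  rewrite -[trig_kernel s x]mul1r -(@cos0 R) -trig_kernelE mulr_sumr; apply: eq_bigr => k _.
  by rewrite mulr_sumr; apply: eq_bigr => l _; rewrite addr0.
transitivity (\int[LV d]_x (\sum_(k <- s) \sum_(l <- s) (\1_(cube (@cube_side R N)) x * cos (dotv (x : 'rV[R]_d) (ivec (k - l)))))%:E)%E.
  by apply: eq_integral => x _; rewrite e.
rewrite EFin_Rintegral // e3; congr EFin.
transitivity (\sum_(k <- s) (2 * @cube_side R N) ^+ d); last first.
  by rewrite big_const_seq count_predT iter_addr addr0 [RHS]mulr_natl.
rewrite big_seq [RHS]big_seq; apply: eq_bigr => k ks.
rewrite (i2 k).2 (bigD1_seq k) //= Rintegral_cube_cos // subrr eqxx big1 ?addr0 // => l lk.
by rewrite Rintegral_cube_cos // subr_eq0 eq_sym (negbTE lk).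
Qed.

End trig_kernel.

Section spectral_bounds.
Context {R : realType} {d : nat}.
Local Notation bV := (borelV R d).
Variables (g : bV -> R) (M L kap : R).
Hypotheses (mg : measurable_fun setT g) (g_ge0 : forall x, 0 <= g x) (g_le : forall x, g x <= M).
Hypotheses (L_ge0 : 0 <= L) (kap_gt0 : 0 < kap).
Hypothesis g_decay : forall x : 'rV[R]_d, x != 0 -> g x <= L * enorm x `^ (- (d%:R + kap)).
Let p := d%:R + kap.

Let p_gt0 : 0 < p. Proof. by rewrite ltr_wpDl. Qed.

Let M_ge0 : 0 <= M. Proof. exact: le_trans (g_ge0 0) (g_le 0). Qed.

Let powR2N (y : R) : 0 < y -> 0 <= (2 : R) `^ (- y) < 1.
Proof.
move=> y0; rewrite powR_ge0 /= powRN invf_lt1 ?powR_gt0 //.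
by rewrite -[ltLHS](_ : 1 `^ y = 1); [rewrite gt0_ltr_powR ?nnegrE ?ltr1n|rewrite powR1].
Qed.

Let decay_shell (x : 'rV[R]_d) (t : R) : 0 < t -> t <= enorm x -> g x <= L * t `^ (- p).
Proof.
move=> t0 tx; have x0 : x != 0 by rewrite -enorm_eq0 gt_eqF // (lt_le_trans t0).
apply: (le_trans (g_decay x0)); rewrite ler_wpM2l // !powRN.
rewrite lef_pV2 ?posrE ?powR_gt0 ?(lt_le_trans t0) //.
by apply: ge0_ler_powR; rewrite ?nnegrE ?enorm_ge0 // ltW.
Qed.

Let pow2p : (2 : R) `^ (- p) * 2 ^+ d = 2 `^ (- kap).
Proof.
have <- : (2 : R) `^ d%:R = 2 ^+ d by rewrite powR_mulrn.
rewrite -powRD; last by rewrite pnatr_eq0 implybT.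
by congr (_ `^ _); rewrite /p; ring.
Qed.

(** The sum over k of 2^((k+1) d) (2^k)^-(d + kap): the volume, in units of (2 pi)^d, of the cube
    around the k-th shell times the decay there. *)
Definition shell_const : R := 2 ^+ d * (1 - 2 `^ (- kap))^-1.

(* The kernel is nonnegative and its integral over a cube of side 2 pi N is
   exactly |s| (2 pi N)^d, so g may be replaced by its bounds on dyadic shells. *)
Lemma integral_trig_kernel_le (s : seq 'rV[int]_d) : uniq s ->
  (\int[LV d]_x (g x * trig_kernel s x)%:E <=
    ((2 * pi) ^+ d * (size s)%:R * (M + L * shell_const))%:E)%E.
Proof.
move=> us; pose c : R := (2 * pi) ^+ d * (size s)%:R.
have c0 : 0 <= c by rewrite mulr_ge0 // exprn_ge0 // mulr_ge0 // pi_ge0.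
(* Index 0 is the cube of side 2 pi with the bound M. Index k + 1 is the cube of half-side pi
   2^(k+1), which contains the shell 2^k <= |x| <= 2^(k+1), with the decay at its inner radius.
   Points outside the first cube have |x| >= 1 and so lie in some shell. *)
pose N (k : nat) := if k is k'.+1 then (2 ^ k)%N else 1%N.
pose a (k : nat) : R := if k is k'.+1 then L * (2 ^+ k') `^ (- p) else M.
have N0 k : (0 < N k)%N by case: k => [//|k]; rewrite /N expn_gt0.
have a0 k : 0 <= a k by case: k => [//|k]; rewrite /a mulr_ge0 // powR_ge0.
have N1 k : (1 : R) <= (N k)%:R by rewrite ler1n.
have mk := measurable_trig_kernel s.
have mi k : measurable_fun setT (\1_(cube (@cube_side R (N k))) : bV -> R).
  by apply: measurable_indic; exact: measurable_cube.
have h0 k (x : bV) : 0 <= \1_(cube (@cube_side R (N k))) x * trig_kernel s x.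
  by rewrite mulr_ge0 ?trig_kernel_ge0 // indicE.
apply: (@integral_le_cover _ _ _ (LV d) _
  (fun k x => (a k)%:E * (\1_(cube (@cube_side R (N k))) x * trig_kernel s x)%:E)%E
  (fun k => a k * ((size s)%:R * (2 * @cube_side R (N k)) ^+ d))).
- by apply/measurable_EFinP; exact: measurable_funM.
- by move=> x; rewrite lee_fin mulr_ge0 ?trig_kernel_ge0.
- by move=> k; apply: measurable_funeM; apply/measurable_EFinP; exact: measurable_funM.
- by move=> k x; rewrite -EFinM lee_fin mulr_ge0.
- move=> x.
  suff [k xk ak] : exists2 k, cube (@cube_side R (N k)) x & g x <= a k.
    by exists k; rewrite -EFinM lee_fin indicE mem_set // mul1r ler_wpM2r ?trig_kernel_ge0.
  have [xc|xc] := pselect (cube (@cube_side R (N 0)) x); first by exists 0.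
  have x1 : 1 <= enorm (x : 'rV[R]_d).
    apply: contra_notT xc; rewrite -ltNge => x1; apply/cubeP => j.
    apply: (le_trans (coord_le_enorm _ _)); apply/ltW; apply: (lt_le_trans x1).
    by rewrite /cube_side mulr1; apply: le_trans (pi_ge2 R); rewrite ler1n.
  have [k /andP[k1 k2]] := dyadic_shell x1.
  exists k.+1; last by apply: decay_shell => //; rewrite exprn_gt0.
  apply/cubeP => j; apply: (le_trans (coord_le_enorm _ _)); apply: (le_trans k2).
  rewrite /cube_side /N natrX ler_peMl ?exprn_ge0 //.
  by apply: le_trans (pi_ge2 R); rewrite ler1n.
- move=> k.
  have mE : measurable_fun setT (fun x : bV => (\1_(cube (@cube_side R (N k))) x * trig_kernel s x)%:E).
    by apply/measurable_EFinP; exact: measurable_funM.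
  rewrite ge0_integralZl ?lee_fin //.
    by rewrite integral_cube_trig_kernel // EFinM.
  by move=> x _; rewrite lee_fin.
- move=> K.
  have e k : a k.+1 * ((size s)%:R * (2 * @cube_side R (N k.+1)) ^+ d) =
      c * L * 2 ^+ d * (2 `^ (- kap)) ^+ k.
    rewrite /a /N /cube_side powR_exprn // natrX.
    rewrite (_ : 2 * (pi * 2 ^+ k.+1) = (2 * pi) * (2 ^+ k * 2)); last by rewrite exprS; ring.
    by rewrite !exprMn -pow2p exprMn -!exprM (mulnC k d) /c !exprMn; ring.
  have cL : 0 <= c * L * 2 ^+ d by apply: mulr_ge0; [exact: mulr_ge0|exact: exprn_ge0].
  apply: (@le_trans _ _ (c * M + c * L * 2 ^+ d * \sum_(k < K) (2 `^ (- kap)) ^+ k)).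
    case: K => [|K].
      by rewrite !big_ord0 mulr0 addr0 mulr_ge0.
    rewrite big_ord_recl /=; apply: lerD.
      by rewrite /a /N /cube_side mulr1 /c; rewrite le_eqVlt; apply/orP; left; apply/eqP; ring.
    under eq_bigr => k _ do rewrite /bump /= add1n e.
    rewrite -mulr_sumr ler_wpM2l //.
    by rewrite [leRHS]big_ord_recr lerDl exprn_ge0 // powR_ge0.
  rewrite -/c mulrDr lerD2l /shell_const !mulrA ler_wpM2l //.
  exact: sum_geom0_le (powR2N kap_gt0).
Qed.

(** The case s = {0} of the previous bound, where the kernel is constantly 1. *)
Lemma integrable_spectral : (LV d).-integrable setT (EFin \o g).
Proof.
apply/integrableP; split; first exact/measurable_EFinP.
have k1 x : @trig_kernel R d [:: 0] x = 1.
  rewrite /trig_kernel !big_seq1 /ivec map_mx0.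
  rewrite (_ : dotv _ _ = 0); first by rewrite cos0 sin0 expr1n expr0n addr0.
  by rewrite dotvC dotv0l.
apply: (@le_lt_trans _ _ (\int[LV d]_x (g x * trig_kernel [:: 0] x)%:E)%E).
  rewrite le_eqVlt; apply/orP; left; apply/eqP; apply: eq_integral => x _.
  by rewrite /= k1 mulr1 ger0_norm.
by apply: le_lt_trans (integral_trig_kernel_le _) _; rewrite ?ltry.
Qed.

(** The first summand collects the shells with |x| >= 1, where w <= 1, the second those with |x| <
    1, where w <= W |x|^th; there the ratio 2^(kap - th) is below 1 as kap < th. *)
Definition weight_const (W th : R) : R :=
  4 ^+ d * (1 - 2 `^ (- kap))^-1 + W * 2 ^+ d * 2 `^ p * (1 - 2 `^ (kap - th))^-1.

(** In contrast to the kernel bound, the decay estimate is used up to the origin, where it is not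
    integrable; the weight, of order |x|^th, compensates. *)
Lemma integral_weight_le (w : bV -> R) (W th : R) : kap < th -> 0 <= W ->
  measurable_fun setT w -> (forall x, 0 <= w x <= 1) ->
  (forall x : 'rV[R]_d, w x <= W * enorm x `^ th) ->
  (\int[LV d]_x (g x * w x)%:E <= (L * weight_const W th)%:E)%E.
Proof.
move=> kt W0 mw w01 wW.
have th0 : 0 < th by exact: lt_trans kt.
pose a1 k : R := L * (2 ^+ k) `^ (- p).
pose a2 k : R := L * (2^-1 ^+ k.+1) `^ (- p) * (W * (2^-1 ^+ k) `^ th).
have a10 k : 0 <= a1 k by rewrite mulr_ge0 ?powR_ge0.
have a20 k : 0 <= a2 k by rewrite !mulr_ge0 ?powR_ge0.
have mi c : measurable_fun setT (\1_(cube c) : bV -> R).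
  by apply: measurable_indic; exact: measurable_cube.
have mE c : measurable_fun setT (fun x : bV => (\1_(cube c) x : R)%:E) by exact/measurable_EFinP.
have iE c : 0 <= c -> (\int[LV d]_x (\1_(cube c) x : R)%:E = ((2 * c) ^+ d)%:E)%E.
  move=> c0; transitivity (LV d (cube c `&` setT)); last by rewrite setIT LV_cube.
  by apply: integral_indic => //; exact: measurable_cube.
have i0 (c : R) (x : bV) : 0 <= \1_(cube c) x :> R by rewrite indicE.
have x2 k : 0 <= 2^-1 ^+ k :> R by rewrite exprn_ge0.
have x2' k : 0 <= 2 ^+ k :> R by rewrite exprn_ge0.
apply: (@integral_le_cover _ _ _ (LV d) _
  (fun k x => (a1 k)%:E * (\1_(cube (2 ^+ k.+1)) x)%:E + (a2 k)%:E * (\1_(cube (2^-1 ^+ k)) x)%:E)%E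
  (fun k => a1 k * (2 * 2 ^+ k.+1) ^+ d + a2 k * (2 * 2^-1 ^+ k) ^+ d)).
- by apply/measurable_EFinP; exact: measurable_funM.
- by move=> x; rewrite lee_fin mulr_ge0 //; have /andP[] := w01 x.
- by move=> k; apply: emeasurable_funD; exact: measurable_funeM.
- by move=> k x; rewrite -!EFinM -EFinD lee_fin addr_ge0 // mulr_ge0.
- move=> x; have /andP[w0 w1] := w01 x.
  suff [k hk] : exists k, g x * w x <= a1 k * \1_(cube (2 ^+ k.+1)) x + a2 k * \1_(cube (2^-1 ^+ k)) x.
    by exists k; rewrite -!EFinM -EFinD lee_fin.
  have [x1|x1] := leP 1 (enorm (x : 'rV[R]_d)).
    have [k /andP[k1 k2]] := dyadic_shell x1.
    exists k; rewrite [\1_(cube (2 ^+ k.+1)) x]indicE mem_set ?mulr1; last first.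
      by apply/cubeP => j; apply: (le_trans (coord_le_enorm _ _)).
    apply: (@le_trans _ _ (a1 k)); last by rewrite lerDl mulr_ge0.
    rewrite -[leRHS]mulr1; apply: ler_pM => //.
    by apply: decay_shell => //; rewrite exprn_gt0.
  (* The origin lies in no shell, but there w vanishes because th > 0. *)
  have [/eqP x0|x0] := boolP ((x : 'rV[R]_d) == 0).
    exists 0; apply: (@le_trans _ _ 0); last by rewrite addr_ge0 // mulr_ge0.
    have e0 : enorm (x : 'rV[R]_d) = 0 by apply/eqP; rewrite enorm_eq0 x0.
    have := wW x; rewrite e0 powR0 ?gt_eqF // mulr0 => w0'.
    by rewrite (_ : w x = 0) ?mulr0 //; apply/eqP; rewrite eq_le w0' w0.
  have ex0 : 0 < enorm (x : 'rV[R]_d) by rewrite lt_def enorm_eq0 x0 enorm_ge0.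
  have ix : 1 <= (enorm (x : 'rV[R]_d))^-1 by rewrite invf_ge1 // ltW.
  have [k /andP[k1 k2]] := dyadic_shell ix.
  have k1' : enorm (x : 'rV[R]_d) <= 2^-1 ^+ k.
    by rewrite -[leLHS]invrK exprVn lef_pV2 ?posrE ?exprn_gt0 // invr_gt0.
  have k2' : 2^-1 ^+ k.+1 <= enorm (x : 'rV[R]_d).
    by rewrite -[leRHS]invrK exprVn lef_pV2 ?posrE ?exprn_gt0 // invr_gt0.
  exists k; rewrite [\1_(cube (2^-1 ^+ k)) x]indicE mem_set ?mulr1; last first.
    by apply/cubeP => j; apply: (le_trans (coord_le_enorm _ _)).
  apply: (@le_trans _ _ (a2 k)); last by rewrite lerDr mulr_ge0.
  apply: ler_pM => //; first by apply: decay_shell => //; rewrite exprn_gt0.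
  apply: (le_trans (wW x)); rewrite ler_wpM2l //.
  by apply: ge0_ler_powR; rewrite ?nnegrE ?enorm_ge0 // ltW.
- move=> k.
  rewrite ge0_integralD //; last 4 first.
  + by move=> x _; rewrite -EFinM lee_fin mulr_ge0.
  + exact: measurable_funeM.
  + by move=> x _; rewrite -EFinM lee_fin mulr_ge0.
  + exact: measurable_funeM.
  rewrite !ge0_integralZl ?lee_fin //; try by move=> y _; rewrite lee_fin.
  by rewrite !iE.
- move=> K.
  have e k : a1 k * (2 * 2 ^+ k.+1) ^+ d + a2 k * (2 * 2^-1 ^+ k) ^+ d =
      L * 4 ^+ d * (2 `^ (- kap)) ^+ k + L * W * 2 ^+ d * 2 `^ p * (2 `^ (kap - th)) ^+ k.
    have h : (2^-1 : R) `^ (- p) = 2 `^ p by rewrite -[2^-1]powR_inv1 // -powRrM mulN1r opprK.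
    have h2 : (2^-1 : R) `^ th = 2 `^ (- th) by rewrite -[2^-1]powR_inv1 // -powRrM mulN1r.
    have h3 : 2 `^ (kap - th) = 2 `^ p * 2 `^ (- th) * 2^-1 ^+ d :> R.
      rewrite -[2^-1]powR_inv1 // -powR_mulrn ?powR_ge0 // -powRrM.
      have n2 : (2 : R) != 0 by rewrite pnatr_eq0.
      rewrite -powRD ?n2 ?implybT // -powRD ?n2 ?implybT //.
      by congr (_ `^ _); rewrite /p; ring.
    rewrite /a1 /a2 /= !(@powR_exprn R) ?invr_ge0 // h h2 h3 -pow2p.
    rewrite (_ : 4 = 2 * 2 :> R); last by ring.
    by rewrite !exprMn !exprS !exprMn -!exprM !(mulnC k d); ring.
  under eq_bigr => k _ do rewrite e.
  rewrite big_split /= -!mulr_sumr /weight_const mulrDr.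
  have ts0 : 0 < th - kap by rewrite subr_gt0.
  apply: lerD; rewrite !mulrA ler_wpM2l ?mulr_ge0 ?exprn_ge0 ?powR_ge0 //.
    exact: sum_geom0_le (powR2N kap_gt0).
  by have := powR2N ts0; rewrite opprB; exact: sum_geom0_le.
Qed.

Variable gam : 'rV[R]_d -> R.
Hypothesis gamE : forall z, (2 * pi) ^+ d * gam z = \int[LV d]_x (g x * cos (dotv (x : 'rV[R]_d) z)).

(** Summing the inversion formula over all differences k - l turns the phases into the kernel times
    cos (x.z). Since g and the kernel are nonnegative, |cos| <= 1 removes z and the bound is uniform
    in z. *)
Lemma sum_diff_le (s : seq 'rV[int]_d) (z : 'rV[R]_d) : uniq s ->
  \sum_(k <- s) \sum_(l <- s) gam (ivec (k - l) + z) <= (size s)%:R * (M + L * shell_const).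
Proof.
move=> us.
have pd : 0 < (2 * pi) ^+ d :> R by rewrite exprn_gt0 // mulr_gt0 // pi_gt0.
have i1 (k l : 'rV[int]_d) : (LV d).-integrable setT (EFin \o
    (fun x : bV => g x * cos (dotv (x : 'rV[R]_d) (ivec (k - l) + z)))).
  apply: integrable_mul_le1; [exact: measurable_cos_dot|by move=> x; exact: cos_max|].
  exact: integrable_spectral.
have i2 k := Rintegral_sum_seq s (i1 k).
have [i3 e3] := Rintegral_sum_seq s (fun k => (i2 k).1).
have e (x : bV) : \sum_(k <- s) \sum_(l <- s) (g x * cos (dotv (x : 'rV[R]_d) (ivec (k - l) + z))) =
    g x * trig_kernel s x * cos (dotv (x : 'rV[R]_d) z).
  rewrite -mulrA [trig_kernel _ _ * _]mulrC -trig_kernelE mulr_sumr; apply: eq_bigr => k _.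
  by rewrite mulr_sumr; apply: eq_bigr => l _; rewrite dotvDr.
rewrite -(ler_pM2l pd) mulrA.
have -> : (2 * pi) ^+ d * \sum_(k <- s) \sum_(l <- s) gam (ivec (k - l) + z) =
    \int[LV d]_x \sum_(k <- s) \sum_(l <- s) (g x * cos (dotv (x : 'rV[R]_d) (ivec (k - l) + z))).
  rewrite e3 mulr_sumr; apply: eq_bigr => k _; rewrite (i2 k).2 mulr_sumr.
  by apply: eq_bigr => l _; rewrite gamE.
rewrite -lee_fin -EFin_Rintegral //.
apply: le_trans (integral_trig_kernel_le us).
apply: (@le_trans _ _ (\int[LV d]_x `|(\sum_(k <- s) \sum_(l <- s) (g x * cos (dotv (x : 'rV[R]_d) (ivec (k - l) + z))))%:E|)%E).
  by apply: (le_trans (lee_abs _)); apply: le_abse_integral => //; exact: measurable_int i3.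
apply: ge0_le_integral => //.
- by apply: measurableT_comp => //; exact: measurable_int i3.
- by apply/measurable_EFinP; apply: measurable_funM => //; exact: measurable_trig_kernel.
- move=> x _; rewrite e lee_fin normrM ger0_norm ?mulr_ge0 ?trig_kernel_ge0 //.
  by rewrite ler_piMr ?mulr_ge0 ?trig_kernel_ge0 // cos_max.
Qed.

End spectral_bounds.

(** * Averaging over large boxes of Z^d *)

Section folner.
Context {R : realType} {d : nat}.

Definition int_box (m K : nat) : seq 'rV[int]_d :=
  [seq \row_j ((k 0%R j : nat) + m)%N%:Z | k : 'rV['I_K]_d].

Lemma size_int_box m K : size (int_box m K) = (K ^ d)%N.
Proof. by rewrite size_image card_mx card_ord mul1n. Qed.

Lemma int_boxP m K (k : 'rV[int]_d) :
  reflect (forall j, (m%:Z <= k 0 j < (K + m)%N%:Z)) (k \in int_box m K).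
Proof.
apply: (iffP mapP) => [[l _ ->] j|h].
  by rewrite mxE !lez_nat ltz_nat leq_addl ltn_add2r ltn_ord.
have b j : (`|k 0%R j|%N - m < K)%N.
  by have := h j; lia.
exists (\row_j Ordinal (b j)); first by rewrite mem_enum.
 apply/rowP => j; rewrite !mxE /=.
by have := h j; lia.
Qed.

Lemma uniq_int_box m K : uniq (int_box m K).
Proof.
rewrite map_inj_uniq ?enum_uniq // => k l /rowP e; apply/rowP => j; apply/val_inj.
by have := e j; rewrite !mxE => -[] /addIn.
Qed.

Lemma sum_subset_le (I : eqType) (G : I -> R) (t s : seq I) : uniq t -> uniq s ->
  {subset t <= s} -> (forall i, 0 <= G i) -> \sum_(i <- t) G i <= \sum_(i <- s) G i.
Proof.
move=> ut us ts G0; rewrite [leRHS](bigID (mem t)) /= -[leLHS]addr0.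
apply: lerD; last exact: sumr_ge0.
rewrite -[leRHS]big_filter (perm_big [seq i <- s | i \in t]) //=.
apply: uniq_perm => //; first exact: filter_uniq.
by move=> i; rewrite mem_filter; case: (boolP (i \in t)) => // /ts ->.
Qed.

(* Take for s a large box: for all l but those near its boundary, l + S lies
   in s. *)
Lemma sum_le_of_sum_diff_le (F : 'rV[int]_d -> R) (B : R) : (forall m, 0 <= F m) ->
  (forall s, uniq s -> \sum_(k <- s) \sum_(l <- s) F (k - l) <= (size s)%:R * B) ->
  forall S, uniq S -> \sum_(m <- S) F m <= B.
Proof.
move=> F0 FB S uS.
pose Mo := (\sum_(m <- S) \sum_(j < d) `|(m : 'rV[int]_d) 0%R j|)%N.
have SM m j : m \in S -> (`|(m : 'rV[int]_d) 0%R j| <= Mo)%N.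
  move=> mS; rewrite /Mo (big_rem m) //= (bigD1 j) //=; lia.
have B0 : 0 <= B by have := FB [:: 0] isT; rewrite !big_seq1 mul1r; exact: le_trans.
(* All coordinates of points of S are at most Mo in absolute value. With s a box of side N + 2 Mo
   and t the concentric box of side N, l in t and m in S imply l + m in s; keeping only these pairs
   costs nothing because F >= 0. The ratio of the two sizes tends to 1. *)
have key N : (N ^ d)%:R * \sum_(m <- S) F m <= ((N + 2 * Mo) ^ d)%:R * B.
  have := FB _ (uniq_int_box 0 (N + 2 * Mo)); rewrite size_int_box; apply: le_trans.
  set s := int_box 0 _; set t := int_box Mo N.
  have ts : {subset t <= s}.
    by move=> k /int_boxP h; apply/int_boxP => j; have := h j; lia.
  rewrite exchange_big /=.
  apply: (@le_trans _ _ (\sum_(l <- t) \sum_(k <- s) F (k - l))); last first.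
    by apply: sum_subset_le; rewrite ?uniq_int_box // => l; apply: sumr_ge0.
  have -> : (N ^ d)%:R * \sum_(m <- S) F m = \sum_(l <- t) \sum_(m <- S) F m.
    by rewrite big_const_seq count_predT iter_addr addr0 size_int_box [LHS]mulr_natl.
  rewrite big_seq [leRHS]big_seq; apply: ler_sum => l lt.
  have -> : \sum_(m <- S) F m = \sum_(k <- [seq m + l | m <- S]) F (k - l).
    by rewrite big_map; apply: eq_bigr => m _; rewrite addrK.
  apply: sum_subset_le; rewrite ?uniq_int_box //.
    by rewrite map_inj_uniq // => x y /addIr.
  move=> _ /mapP[m mS ->]; apply/int_boxP => j; move/int_boxP : lt => /(_ j).
  by have := SM m j mS; rewrite mxE; move: (m 0%R j) (l 0%R j) => x y; lia.
have kn N : \sum_(m <- S) F m <= (1 + (2 * Mo)%:R * N.+1%:R^-1) ^+ d * B.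
  have pN : 0 < (N.+1 ^ d)%:R :> R by rewrite ltr0n expn_gt0.
  rewrite -(ler_pM2l pN); apply: (le_trans (key N.+1)); rewrite mulrA ler_wpM2r //.
  rewrite !natrX -exprMn mulrDr mulr1 mulrCA mulfV ?pnatr_eq0 // mulr1 natrD.
  exact: lexx.
have lim : (fun N : nat => (1 + (2 * Mo)%:R * N.+1%:R^-1) ^+ d * B) @ \oo --> B.
  have h : (fun N : nat => 1 + (2 * Mo)%:R * N.+1%:R^-1 : R) @ \oo --> (1 + (2 * Mo)%:R * 0 : R).
    by apply: cvgD; [exact: cvg_cst|apply: cvgM; [exact: cvg_cst|exact: cvg_harmonic]].
  rewrite mulr0 addr0 in h; have h2 := cvg_comp _ _ h (@exprn_continuous R d 1).
  have h3 : (fun N : nat => (1 + (2 * Mo)%:R * N.+1%:R^-1) ^+ d * B) @ \oo --> (1 ^+ d * B : R).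
    by apply: cvgM; [exact: h2|exact: cvg_cst].
  by rewrite expr1n mul1r in h3.
by apply: (cvgr_to_ge lim); apply: nearW.
Qed.

End folner.

Section ellipsoid_spectrum.
Context {R : realType} (n : nat).
Local Notation d := n.+1.
Local Notation bV := (borelV R d).
Variables (A : 'M[R]_d) (kap : R).
Hypotheses (uA : A \in unitmx) (kap_gt0 : 0 < kap) (kap_le1 : kap <= 1).
Local Notation E := (ellipsoid A).
Local Notation g r := (fun xi : bV => fourier (E r) xi ^+ 2).

Lemma measurable_spectrum r : 0 < r -> measurable_fun setT (g r).
Proof.
move=> r0; apply: measurable_funX; apply: measurable_fourier.
exact: measurable_ellipsoid.
Qed.

Lemma spectrum_le r xi : 0 < r -> g r xi <= fine (LV d (E r)) ^+ 2.
Proof.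
move=> r0; rewrite -[leLHS]real_normK ?num_real // lerXn2r ?nnegrE ?fine_ge0 ?measure_ge0 //.
by apply: fourier_le; [exact: measurable_ellipsoid|apply: LV_ellipsoid_lty => //; exact: ltW].
Qed.

Lemma ellipsoid_spectrum_bounds : exists2 K : R, 0 < K & forall r, 0 < r ->
  [/\ 0 <= K * r `^ (d%:R - kap),
      forall x : 'rV[R]_d, x != 0 -> g r x <= K * r `^ (d%:R - kap) * enorm x `^ (- (d%:R + kap)) &
      (LV d).-integrable setT (EFin \o g r)].
Proof.
have [|K K0 KE] := @fourier_ellipsoid_decay R n A uA kap; first by rewrite ltW.
exists K => // r r0.
have K1 : 0 <= K * r `^ (d%:R - kap) by rewrite mulr_ge0 ?powR_ge0 // ltW.
have K2 (x : 'rV[R]_d) : x != 0 -> g r x <= K * r `^ (d%:R - kap) * enorm x `^ (- (d%:R + kap)).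
  exact: KE.
split => //; apply: (integrable_spectral (measurable_spectrum r0) _ _ K1 kap_gt0 K2).
- by move=> x; exact: sqr_ge0.
- by move=> x; exact: spectrum_le.
Qed.

Lemma ellipsoid_inversion r z : 0 < r ->
  (2 * pi) ^+ d * covariogram (E r) z = \int[LV d]_xi (g r xi * cos (dotv (xi : 'rV[R]_d) z)).
Proof.
move=> r0; have [K _ /(_ r r0)[_ _ ig]] := ellipsoid_spectrum_bounds.
apply: fourier_inversion => //.
- exact: measurable_ellipsoid.
- by apply: LV_ellipsoid_lty => //; exact: ltW.
- by move=> x; exact: ellipsoidN.
- by move=> z' u; exact: covariogram_ellipsoid_cvg.
Qed.

(** The volume of the ellipsoid will be the mean number of points, so the leading term is the one
    subtracted in the variance; it therefore carries no constant. *)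
Lemma ellipsoid_poisson : exists2 C : R, 0 <= C & forall r z S, 0 < r -> uniq S ->
  \sum_(m <- S) covariogram (E r) (ivec m + z) <= fine (LV d (E r)) ^+ 2 + C * r `^ (d%:R - kap).
Proof.
have [K K0 KE] := ellipsoid_spectrum_bounds.
exists (K * @shell_const R d kap).
  rewrite mulr_ge0 ?(ltW K0) // /shell_const mulr_ge0 ?exprn_ge0 // invr_ge0 subr_ge0.
  by rewrite powRN invf_le1 ?powR_gt0 // -[leLHS](_ : 1 `^ kap = 1); [apply: ge0_ler_powR; rewrite ?nnegrE ?ler1n // ltW|rewrite powR1].
move=> r z S r0 uS; have [K1 K2 _] := KE r r0.
rewrite mulrAC.
apply: (sum_le_of_sum_diff_le (F := fun m => covariogram (E r) (ivec m + z))) => //.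
  by move=> m; exact: covariogram_ge0.
move=> s us.
apply: (sum_diff_le (measurable_spectrum r0) _ _ K1 kap_gt0 K2 _ z us).
- by move=> x; exact: sqr_ge0.
- by move=> x; exact: spectrum_le.
- by move=> z'; exact: ellipsoid_inversion.
Qed.

Lemma ellipsoid_weight (W th : R) : kap < th -> 0 <= W -> exists2 C : R, 0 <= C &
  forall r (w : bV -> R), 0 < r -> measurable_fun setT w -> (forall x, 0 <= w x <= 1) ->
  (forall x : 'rV[R]_d, w x <= W * enorm x `^ th) ->
  (\int[LV d]_x (g r x * w x)%:E <= (C * r `^ (d%:R - kap))%:E)%E.
Proof.
move=> kt W0; have [K K0 KE] := ellipsoid_spectrum_bounds.
exists (K * `|@weight_const R d kap W th|); first by rewrite mulr_ge0 // ltW.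
move=> r w r0 mw w01 wW; have [K1 K2 _] := KE r r0.
have g0 x : 0 <= g r x by exact: sqr_ge0.
have h := integral_weight_le (measurable_spectrum r0) g0 K1 kap_gt0 K2 kt W0 mw w01 wW.
refine (le_trans h _).
by rewrite lee_fin mulrAC ler_wpM2r ?powR_ge0 // ler_wpM2l ?(ltW K0) // ler_norm.
Qed.

End ellipsoid_spectrum.

(** * Second moment of the number of points *)

Section countable_sums.
Context {I : countType} {R : realType}.
Local Open Scope ereal_scope.

(* Integers that are not codes of elements of I contribute 0. *)
Definition enum_fun (f : I -> \bar R) (n : nat) : \bar R :=
  if @pickle_inv I n is Some k then f k else 0.

Lemma enum_fun_ge0 f n : (forall k, 0 <= f k) -> 0 <= enum_fun f n.
Proof. by move=> f0; rewrite /enum_fun; case: pickle_inv. Qed.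

(** Turns sums over a countable type into series, to which monotone convergence applies. *)
Lemma esum_enum f : (forall k, 0 <= f k) ->
  \esum_(k in [set: I]) f k = \sum_(0 <= n <oo) enum_fun f n.
Proof.
move=> f0; have F0 n : 0 <= enum_fun f n by exact: enum_fun_ge0.
rewrite nneseries_esumT // (esumID (range (@pickle I))) //.
rewrite [X in _ + X]esum1 ?adde0; last first.
  move=> n [_ nr]; rewrite /enum_fun; case e : pickle_inv => [k|//].
  by exfalso; apply: nr; exists k => //; have := @pickle_invK I n; rewrite e /=.
rewrite setTI (@reindex_esum _ _ _ [set: I] _ (@pickle I)).
  by apply: eq_esum => k _; rewrite /enum_fun pickleK_inv.
by split; [move=> k _; exists k|move=> k l _ _ /(pcan_inj pickleK_inv)|move=> _ [k _ <-]; exists k].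
Qed.

Lemma esum_le_finite (f : I -> \bar R) (B : \bar R) :
  (forall S : seq I, uniq S -> \sum_(k <- S) f k <= B) -> \esum_(k in [set: I]) f k <= B.
Proof.
move=> fB; apply: ge_ereal_sup => _ [F [finF _] <-].
by rewrite fsbig_finite //; apply: fB; exact: finmap.fset_uniq.
Qed.

Lemma sum_le_esum (f : I -> \bar R) (S : seq I) : uniq S ->
  \sum_(k <- S) f k <= \esum_(k in [set: I]) f k.
Proof.
move=> uS; apply: esum_ge; exists [set` S]; first by split => //; exact: finite_seq.
by rewrite fsbig_seq.
Qed.

(** The factor may be +oo, as it will be the number of points, which is not known to be finite at
    every outcome. *)
Lemma esumZ_ge0 (c : \bar R) (f : I -> \bar R) : 0 <= c -> (forall k, 0 <= f k) ->
  \esum_(k in [set: I]) (c * f k) = c * \esum_(k in [set: I]) f k.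
Proof.
move=> c0 f0; case: c c0 => [c c0|_|//].
  rewrite !esum_enum //; last by move=> k; rewrite mule_ge0.
  rewrite -nneseriesZl; last by move=> n _; exact: enum_fun_ge0.
  by apply: eq_eseriesr => n _; rewrite /enum_fun; case: pickle_inv => //; rewrite mule0.
have [h|] := pselect (forall k, f k = 0).
  by rewrite !esum1 ?mule0 // => k _; rewrite h mule0.
move=> /existsNP[k /eqP fk]; have fk0 : 0 < f k by rewrite lt_def fk f0.
have h (g : I -> \bar R) : g k <= \esum_(k in [set: I]) g k.
  by have := sum_le_esum g (S := [:: k]) isT; rewrite big_seq1.
rewrite [RHS]gt0_mulye; last exact: lt_le_trans fk0 (h f).
by apply/eqP; rewrite -leye_eq; apply: le_trans (h (fun k => +oo * f k)); rewrite gt0_mulye.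
Qed.

End countable_sums.

Lemma esum_exchange {I J : countType} {R : realType} (f : I -> J -> \bar R) : (forall i j, 0 <= f i j)%E ->
  (\esum_(i in [set: I]) \esum_(j in [set: J]) f i j = \esum_(j in [set: J]) \esum_(i in [set: I]) f i j)%E.
Proof.
move=> f0; rewrite !esum_esum //.
rewrite (@reindex_esum _ _ _ ([set: J] `*`` (fun=> [set: I])) _ (fun z => (z.2, z.1))) //.
split => //; last by move=> [i j] _; exists (j, i).
by move=> [a b] [a' b'] _ _ [-> ->].
Qed.

Section countable_sum_integral.
Context {I : countType} {disp} {T : measurableType disp} {R : realType} (mu : {measure set T -> \bar R}).
Variable f : I -> T -> \bar R.
Hypotheses (mf : forall k, measurable_fun setT (f k)) (f0 : forall k x, (0 <= f k x)%E).

Lemma measurable_enum_fun n : measurable_fun setT (fun x => enum_fun (f ^~ x) n).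
Proof. by rewrite /enum_fun; case: pickle_inv => [k|]; [exact: mf|exact: measurable_cst]. Qed.

Lemma measurable_esum : measurable_fun setT (fun x => \esum_(k in [set: I]) f k x)%E.
Proof.
under eq_fun do rewrite esum_enum //.
apply: ge0_emeasurable_sum; first by move=> n x _ _; exact: enum_fun_ge0.
by move=> n _; exact: measurable_enum_fun.
Qed.

Lemma integral_esum :
  (\int[mu]_x (\esum_(k in [set: I]) f k x) = \esum_(k in [set: I]) \int[mu]_x f k x)%E.
Proof.
rewrite esum_enum; last by move=> k; exact: integral_ge0.
transitivity (\int[mu]_x \sum_(0 <= n <oo) enum_fun (f ^~ x) n)%E.
  by apply: eq_integral => x _; rewrite esum_enum.
rewrite integral_nneseries //; last 2 first.
- by move=> n; exact: measurable_enum_fun.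
- by move=> n x _; exact: enum_fun_ge0.
apply: eq_eseriesr => n _; rewrite /enum_fun; case: pickle_inv => [//|].
exact: integral0.
Qed.

End countable_sum_integral.

Section tiling.
Context {R : realType} {d : nat}.
Local Notation bV := (borelV R d).

Definition unit_cube : set bV := box `[0%R, 1%R[%classic.

Lemma unit_cubeP (x : 'rV[R]_d) : unit_cube x <-> forall j, 0 <= x 0 j < 1.
Proof. by split => h j; have := h j; rewrite /= in_itv. Qed.

Lemma measurable_unit_cube : measurable unit_cube.
Proof. exact: measurable_box. Qed.

(** Exactly one k, the coordinatewise floor of x, puts x - k in the half-open unit cube. *)
Lemma esum_unit_cube (c : \bar R) (x : 'rV[R]_d) : (0 <= c)%E ->
  (\esum_(k in [set: 'rV[int]_d]) ((\1_unit_cube (x - ivec k : bV)%R)%:E * c) = c)%E.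
Proof.
move=> c0; pose k0 : 'rV[int]_d := \row_j Num.floor (x 0 j).
have uk (k : 'rV[int]_d) : unit_cube (x - ivec k) <-> k = k0.
  rewrite unit_cubeP; split => [h|-> j].
    apply/rowP => j; have := h j; rewrite !mxE => /andP[h1 h2].
    by apply/esym/floor_def; rewrite -subr_ge0 h1 /= intrD addrC -ltrBlDr.
  have /andP[h1 h2] := floor_itv (x 0 j).
  by rewrite !mxE subr_ge0 h1 /= ltrBlDl; move: h2; rewrite intrD.
have f0 (k : 'rV[int]_d) : (0 <= (\1_unit_cube (x - ivec k : bV)%R)%:E * c)%E.
  by rewrite mule_ge0 // lee_fin indicE.
rewrite (esumID [set k0]) // setTI esum_set1 // esum1 ?adde0.
  by rewrite indicE mem_set ?mul1e //; exact/uk.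
by move=> k [_ kk]; rewrite indicE memNset ?mul0e // => /uk.
Qed.

Lemma integral_tiling (f : bV -> \bar R) : measurable_fun setT f -> (forall x, 0 <= f x)%E ->
  ((\esum_(k in [set: 'rV[int]_d]) (\int[LV d]_x ((\1_unit_cube x)%:E * f ((x : 'rV[R]_d) + ivec k)%R))) =
    \int[LV d]_x f x)%E.
Proof.
move=> mf f0.
have mtr (y : 'rV[R]_d) : measurable_fun setT (fun x : bV => ((x : 'rV[R]_d) + y : bV)).
  by apply: measurable_borelVD; [exact: measurable_id|exact: measurable_cst].
have mu1 : measurable_fun setT (fun x : bV => (\1_unit_cube x : R)%:E).
  by apply/measurable_EFinP; apply: measurable_indic; exact: measurable_unit_cube.
have u0 (x : bV) : (0 <= (\1_unit_cube x : R)%:E)%E by rewrite lee_fin indicE.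
transitivity (\int[LV d]_x (\esum_(k in [set: 'rV[int]_d])
    ((\1_unit_cube ((x : 'rV[R]_d) - ivec k : bV)%R)%:E * f x)))%E; last first.
  by apply: eq_integral => x _; rewrite esum_unit_cube.
have h0 (k : 'rV[int]_d) (x : bV) : (0 <= (\1_unit_cube ((x : 'rV[R]_d) - ivec k : bV)%R)%:E * f x)%E.
  by rewrite mule_ge0.
have mh (k : 'rV[int]_d) : measurable_fun setT (fun x : bV => (\1_unit_cube ((x : 'rV[R]_d) - ivec k : bV)%R)%:E * f x)%E.
  by apply: emeasurable_funM => //; exact: (measurableT_comp mu1 (mtr (- ivec k))).
apply: esym; apply: (etrans (integral_esum (LV d) mh h0)); apply: eq_esum => k _.
rewrite -(ge0_integral_LVD (ivec k) (mh k) (h0 k)).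
by apply: eq_integral => x _; rewrite addrK.
Qed.

End tiling.

Section independence.
Context {disp} {T : measurableType disp} {R : realType} (P : probability T R).

Definition pack_mfun {d1} {T1 : measurableType d1} (Y : T -> T1) (mY : measurable_fun setT Y) : {mfun T >-> T1} :=
  mfun_Sub (mem_set mY).

Lemma ge0_integral_same_law {d1} {T1 : measurableType d1} (Y Z : T -> T1) (f : T1 -> \bar R) :
  measurable_fun setT Y -> measurable_fun setT Z ->
  (forall B, measurable B -> P (Y @^-1` B) = P (Z @^-1` B)) ->
  measurable_fun setT f -> (forall x, 0 <= f x)%E ->
  (\int[P]_w f (Y w) = \int[P]_w f (Z w))%E.
Proof.
move=> mY mZ YZ mf f0.
have <- := ge0_integral_distribution (P := P) (pack_mfun mY) mf f0.
have <- := ge0_integral_distribution (P := P) (pack_mfun mZ) mf f0.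
by apply: eq_measure_integral => B mB _; exact: YZ.
Qed.

Lemma ge0_integral_law {d1} {T1 : measurableType d1} (Y : T -> T1) (m : {measure set T1 -> \bar R})
  (D : set T1) (f : T1 -> \bar R) :
  measurable_fun setT Y -> measurable D ->
  (forall B, measurable B -> P (Y @^-1` B) = m (B `&` D)) ->
  measurable_fun setT f -> (forall x, 0 <= f x)%E ->
  (\int[P]_w f (Y w) = \int[m]_x ((\1_D x)%:E * f x))%E.
Proof.
move=> mY mD YD mf f0.
have <- := ge0_integral_distribution (P := P) (pack_mfun mY) mf f0.
have mDc : measurable (~` D) by exact: measurableC.
rewrite (@ge0_negligible_integral _ _ _ (distribution P (pack_mfun mY)) setT (~` D)) //; last first.
  by transitivity (m (~` D `&` D)); [exact: YD|rewrite setICl measure0].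
rewrite setTD setCK.
transitivity (\int[m]_(x in D) f x)%E.
  apply: eq_measure_integral => B mB BD; have e : P (Y @^-1` B) = m B by rewrite YD // (setIidl BD).
  first [exact: e|exact/esym/e].
rewrite integral_mkcond; apply: eq_integral => x _; rewrite patchE indicE.
by case: (x \in D); rewrite ?mul1e ?mul0e.
Qed.

(** The joint law agrees with the product of the marginals on rectangles, hence everywhere; Tonelli
    then integrates out Y for fixed Z. *)
Lemma independent_integral {d1 d2} {T1 : measurableType d1} {T2 : measurableType d2}
  (Y : T -> T1) (Z : T -> T2) (D : set (T1 * T2)) :
  measurable_fun setT Y -> measurable_fun setT Z ->
  (forall A B, measurable A -> measurable B ->
    P (Y @^-1` A `&` Z @^-1` B) = (P (Y @^-1` A) * P (Z @^-1` B))%E) ->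
  measurable D ->
  (P [set w | D (Y w, Z w)] = \int[P]_w P [set w' | D (Y w', Z w)])%E.
Proof.
move=> mY mZ YZ mD.
have mYZ : measurable_fun setT (fun w => (Y w, Z w)) by exact: measurable_fun_pair.
have e := @product_measure_unique _ _ _ _ _ (distribution P (pack_mfun mY)) (distribution P (pack_mfun mZ))
  (distribution P (pack_mfun mYZ)) YZ D mD.
have e2 := @product_measure_unique _ _ _ _ _ (distribution P (pack_mfun mY)) (distribution P (pack_mfun mZ))
  (distribution P (pack_mfun mY) \x^ distribution P (pack_mfun mZ))%E _ D mD.
transitivity ((distribution P (pack_mfun mY) \x distribution P (pack_mfun mZ)) D)%E; first exact/esym/e.
rewrite e2; last by move=> A B mA mB; exact: product_measure2E.
rewrite /product_measure2 /=.
transitivity (\int[distribution P (pack_mfun mZ)]_x (distribution P (pack_mfun mY) \o ysection D) x)%E => //.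
rewrite (ge0_integral_distribution (P := P) (pack_mfun mZ)) //.
  by apply: eq_integral => w _ /=; congr (P _); apply/seteqP; split => w' /=; rewrite /ysection /= inE.
exact: measurable_fun_ysection.
Qed.

End independence.

Section counting_moments.
Context {disp} {T : measurableType disp} {R : realType} (P : probability T R) {d : nat}.
Local Notation bV := (borelV R d).
Local Notation rV := 'rV[R]_d.
Local Notation iV := 'rV[int]_d.
Variables (X : iV -> T -> rV) (V : T -> rV).
Hypotheses (mX : forall k, measurable_fun setT (X k : T -> bV)) (mV : measurable_fun setT (V : T -> bV)).
Hypothesis X_stat : forall (k m : iV) (B : set (bV * bV)), measurable B ->
  P [set w | B (X k w, X (k + m) w)] = P [set w | B (X 0 w, X m w)].
Hypothesis XV_indep : forall (k l : iV) (B : set (bV * bV)) (C : set bV), measurable B -> measurable C ->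
  P ([set w | B (X k w, X l w)] `&` V @^-1` C) = (P [set w | B (X k w, X l w)] * P (V @^-1` C))%E.
Hypothesis V_unif : forall C : set bV, measurable C -> P (V @^-1` C) = LV d (C `&` unit_cube).
Variable E : set bV.
Hypotheses (mE : measurable E) (fE : (LV d E < +oo)%E).

Let e (x : rV) : R := \1_E (x : bV).

Let e_ge0 x : 0 <= e x. Proof. by rewrite /e indicE. Qed.

Let e_le1 x : e x <= 1. Proof. by rewrite /e indicE; case: (_ \in _). Qed.

Let me {d'} {S : measurableType d'} (f : S -> rV) : measurable_fun setT (f : S -> bV) ->
  measurable_fun setT (fun w => e (f w)).
Proof. by move=> mf; apply: (measurableT_comp _ mf); exact: measurable_indic. Qed.

Let mid : measurable_fun setT (fun x : bV => (x : rV) : bV). Proof. exact: measurable_id. Qed.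

Let mcst (c : rV) {d'} {S : measurableType d'} : measurable_fun setT (fun _ : S => c : bV).
Proof. exact: measurable_cst. Qed.

Let mpre {d'} {S : measurableType d'} (f : S -> rV) : measurable_fun setT (f : S -> bV) ->
  measurable [set z | E (f z)].
Proof. by move=> mf; rewrite -[X in measurable X]setTI; exact: mf. Qed.

Let prob_indic2 (f h : T -> rV) : measurable_fun setT (f : T -> bV) -> measurable_fun setT (h : T -> bV) ->
  P [set w | E (f w) /\ E (h w)] = (\int[P]_w (e (f w) * e (h w))%:E)%E.
Proof.
move=> mf mh; have m1 := mpre mf; have m2 := mpre mh.
have mI : measurable [set w | E (f w) /\ E (h w)] by exact: measurableI.
transitivity (\int[P]_w (\1_[set w | E (f w) /\ E (h w)] w)%:E)%E.
  by rewrite integral_indic // setIT.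
apply: eq_integral => w _; congr EFin; rewrite /e !indicE -natrM mulnb; congr (nat_of_bool _)%:R.
by apply/idP/andP; rewrite !inE.
Qed.

Let cstE (c : R) : (\int[P]_w c%:E = c%:E)%E.
Proof.
by rewrite integral_cst //; have := congr1 (fun z => c%:E * z)%E (probability_setT P); rewrite mule1; exact.
Qed.

Definition counting (w : T) : \bar R := \esum_(k in [set: iV]) (e (ivec k + X k w + V w))%:E.

(** The probability that the points of the sites 0 and m both fall in E when the random shift V is
    frozen at v. *)
Let phi (m : iV) (v : bV) : \bar R :=
  (\int[P]_w (e ((v : rV) + X 0 w) * e ((v : rV) + ivec m + X m w))%:E)%E.

Let mphi2 m : measurable_fun setT (fun z : bV * T => (e ((z.1 : rV) + X 0 z.2) * e ((z.1 : rV) + ivec m + X m z.2))%:E).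
Proof.
apply/measurable_EFinP; apply: measurable_funM; apply: me.
  by apply: measurable_borelVD; [exact: measurable_fst|exact: (measurableT_comp (mX 0) measurable_snd)].
apply: measurable_borelVD; last exact: (measurableT_comp (mX m) measurable_snd).
by apply: measurable_borelVD; [exact: measurable_fst|exact: mcst].
Qed.

Let mphi m : measurable_fun setT (phi m).
Proof.
apply: (@measurable_fun_fubini_tonelli_F _ _ bV T R P _ (mphi2 m)).
by move=> z; rewrite lee_fin mulr_ge0.
Qed.

Let phi0 m v : (0 <= phi m v)%E.
Proof. by apply: integral_ge0 => w _; rewrite lee_fin mulr_ge0. Qed.

(** Independence integrates out V over the unit cube, and stationarity moves the pair of sites (k, k
    + m) to (0, m). The site k survives only as a translation of v, so that summing over k tiles the
    whole space. *)
Let pair_integral (k m : iV) :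
  (\int[P]_w (e (ivec k + X k w + V w) * e (ivec (k + m) + X (k + m) w + V w))%:E =
   \int[LV d]_v ((\1_unit_cube v)%:E * phi m ((v : rV) + ivec k)%R))%E.
Proof.
pose D : set ((bV * bV) * bV) :=
  [set z | E (ivec k + (z.1.1 : rV) + (z.2 : rV)) /\ E (ivec (k + m) + (z.1.2 : rV) + (z.2 : rV))].
have m11 : measurable_fun setT (fun z : (bV * bV) * bV => z.1.1).
  exact: (measurableT_comp measurable_fst measurable_fst).
have m12 : measurable_fun setT (fun z : (bV * bV) * bV => z.1.2).
  exact: (measurableT_comp measurable_snd measurable_fst).
have mD : measurable D.
  apply: measurableI; apply: mpre; apply: measurable_borelVD; try exact: measurable_snd.
    by apply: measurable_borelVD; [exact: mcst|exact: m11].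
  by apply: measurable_borelVD; [exact: mcst|exact: m12].
have mXX : measurable_fun setT (fun w => (X k w, X (k + m) w) : bV * bV).
  exact: measurable_fun_pair.
have mkXV l : measurable_fun setT ((fun w => ivec l + X l w + V w) : T -> bV).
  by apply: measurable_borelVD => //; apply: measurable_borelVD; [exact: mcst|exact: mX].
rewrite -(prob_indic2 (mkXV k) (mkXV (k + m))).
transitivity (P [set w | D ((X k w, X (k + m) w), V w)]) => //.
rewrite (@independent_integral _ _ _ P _ _ (bV * bV)%type bV (fun w => (X k w, X (k + m) w)) V D mXX mV) //;
  last by move=> B C mB mC; exact: XV_indep.
rewrite -(@ge0_integral_law _ _ _ P _ bV V (LV d) unit_cube (fun v => phi m ((v : rV) + ivec k))) //.
- apply: eq_integral => w _.
  pose B : set (bV * bV) := [set y | E (ivec k + (y.1 : rV) + V w) /\ E (ivec (k + m) + (y.2 : rV) + V w)].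
  have mB : measurable B.
    apply: measurableI; apply: mpre; apply: measurable_borelVD; try exact: mcst.
      by apply: measurable_borelVD; [exact: mcst|exact: measurable_fst].
    by apply: measurable_borelVD; [exact: mcst|exact: measurable_snd].
  transitivity (P [set w' | B (X 0 w', X m w')]); first exact: (X_stat k m mB).
  rewrite /phi -prob_indic2.
  + have e1 w' : ivec k + X 0 w' + V w = V w + ivec k + X 0 w' by rewrite addrC addrA.
    have e2 w' : ivec k + ivec m + X m w' + V w = V w + ivec k + ivec m + X m w' by rewrite addrC !addrA.
    by congr (P _); apply/seteqP; split => w' /=; rewrite /B /= ivecD e1 e2.
  + by apply: measurable_borelVD; [exact: mcst|exact: mX].
  + by apply: measurable_borelVD; [exact: mcst|exact: mX].
- exact: measurable_unit_cube.
- apply: (measurableT_comp (mphi m)); apply: measurable_borelVD; [exact: mid|exact: mcst].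
Qed.

Let covE (x y : rV) : (\int[LV d]_v (e ((v : rV) + x) * e ((v : rV) + y))%:E = (covariogram E (y - x))%:E)%E.
Proof.
have mf : measurable_fun setT (fun v : bV => (e v * e ((v : rV) + (y - x)))%:E).
  apply/measurable_EFinP; apply: measurable_funM; apply: me; first exact: mid.
  by apply: measurable_borelVD; [exact: mid|exact: mcst].
transitivity (\int[LV d]_v (e v * e ((v : rV) + (y - x)))%:E)%E.
  rewrite -(ge0_integral_LVD x mf); last by move=> v; rewrite lee_fin mulr_ge0.
  apply: eq_integral => v _; congr (_ * _)%:E; congr e.
  by rewrite -addrA [x + _]addrC subrK.
rewrite EFin_Rintegral //; apply: integrable_mul_le1.
- by apply: me; apply: measurable_borelVD; [exact: mid|exact: mcst].
- by move=> v; rewrite ger0_norm.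
- exact: indic_integrable.
Qed.

Let integral_phi m : (\int[LV d]_v phi m v = \int[P]_w (covariogram E (ivec m + X m w - X 0 w))%:E)%E.
Proof.
rewrite /phi (@fubini_tonelli _ _ bV T R (LV d) P _ (mphi2 m)); last first.
  by move=> z; rewrite lee_fin mulr_ge0.
apply: eq_integral => w _ /=.
rewrite -covE; apply: eq_integral => v _; congr (_ * _)%:E; congr e.
by rewrite addrA.
Qed.

Let mcount k : measurable_fun setT (fun w => (e (ivec k + X k w + V w))%:E).
Proof.
apply/measurable_EFinP; apply: me.
by apply: measurable_borelVD => //; apply: measurable_borelVD; [exact: mcst|exact: mX].
Qed.

Lemma measurable_counting : measurable_fun setT counting.
Proof. by apply: measurable_esum => // k w; rewrite lee_fin. Qed.

Lemma counting_ge0 w : (0 <= counting w)%E.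
Proof. by apply: esum_ge0 => k _; rewrite lee_fin. Qed.

(** The pair formula at m = 0, an indicator being equal to its square. *)
Lemma integral_counting : (\int[P]_w counting w = LV d E)%E.
Proof.
rewrite /counting integral_esum //; last by move=> k w; rewrite lee_fin.
transitivity (\int[LV d]_v phi 0 v)%E.
  rewrite -(integral_tiling (mphi 0) (phi0 0)); apply: eq_esum => k _.
  rewrite -pair_integral addr0; apply: eq_integral => w _; congr EFin.
  by rewrite /e indicE; case: (_ \in _); rewrite ?mulr1 ?mulr0.
rewrite integral_phi.
transitivity (\int[P]_w (covariogram E 0)%:E)%E.
  by apply: eq_integral => w _; rewrite /ivec map_mx0 add0r subrr.
rewrite cstE.
rewrite -[0](subrr 0) -covE; transitivity (\int[LV d]_v (\1_E v)%:E)%E; last by rewrite integral_indic // setIT.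
by apply: eq_integral => v _; rewrite addr0 /e indicE; case: (_ \in _); rewrite ?mulr1 ?mulr0.
Qed.

(** Index pairs of sites by k and the difference m. For fixed m the sum over k tiles the space and
    gives the integral of [phi m], which by Tonelli is an expected covariogram. *)
Lemma integral_counting2 : (\int[P]_w (counting w * counting w) =
  \esum_(m in [set: iV]) \int[P]_w (covariogram E (ivec m + X m w - X 0 w))%:E)%E.
Proof.
pose f (k m : iV) (w : T) : \bar R := (e (ivec k + X k w + V w) * e (ivec (k + m) + X (k + m) w + V w))%:E.
have f0 k m w : (0 <= f k m w)%E by rewrite lee_fin mulr_ge0.
have mf k m : measurable_fun setT (f k m).
  by rewrite /f; under eq_fun do rewrite EFinM; apply: emeasurable_funM; exact: mcount.
transitivity (\int[P]_w (\esum_(k in [set: iV]) (\esum_(m in [set: iV]) f k m w)))%E.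
  apply: eq_integral => w _.
  have en k : (0 <= (e (ivec k + X k w + V w))%:E)%E by rewrite lee_fin.
  rewrite -[X in (X * _)%E]/(\esum_(k in [set: iV]) _)%E muleC -esumZ_ge0 ?counting_ge0 //.
  apply: eq_esum => k _; rewrite muleC {1}/counting -esumZ_ge0 //.
  have bk : set_bij [set: iV] [set: iV] (fun m : iV => k + m).
    by split; [|move=> x y _ _ /addrI|move=> y _; exists (y - k) => //=; rewrite addrC subrK].
  by apply: etrans (@reindex_esum R _ _ _ _ _ _ bk) _; apply: eq_esum.
pose F (k : iV) (w : T) : \bar R := \esum_(m in [set: iV]) f k m w.
have mF k : measurable_fun setT (F k) by exact: measurable_esum.
have F0 k w : (0 <= F k w)%E by exact: esum_ge0.
apply: (etrans (@integral_esum iV _ _ _ P F mF F0)).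
transitivity (\esum_(k in [set: iV]) (\esum_(m in [set: iV]) (\int[P]_w f k m w)))%E.
  by apply: eq_esum => k _; rewrite integral_esum.
rewrite esum_exchange; last by move=> k m; exact: integral_ge0.
apply: eq_esum => m _; rewrite -integral_phi -(integral_tiling (mphi m) (phi0 m)).
by apply: eq_esum => k _; rewrite -pair_integral.
Qed.

Lemma evariance_counting (B : R) : (\int[P]_w (counting w * counting w) <= B%:E)%E ->
  (evariance P counting <= B%:E - LV d E ^+ 2)%E.
Proof.
have Efin : LV d E \is a fin_num by rewrite ge0_fin_numE ?measure_ge0.
set mu := fine (LV d E); have muE : LV d E = mu%:E by rewrite fineK.
have mu0 : 0 <= mu by rewrite fine_ge0 ?measure_ge0.
move=> NB; rewrite /evariance integral_counting muE.
have mN := measurable_counting.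
(* The expansion of the square is written without negative terms on the right and with 2 mu N on the
   left, so that it also holds where the count is +oo. *)
have pt (w : T) : ((counting w - mu%:E) ^+ 2 + (2 * mu)%:E * counting w =
    counting w * counting w + (mu ^+ 2)%:E)%E.
  have := counting_ge0 w; case: (counting w) => [x x0| _|//].
    by rewrite -EFinB -EFin_expe -!EFinM -!EFinD; congr EFin; ring.
  have : (0 <= (2 * mu)%:E * +oo :> \bar R)%E by rewrite mule_ge0 // lee_fin mulr_ge0.
  move=> c0; have c1 : ((2 * mu)%:E * +oo)%E != -oo%E by rewrite gt_eqF // (lt_le_trans _ c0).
  have -> : ((+oo - mu%:E) ^+ 2 = +oo :> \bar R)%E by exact: mulyy.
  by rewrite mulyy !addye.
have m1 : measurable_fun setT (fun w => (counting w - mu%:E) ^+ 2)%E.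
  have h : measurable_fun setT (fun w => (counting w - mu%:E))%E.
    by apply: emeasurable_funB => //; exact: measurable_cst.
  exact: (emeasurable_funM h h).
have m2 : measurable_fun setT (fun w => (2 * mu)%:E * counting w)%E by exact: measurable_funeM.
have m3 : measurable_fun setT (fun w => counting w * counting w)%E by exact: emeasurable_funM.
have n1 w : (0 <= (counting w - mu%:E) ^+ 2)%E by exact: sqre_ge0.
have n2 w : (0 <= (2 * mu)%:E * counting w)%E by rewrite mule_ge0 ?counting_ge0 // lee_fin mulr_ge0.
have n3 w : (0 <= counting w * counting w)%E by rewrite mule_ge0 ?counting_ge0.
have i1 : (\int[P]_w ((counting w - mu%:E) ^+ 2) + (2 * mu)%:E * mu%:E =
    \int[P]_w (counting w * counting w) + (mu ^+ 2)%:E)%E.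
  rewrite -{2}muE -integral_counting -ge0_integralZl //; last 2 first.
  - by move=> w _; exact: counting_ge0.
  - by rewrite lee_fin mulr_ge0.
  rewrite -ge0_integralD //.
  transitivity (\int[P]_w (counting w * counting w + (mu ^+ 2)%:E))%E.
    by apply: eq_integral => w _; exact: pt.
  rewrite ge0_integralD //; last by move=> w _; rewrite lee_fin sqr_ge0.
  by rewrite cstE.
have -> : (B%:E - mu%:E ^+ 2 = (B + mu ^+ 2 - 2 * mu * mu)%:E)%E.
  by rewrite -EFin_expe -EFinB; congr EFin; ring.
rewrite EFinB leeBrDr // EFinM i1 EFinD.
exact: leeD.
Qed.

End counting_moments.

(** * Decoupling *)

Section decoupling.
Context {disp} {T : measurableType disp} {R : realType} (P : probability T R) {n : nat}.
Local Notation d := n.+1.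
Local Notation bV := (borelV R d).
Local Notation rV := 'rV[R]_d.
Local Notation Ex := (Ex P).
Variables (A : 'M[R]_d) (r : R).
Hypotheses (uA : A \in unitmx) (r_gt0 : 0 < r).
Local Notation E := (ellipsoid A r).
Local Notation g := (fun xi : bV => fourier E xi ^+ 2).

Let mE : measurable E. Proof. exact: measurable_ellipsoid. Qed.
Let fE : (LV d E < +oo)%E. Proof. by apply: LV_ellipsoid_lty => //; exact: ltW. Qed.

Let gi : (LV d).-integrable setT (EFin \o g).
Proof. by have [K _ /(_ r r_gt0)[]] := @ellipsoid_spectrum_bounds R n A 1 uA ltr01 (lexx 1). Qed.

Let mg : measurable_fun setT g. Proof. exact: measurable_spectrum. Qed.

Let pd : 0 < (2 * pi) ^+ d :> R. Proof. by rewrite exprn_gt0 // mulr_gt0 // pi_gt0. Qed.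

Let P1i : P.-integrable setT (EFin \o (fun _ : T => 1 : R)).
Proof. apply: bounded_mfun_integrable; exact: bounded_mfun_cst. Qed.

Lemma bounded_covariogram (Z : T -> rV) : measurable_fun setT (Z : T -> bV) ->
  bounded_mfun (fun w => covariogram E (Z w)).
Proof.
move=> mZ; split; first by apply: (measurableT_comp _ mZ); exact: measurable_covariogram.
by exists (fine (LV d E)) => w; exact: covariogram_le.
Qed.

Lemma Ex_covariogram (Z : T -> rV) : measurable_fun setT (Z : T -> bV) ->
  (2 * pi) ^+ d * Ex (fun w => covariogram E (Z w)) =
  \int[LV d]_xi (g xi * Ex (fun w => cos (dotv (xi : rV) (Z w)))).
Proof.
move=> mZ; rewrite -ExZ; last exact: bounded_covariogram.
transitivity (\int[P]_w (1 * \int[LV d]_xi (g xi * cos (dotv (xi : rV) (Z w))))).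
  by apply: eq_Rintegral => w _; rewrite mul1r (ellipsoid_inversion uA ltr01).
rewrite (@Rintegral_fubini_dom _ _ T bV R P (LV d) (fun=> 1) g (fun z => cos (dotv (z.2 : rV) (Z z.1)))) //.
- by apply: eq_Rintegral => xi _; congr (_ * _); apply: eq_Rintegral => w _; rewrite mul1r.
- apply: measurable_cosT; apply: measurable_dotv2; first exact: measurable_snd.
  exact: (measurableT_comp mZ measurable_fst).
- by move=> z; exact: cos_max.
Qed.

Variables (X0 Xm : T -> rV) (c : rV).
Hypotheses (mX0 : measurable_fun setT (X0 : T -> bV)) (mXm : measurable_fun setT (Xm : T -> bV)).

Definition coupled : R := Ex (fun w => covariogram E (c + Xm w - X0 w)).
(** The second variable w' is integrated separately, so Xm is replaced by a variable of the same law
    independent of X0. *)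
Definition decoupled : R := Ex (fun w => Ex (fun w' => covariogram E (c + Xm w' - X0 w))).

Let mcst (u : rV) {d'} {S : measurableType d'} : measurable_fun setT (fun _ : S => u : bV).
Proof. exact: measurable_cst. Qed.

Let bcos (f : T -> R) : measurable_fun setT f -> bounded_mfun (fun w => cos (f w)).
Proof. by move=> mf; split; [exact: measurable_cosT|exists 1 => w; exact: cos_max]. Qed.

Let bsin (f : T -> R) : measurable_fun setT f -> bounded_mfun (fun w => sin (f w)).
Proof. by move=> mf; split; [exact: measurable_sinT|exists 1 => w; exact: norm_sin_le1]. Qed.

(** Real part of the characteristic function of c + Xm - X0; [F2] plays the same part for the
    decoupled difference. *)
Let F1 (xi : bV) : R := Ex (fun w => cos (dotv (xi : rV) (c + Xm w - X0 w))).
Let h (z : T * bV) : R := Ex (fun w' => cos (dotv (z.2 : rV) (c + Xm w' - X0 z.1))).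
Let F2 (xi : bV) : R := Ex (fun w => h (w, xi)).

Let mZ : measurable_fun setT ((fun w => c + Xm w - X0 w) : T -> bV).
Proof.
by apply: measurable_borelVD; [apply: measurable_borelVD; [exact: mcst|]|exact: measurable_borelVN].
Qed.

Let mF1 : measurable_fun setT F1.
Proof.
apply: (@measurable_Rintegral_param _ _ bV T R P (fun z => cos (dotv (z.1 : rV) (c + Xm z.2 - X0 z.2)))).
apply: measurable_cosT; apply: measurable_dotv2; first exact: measurable_fst.
exact: (measurableT_comp mZ measurable_snd).
Qed.

Let mh : measurable_fun setT h.
Proof.
apply: (@measurable_Rintegral_param _ _ (T * bV)%type T R P
  (fun z => cos (dotv (z.1.2 : rV) (c + Xm z.2 - X0 z.1.1)))).
apply: measurable_cosT; apply: measurable_dotv2; first exact: (measurableT_comp measurable_snd measurable_fst).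
apply: measurable_borelVD.
  by apply: measurable_borelVD; [exact: mcst|exact: (measurableT_comp mXm measurable_snd)].
apply: measurable_borelVN; apply: (measurableT_comp mX0).
exact: (measurableT_comp measurable_fst measurable_fst).
Qed.

Let h1 z : `|h z| <= 1.
Proof.
apply: Ex_norm_le; last by move=> w; exact: cos_max.
apply: bcos; apply: measurable_dotv2; first exact: mcst.
by apply: measurable_borelVD; [apply: measurable_borelVD; [exact: mcst|]|exact: mcst].
Qed.

Let mF2 : measurable_fun setT F2.
Proof.
apply: (@measurable_Rintegral_param _ _ bV T R P (fun z => h (z.2, z.1))).
by apply: (measurableT_comp mh); exact: measurable_fun_pair.
Qed.

Let bh xi : bounded_mfun (fun w => h (w, xi)).
Proof.
split; last by exists 1 => w; exact: h1.
by apply: (measurableT_comp mh); apply: measurable_fun_pair => //; exact: measurable_cst.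
Qed.

Let F1_le xi : `|F1 xi| <= 1.
Proof.
apply: Ex_norm_le; last by move=> w; exact: cos_max.
by apply: bcos; apply: measurable_dotv2; [exact: mcst|exact: mZ].
Qed.

Let F2_le xi : `|F2 xi| <= 1. Proof. by apply: Ex_norm_le => // w; exact: h1. Qed.

Lemma decoupled_fourier : (2 * pi) ^+ d * decoupled = \int[LV d]_xi (g xi * F2 xi).
Proof.
have inner w : (2 * pi) ^+ d * Ex (fun w' => covariogram E (c + Xm w' - X0 w)) =
    \int[LV d]_xi (g xi * h (w, xi)).
  rewrite Ex_covariogram //.
  by apply: measurable_borelVD; [apply: measurable_borelVD; [exact: mcst|]|exact: mcst].
have bd : bounded_mfun (fun w => Ex (fun w' => covariogram E (c + Xm w' - X0 w))).
  split.
    apply: (@measurable_Rintegral_param _ _ T T R P (fun z => covariogram E (c + Xm z.2 - X0 z.1))).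
    apply: (measurableT_comp (measurable_covariogram mE)); apply: measurable_borelVD.
      by apply: measurable_borelVD; [exact: mcst|exact: (measurableT_comp mXm measurable_snd)].
    by apply: measurable_borelVN; exact: (measurableT_comp mX0 measurable_fst).
  exists (fine (LV d E)) => w; apply: Ex_norm_le; last by move=> w'; exact: covariogram_le.
  apply: bounded_covariogram.
  by apply: measurable_borelVD; [apply: measurable_borelVD; [exact: mcst|]|exact: mcst].
rewrite /decoupled -ExZ //.
transitivity (\int[P]_w (1 * \int[LV d]_xi (g xi * h (w, xi)))).
  by apply: eq_Rintegral => w _; rewrite mul1r inner.
rewrite (@Rintegral_fubini_dom _ _ T bV R P (LV d) (fun=> 1) g h) //.
by apply: eq_Rintegral => xi _; congr (_ * _); apply: eq_Rintegral => w _; rewrite mul1r.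
Qed.

Let F2E (xi : rV) : let U w := dotv xi (X0 w) in let V w := dotv xi (Xm w) in
  F2 xi = cos (dotv xi c) * (Ex (cos \o V) * Ex (cos \o U) + Ex (sin \o V) * Ex (sin \o U)) -
     sin (dotv xi c) * (Ex (sin \o V) * Ex (cos \o U) - Ex (cos \o V) * Ex (sin \o U)).
Proof.
move=> U V.
have mU : measurable_fun setT U by apply: measurable_dotv2; [exact: mcst|].
have mV : measurable_fun setT V by apply: measurable_dotv2; [exact: mcst|].
set k := dotv xi c.
have hE w : h (w, xi) = (cos k * Ex (cos \o V) - sin k * Ex (sin \o V)) * cos (U w) +
    (sin k * Ex (cos \o V) + cos k * Ex (sin \o V)) * sin (U w).
  transitivity (Ex (fun w' => cos (k - U w) * cos (V w') - sin (k - U w) * sin (V w'))).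
    apply: eq_Rintegral => w' _ /=.
    by rewrite -cosD dotvDr dotvDr dotvNr addrAC.
  rewrite ExB; last 2 first.
  - by apply: bounded_mfunZ; exact: bcos.
  - by apply: bounded_mfunZ; exact: bsin.
  rewrite !ExZ; [|exact: bsin|exact: bcos].
  by rewrite cosB sinB /comp; ring.
rewrite /F2; transitivity (Ex (fun w => (cos k * Ex (cos \o V) - sin k * Ex (sin \o V)) * cos (U w) +
    (sin k * Ex (cos \o V) + cos k * Ex (sin \o V)) * sin (U w))).
  by apply: eq_Rintegral => w _; rewrite hE.
rewrite ExD; last 2 first.
- by apply: bounded_mfunZ; exact: bcos.
- by apply: bounded_mfunZ; exact: bsin.
rewrite !ExZ; [|exact: bsin|exact: bcos].
by rewrite /comp; ring.
Qed.

Variables (al a1 a2 Q mm : R).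
Hypotheses (a1_gt0 : 0 < a1) (a2_gt0 : 0 < a2) (a12 : a1 + (a2 + a2) = 1).
Hypotheses (Q_gt0 : 0 < Q) (Qa2 : Q * a2 < 1) (mm_ge0 : 0 <= mm).
Hypothesis mix : forall B C : set bV, measurable B -> measurable C ->
  `|fine (P (X0 @^-1` B `&` Xm @^-1` C)) - fine (P (X0 @^-1` B)) * fine (P (Xm @^-1` C))| <= al.
Hypothesis tail0 : forall t, 0 < t -> fine (P [set w | t <= enorm (X0 w)]) <= (mm / t) `^ Q.
Hypothesis tailm : forall t, 0 < t -> fine (P [set w | t <= enorm (Xm w)]) <= (mm / t) `^ Q.

(** One factor from each of X0 and Xm, whence the square; it is at most (|xi| mm)^(2 Q a2). *)
Definition freq_weight (xi : bV) : R := Num.min 1 ((enorm (xi : rV) * mm) `^ (Q * a2)) ^+ 2.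

Let tail_dotv (Z : T -> rV) (xi : rV) : measurable_fun setT (Z : T -> bV) ->
  (forall t, 0 < t -> fine (P [set w | t <= enorm (Z w)]) <= (mm / t) `^ Q) ->
  tail_bound P (fun w => dotv xi (Z w)) Q (enorm xi * mm).
Proof.
move=> mZ' tZ t t0.
have mU : measurable_fun setT (fun w => `|dotv xi (Z w)|).
  by apply: measurableT_comp => //; apply: measurable_dotv2; [exact: mcst|].
have mS : measurable [set w | t <= `|dotv xi (Z w)|].
  rewrite (_ : mkset _ = (fun w => `|dotv xi (Z w)|) @^-1` `[t, +oo[).
    by rewrite -[X in measurable X]setTI; apply: mU.
  by apply/seteqP; split => w /=; rewrite in_itv /= andbT.
have [x0|x0] := eqVneq (enorm xi) 0.
  rewrite (_ : mkset _ = set0) ?measure0 ?powR_ge0 //.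
  apply/seteqP; split => // w /= ht.
  have := dotv_le_enorm xi (Z w); rewrite x0 mul0r => h0.
  by move: (lt_le_trans t0 (le_trans ht h0)); rewrite ltxx.
have x1 : 0 < enorm xi by rewrite lt_def x0 enorm_ge0.
have tx : 0 < t / enorm xi by rewrite divr_gt0.
have := tZ _ tx; rewrite invf_div mulrA [mm * _]mulrC; apply: le_trans.
have mS' : measurable [set w | t / enorm xi <= enorm (Z w)].
  rewrite (_ : mkset _ = (fun w => enorm (Z w)) @^-1` `[t / enorm xi, +oo[).
    by rewrite -[X in measurable X]setTI; apply: (measurableT_comp (@measurable_enorm R d) mZ').
  by apply/seteqP; split => w /=; rewrite in_itv /= andbT.
apply: fine_le; rewrite ?fin_num_measure //.
apply: le_measure; rewrite ?inE // => w /= ht.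
by rewrite ler_pdivrMr // mulrC; exact: le_trans ht (dotv_le_enorm _ _).
Qed.

Lemma characteristic_mixing (xi : rV) :
  `|F1 xi - F2 xi| <= 64 * geom_const (Q * a2) ^+ 2 * al `^ a1 * freq_weight xi.
Proof.
rewrite F2E /freq_weight.
have mU : measurable_fun setT (fun w => dotv xi (X0 w)) by apply: measurable_dotv2; [exact: mcst|].
have mV : measurable_fun setT (fun w => dotv xi (Xm w)) by apply: measurable_dotv2; [exact: mcst|].
have -> : F1 xi = Ex (fun w => cos (dotv xi c + (dotv xi (Xm w) - dotv xi (X0 w)))).
  by apply: eq_Rintegral => w _; rewrite !dotvDr dotvNr addrA.
apply: (mixing_cos (dotv xi c) mU mV a1_gt0 a2_gt0 a12 _ Q_gt0 Qa2).
- move=> B C mB mC.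
  have mxi : measurable_fun setT (fun x : bV => dotv xi (x : rV)) by exact: measurable_dotv.
  have mB' : measurable ((fun x : bV => dotv xi (x : rV)) @^-1` B) by rewrite -[X in measurable X]setTI; exact: mxi.
  have mC' : measurable ((fun x : bV => dotv xi (x : rV)) @^-1` C) by rewrite -[X in measurable X]setTI; exact: mxi.
  exact: (mix mB' mC').
- by rewrite mulr_ge0 // enorm_ge0.
- exact: tail_dotv.
- exact: tail_dotv.
Qed.

Lemma coupled_sub_decoupled (B : R) : 0 <= B ->
  (\int[LV d]_x (g x * freq_weight x)%:E <= B%:E)%E ->
  coupled <= decoupled + 64 * geom_const (Q * a2) ^+ 2 * al `^ a1 * B.
Proof.
move=> B0 hB; set K := 64 * _ * _.
have K0 : 0 <= K by apply: mulr_ge0; [apply: mulr_ge0; [|exact: sqr_ge0]|exact: powR_ge0].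
have g0 x : 0 <= g x by exact: sqr_ge0.
have w01 x : 0 <= freq_weight x <= 1.
  rewrite /freq_weight sqr_ge0 /= expr_le1 // ?ge_min ?lexx // le_min ler01 powR_ge0 //.
have mw : measurable_fun setT freq_weight.
  apply: measurable_funX; apply: measurable_minr; first exact: measurable_cst.
  apply: (measurableT_comp (measurable_powR _)); apply: measurable_funM; last exact: measurable_cst.
  exact: measurable_enorm.
have i1 : (LV d).-integrable setT (EFin \o (fun x => g x * F1 x)) by exact: integrable_mul_le1.
have i2 : (LV d).-integrable setT (EFin \o (fun x => g x * F2 x)) by exact: integrable_mul_le1.
have i3 : (LV d).-integrable setT (EFin \o (fun x => g x * freq_weight x)).
  by apply: integrable_mul_le1 => // x; have /andP[? ?] := w01 x; rewrite ger0_norm.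
have e1 : (2 * pi) ^+ d * coupled = \int[LV d]_x (g x * F1 x) by rewrite /coupled Ex_covariogram.
have hB' : \int[LV d]_x (g x * freq_weight x) <= B by rewrite -lee_fin -EFin_Rintegral.
have le1 : (2 * pi) ^+ d * (coupled - decoupled) <= K * B.
  rewrite mulrBr e1 decoupled_fourier -RintegralB //.
  apply: (@le_trans _ _ (\int[LV d]_x (K * (g x * freq_weight x)))); last first.
    by rewrite RintegralZl // ler_wpM2l.
  apply: le_Rintegral => //.
  - rewrite (_ : EFin \o _ = (EFin \o (fun x => g x * F1 x)%R) \- (EFin \o (fun x => g x * F2 x)%R))%E //.
    exact: integrableB.
  - exact: integrableZl_fun.
  - move=> x _; rewrite -mulrBr mulrCA ler_wpM2l //.
    exact: (le_trans (ler_norm _) (characteristic_mixing x)).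
(* Dropping the factor (2 pi)^d >= 1 from the left of [le1] is a weakening only when coupled -
   decoupled is positive; otherwise the claim follows from K B >= 0. *)
have p1 : 1 <= (2 * pi) ^+ d :> R.
  rewrite exprn_ege1 //; have := pi_ge2 R; lra.
have KB : 0 <= K * B by rewrite mulr_ge0.
rewrite -lerBlDl; have [neg|pos] := leP (coupled - decoupled) 0; first exact: le_trans neg KB.
by apply: le_trans le1; apply: ler_peMl => //; exact: ltW.
Qed.

End decoupling.

Section variance_bound.
Context {disp} {T : measurableType disp} {R : realType} (P : probability T R) {n : nat}.
Local Notation d := n.+1.
Local Notation bV := (borelV R d).
Local Notation rV := 'rV[R]_d.
Local Notation iV := 'rV[int]_d.
Local Notation Ex := (Ex P).
Variables (X : iV -> T -> rV) (V : T -> rV).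
Hypotheses (mX : forall k, measurable_fun setT (X k : T -> bV)) (mV : measurable_fun setT (V : T -> bV)).
Hypothesis X_stat : forall (k m : iV) (B : set (bV * bV)), measurable B ->
  P [set w | B (X k w, X (k + m) w)] = P [set w | B (X 0 w, X m w)].
Hypothesis XV_indep : forall (k l : iV) (B : set (bV * bV)) (C : set bV), measurable B -> measurable C ->
  P ([set w | B (X k w, X l w)] `&` V @^-1` C) = (P [set w | B (X k w, X l w)] * P (V @^-1` C))%E.
Hypothesis V_unif : forall C : set bV, measurable C -> P (V @^-1` C) = LV d (C `&` unit_cube).
Variables (A : 'M[R]_d) (kap : R) (al : iV -> R) (Sal a1 a2 Q mm : R).
Hypotheses (uA : A \in unitmx) (kap_gt0 : 0 < kap) (kap_le1 : kap <= 1).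
Hypotheses (a1_gt0 : 0 < a1) (a2_gt0 : 0 < a2) (a12 : a1 + (a2 + a2) = 1).
Hypotheses (Q_gt0 : 0 < Q) (Qa2 : Q * a2 < 1) (mm_ge0 : 0 <= mm) (kapQ : kap < Q * a2 * 2).
Hypothesis mix : forall (m : iV) (B C : set bV), measurable B -> measurable C ->
  `|fine (P (X 0 @^-1` B `&` X m @^-1` C)) - fine (P (X 0 @^-1` B)) * fine (P (X m @^-1` C))| <= al m.
Hypothesis al_sum : forall S : seq iV, uniq S -> \sum_(m <- S) al m `^ a1 <= Sal.
Hypothesis tail : forall t, 0 < t -> fine (P [set w | t <= enorm (X 0 w)]) <= (mm / t) `^ Q.

Let marginal m (B : set bV) : measurable B -> P (X m @^-1` B) = P (X 0 @^-1` B).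
Proof.
move=> mB; have mB2 : measurable (fst @^-1` B : set (bV * bV)).
  by rewrite -[X in measurable X]setTI; exact: measurable_fst.
exact: (X_stat m 0 mB2).
Qed.

Let tailm m t : 0 < t -> fine (P [set w | t <= enorm (X m w)]) <= (mm / t) `^ Q.
Proof.
move=> t0; apply: le_trans (tail t0).
have mB : measurable [set x : bV | t <= enorm (x : rV)].
  rewrite (_ : mkset _ = (fun x : bV => enorm (x : rV)) @^-1` `[t, +oo[).
    by rewrite -[X in measurable X]setTI; apply: (@measurable_enorm R d).
  by apply/seteqP; split => w /=; rewrite in_itv /= andbT.
by have := marginal m mB; rewrite /preimage /= => ->.
Qed.

Let mcst (u : rV) {d'} {S : measurableType d'} : measurable_fun setT (fun _ : S => u : bV).
Proof. exact: measurable_cst. Qed.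

(** By stationarity the copy of X m may be taken to be a copy of X 0, the same for all m. The sum
    over m can then be moved inside both expectations and bounded for each fixed value z of the
    difference of the two copies. *)
Lemma sum_decoupled_le (r B : R) (S : seq iV) : 0 < r ->
  (forall z, \sum_(m <- S) covariogram (ellipsoid A r) (ivec m + z) <= B) ->
  \sum_(m <- S) decoupled P A r (X 0) (X m) (ivec m) <= B.
Proof.
move=> r0 hB.
have mE : measurable (ellipsoid A r) by exact: measurable_ellipsoid.
have fE : (LV d (ellipsoid A r) < +oo)%E by apply: LV_ellipsoid_lty => //; exact: ltW.
pose G (m : iV) (z : T * T) : R := covariogram (ellipsoid A r) (ivec m + X 0 z.2 - X 0 z.1).
have mG m : measurable_fun setT (G m).
  apply: (measurableT_comp (measurable_covariogram mE)); apply: measurable_borelVD.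
    by apply: measurable_borelVD; [exact: mcst|exact: (measurableT_comp (mX 0) measurable_snd)].
  by apply: measurable_borelVN; exact: (measurableT_comp (mX 0) measurable_fst).
have bG m w : bounded_mfun (fun w' => G m (w, w')).
  apply: (bounded_covariogram uA r0 (Z := fun w' => ivec m + X 0 w' - X 0 w)).
  by apply: measurable_borelVD; [apply: measurable_borelVD; [exact: mcst|]|exact: mcst].
have bD m : bounded_mfun (fun w => Ex (fun w' => G m (w, w'))).
  split; first by apply: (@measurable_Rintegral_param _ _ T T R P (G m)).
  exists (fine (LV d (ellipsoid A r))) => w; apply: Ex_norm_le => // w'.
  exact: covariogram_le.
have decE m : decoupled P A r (X 0) (X m) (ivec m) = Ex (fun w => Ex (fun w' => G m (w, w'))).
  have h w : (\int[P]_w' (covariogram (ellipsoid A r) (ivec m + X m w' - X 0 w))%:E =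
      \int[P]_w' (covariogram (ellipsoid A r) (ivec m + X 0 w' - X 0 w))%:E)%E.
    pose f (y : bV) : \bar R := (covariogram (ellipsoid A r) (ivec m + (y : rV) - X 0 w))%:E.
    have mf : measurable_fun setT f.
      apply/measurable_EFinP; apply: (measurableT_comp (measurable_covariogram mE)).
      apply: measurable_borelVD; last exact: mcst.
      by apply: measurable_borelVD; [exact: mcst|exact: measurable_id].
    have f0 y : (0 <= f y)%E by rewrite lee_fin covariogram_ge0.
    exact: (@ge0_integral_same_law _ _ _ P _ bV (X m) (X 0) f (mX m) (mX 0) (@marginal m) mf f0).
  refine (congr1 (fun f : T -> R => Ex f) _); apply/funext => w.
  refine (congr1 fine (h w)).
under eq_bigr do rewrite decE.
have [_ <-] := @Rintegral_sum_seq _ _ _ P iV S (fun m w => Ex (fun w' => G m (w, w')))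
  (fun m => bounded_mfun_integrable P (bD m)).
have GE w : \sum_(m <- S) Ex (fun w' => G m (w, w')) = Ex (fun w' => \sum_(m <- S) G m (w, w')).
  exact: (esym (@Rintegral_sum_seq _ _ _ P iV S (fun m w' => G m (w, w'))
    (fun m => bounded_mfun_integrable P (bG m w))).2).
have G0 z : 0 <= \sum_(m <- S) G m z by apply: sumr_ge0 => m _; exact: covariogram_ge0.
have GB z : \sum_(m <- S) G m z <= B.
  by apply: le_trans (hB (X 0 z.2 - X 0 z.1)); apply: ler_sum => m _; rewrite /G addrA.
have mS : measurable_fun setT (fun z => \sum_(m <- S) G m z) by exact: measurable_sum.
have b1 w : bounded_mfun (fun w' => \sum_(m <- S) G m (w, w')).
  split; first by apply: measurable_sum => m; have [] := bG m w.
  by exists B => w'; rewrite ger0_norm.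
apply: (le_trans (ler_norm _)); apply: Ex_norm_le.
  split.
    under eq_fun do rewrite GE.
    exact: (@measurable_Rintegral_param _ _ T T R P (fun z => \sum_(m <- S) G m z)).
  by exists B => w; rewrite GE; apply: Ex_norm_le => // w'; rewrite ger0_norm.
by move=> w; rewrite GE; apply: Ex_norm_le => // w'; rewrite ger0_norm.
Qed.

Lemma variance_bound : exists C : R, forall r, 0 < r ->
  (evariance P (counting X V (ellipsoid A r)) <= (C * r `^ (d%:R - kap))%:E)%E.
Proof.
have [Cp Cp0 poisson] := ellipsoid_poisson uA kap_gt0 kap_le1.
(* The parameters with which [freq_weight] is at most W |xi|^th. *)
pose th := Q * a2 * 2; pose W := mm `^ th.
have W0 : 0 <= W by exact: powR_ge0.
have [Cw Cw0 weight] := ellipsoid_weight uA kap_gt0 kap_le1 kapQ W0.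
pose K := 64 * geom_const (Q * a2) ^+ 2.
have K0 : 0 <= K by rewrite mulr_ge0 // sqr_ge0.
(* Cp is the error of the Poisson bound; the other term is the decoupling error summed over m. *)
exists (Cp + K * Sal * Cw) => r r0; set rho := r `^ _.
have rho0 : 0 <= rho by exact: powR_ge0.
set E := ellipsoid A r.
have mE : measurable E by exact: measurable_ellipsoid.
have fE : (LV d E < +oo)%E by apply: LV_ellipsoid_lty => //; exact: ltW.
have Efin : LV d E \is a fin_num by rewrite ge0_fin_numE ?measure_ge0.
have hw : (\int[LV d]_x (fourier E x ^+ 2 * freq_weight a2 Q mm x)%:E <= (Cw * rho)%:E)%E.
  have Q0 : 0 <= Q * a2 by rewrite mulr_ge0 // ltW.
  apply: weight => //.
  - apply: measurable_funX; apply: measurable_minr; first exact: measurable_cst.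
    apply: (measurableT_comp (measurable_powR _)); apply: measurable_funM; last exact: measurable_cst.
    exact: measurable_enorm.
  - move=> x; rewrite /freq_weight sqr_ge0 /= expr_le1 // ?ge_min ?lexx // le_min ler01 powR_ge0 //.
  - move=> x; rewrite /freq_weight.
    apply: (@le_trans _ _ (((enorm x * mm) `^ (Q * a2)) ^+ 2)).
      by rewrite lerXn2r ?nnegrE ?le_min ?ler01 ?powR_ge0 // ge_min lexx orbT.
    by rewrite -powR_mulrn ?powR_ge0 // -powRrM powRM ?enorm_ge0 // mulrC.
have key (S : seq iV) : uniq S ->
    \sum_(m <- S) coupled P A r (X 0) (X m) (ivec m) <=
      fine (LV d E) ^+ 2 + Cp * rho + K * Sal * Cw * rho.
  move=> uS.
  apply: (@le_trans _ _ (\sum_(m <- S) (decoupled P A r (X 0) (X m) (ivec m) + K * al m `^ a1 * (Cw * rho)))).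
    apply: ler_sum => m _.
    apply: (coupled_sub_decoupled uA r0 (ivec m) (mX 0) (mX m) a1_gt0 a2_gt0 a12 Q_gt0 Qa2 mm_ge0) => //.
    - by move=> B C; exact: mix.
    - by move=> t; exact: tailm.
    - exact: mulr_ge0.
  rewrite big_split /=; apply: lerD.
    by apply: sum_decoupled_le => // z; exact: poisson.
  rewrite -mulr_suml -mulr_sumr -[leRHS]mulrA ler_wpM2r ?mulr_ge0 // ler_wpM2l //.
  exact: al_sum.
have N2 : (\int[P]_w (counting X V E w * counting X V E w) <=
    (fine (LV d E) ^+ 2 + Cp * rho + K * Sal * Cw * rho)%:E)%E.
  rewrite (integral_counting2 mX mV X_stat XV_indep V_unif mE fE).
  apply: esum_le_finite => S uS.
  rewrite (_ : (\sum_(k <- S) _)%E = (\sum_(m <- S) coupled P A r (X 0) (X m) (ivec m))%:E).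
    by rewrite lee_fin key.
  rewrite -sumEFin; apply: eq_bigr => m _; rewrite EFin_Rintegral //.
  apply: bounded_mfun_integrable; apply: (bounded_covariogram uA r0).
  by apply: measurable_borelVD; [apply: measurable_borelVD; [exact: mcst|]|exact: measurable_borelVN].
apply: (le_trans (evariance_counting mX mV X_stat XV_indep V_unif mE fE N2)).
rewrite -(fineK Efin) -EFin_expe -EFinB lee_fin le_eqVlt; apply/orP; left; apply/eqP.
by rewrite /=; ring.
Qed.

End variance_bound.

(** * Lattice coordinates and moments *)

Section generated_sigma_field.
Context {R : realType} {d : nat} {T : pointedType} {I : Type}.
Local Notation bV := (borelV R d).

(** Give T the generated sigma-field itself: each X k with k in C is then measurable, hence so is
    the pair. Events about a single site are obtained with i = j and B a preimage under [fst]. *)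
Lemma sigma_gen_pair (C : set I) (X : I -> T -> 'rV[R]_d) (i j : I) (M : 'M[R]_d) (B : set (bV * bV)) :
  C i -> C j -> measurable B -> sigma_gen C X [set w | B (X i w *m M, X j w *m M)].
Proof.
move=> Ci Cj mB; pose G := \bigcup_(i in C) preimage_set_system setT (X i) (borel R d).
have mX k : C k -> measurable_fun setT (X k : g_sigma_algebraType G -> bV).
  move=> Ck _ Y mY; apply: sub_sigma_algebra; exists k => //; exists Y => //.
have mXM k : C k -> measurable_fun setT ((fun w => X k w *m M) : g_sigma_algebraType G -> bV).
  by move=> Ck; apply: measurable_borelVM; exact: mX.
have mp : measurable_fun setT ((fun w => (X i w *m M, X j w *m M)) : g_sigma_algebraType G -> bV * bV).
  by apply: measurable_fun_pair; exact: mXM.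
by have := mp measurableT B mB; rewrite setTI.
Qed.

End generated_sigma_field.

Section lattice_coordinates.
Context {R : realType} {d : nat} (a : d.-tuple 'rV[R]_d).
Hypothesis a_basis : basis_of fullv a.
Local Notation bV := (borelV R d).

Definition basis_mx : 'M[R]_d := \matrix_(i < d) tnth a i.

Lemma mulmx_basis_mx (x : 'rV[R]_d) : x *m basis_mx = \sum_(j < d) x 0 j *: tnth a j.
Proof. by rewrite mulmx_sum_row; apply: eq_bigr => j _; rewrite rowK. Qed.

Lemma basis_mx_unit : basis_mx \in unitmx.
Proof.
rewrite -row_free_unit; apply: inj_row_free => v; rewrite mulmx_basis_mx => v0.
have /freeP fr := basis_free a_basis.
apply/rowP => j; rewrite mxE; apply: (fr (fun j => v 0 j)).
by rewrite -[RHS]v0; apply: eq_bigr => k _; rewrite (tnth_nth 0).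
Qed.

Definition site (k : 'rV[int]_d) : 'rV[R]_d := ivec k *m basis_mx.

Lemma site0 : site 0 = 0.
Proof. by rewrite /site /ivec map_mx0 mul0mx. Qed.

Lemma siteD k l : site (k + l) = site k + site l.
Proof. by rewrite /site ivecD mulmxDl. Qed.

Lemma lattice_site k : lattice a (site k).
Proof. by exists (fun j => k 0 j); rewrite /site mulmx_basis_mx; apply: eq_bigr => j _; rewrite ivecE. Qed.

Lemma site_bij : set_bij [set: 'rV[int]_d] (lattice a) site.
Proof.
split; first by move=> k _; exact: lattice_site.
  move=> k l _ _ /(congr1 (fun x => x *m invmx basis_mx)).
  rewrite /site !mulmxK ?basis_mx_unit // => /rowP h; apply/rowP => j.
  by have := h j; rewrite !ivecE => /intr_inj.
move=> x [k ->]; exists (\row_j k j) => //.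
by rewrite /site mulmx_basis_mx; apply: eq_bigr => j _; rewrite ivecE mxE.
Qed.

Lemma fundamental_domainE : fundamental_domain a = [set x : 'rV[R]_d | unit_cube (x *m invmx basis_mx)].
Proof.
have u := basis_mx_unit.
apply/seteqP; split => x /=.
  move=> [t [t01 ->]].
  have -> : \sum_(j < d) t j *: tnth a j = (\row_j t j) *m basis_mx.
    by rewrite mulmx_basis_mx; apply: eq_bigr => j _; rewrite mxE.
  by rewrite mulmxK //; apply/unit_cubeP => j; rewrite mxE.
move=> /unit_cubeP h; exists (fun j => (x *m invmx basis_mx) 0 j); split => //.
by rewrite -mulmx_basis_mx mulmxKV.
Qed.

Lemma LV_unit_cube : LV d unit_cube = 1%E :> \bar R.
Proof.
rewrite LV_box //; have -> : (@lebesgue_measure R `[0, 1[%classic) = 1%E.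
  by rewrite lebesgue_measure_itv /= lte_fin ltr01 oppr0 adde0.
by elim: d => [|n IH]; rewrite ?expe0 // expeS IH mule1.
Qed.

(** In the new coordinates the fundamental domain is the unit cube, and the constant of the linear
    change cancels in the quotient of volumes. *)
Lemma uniform_coordinates {disp} {T : measurableType disp} (P : probability T R) (U : T -> 'rV[R]_d) :
  uniform_on P (fundamental_domain a) U ->
  forall C : set bV, measurable C ->
  P ((fun w => U w *m invmx basis_mx) @^-1` C) = LV d (C `&` unit_cube).
Proof.
move=> hU C mC.
have ui : invmx basis_mx \in unitmx by rewrite unitmx_inv basis_mx_unit.
have [c c0 cE] := LV_mulmx ui.
have mC' := measurable_preimage_mulmx (invmx basis_mx) mC.
have mQ := @measurable_unit_cube R d.
have Qfin : LV d (C `&` unit_cube) \is a fin_num.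
  rewrite ge0_fin_numE ?measure_ge0 //; apply: (@le_lt_trans _ _ (LV d unit_cube)).
    by apply: le_measure; rewrite ?inE //; exact: measurableI.
  by rewrite LV_unit_cube ltry.
have := hU _ mC'; rewrite -LVE fundamental_domainE.
have -> : [set y : bV | C ((y : 'rV[R]_d) *m invmx basis_mx)] `&`
    [set x : 'rV[R]_d | unit_cube (x *m invmx basis_mx)] =
    [set y : bV | (C `&` unit_cube) ((y : 'rV[R]_d) *m invmx basis_mx)] by [].
rewrite (cE _ (measurableI _ _ mC mQ)) (cE _ mQ) LV_unit_cube mule1 => e.
transitivity (c%:E * LV d (C `&` unit_cube) / c%:E)%E; first exact: e.
rewrite -(fineK Qfin) -EFinM inver gt_eqF // -EFinM mulrAC mulfV ?mul1r // gt_eqF //.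
Qed.

End lattice_coordinates.

Section asymptotics.
Context {R : realType}.

Lemma powR_cvg0_pinfty (C k : R) : 0 < k -> (fun r : R => C * r `^ (- k)) @ +oo --> 0.
Proof.
move=> k0; apply/cvgrPdist_le => e e0.
pose del := e / (`|C| + 1).
have C1 : 0 < `|C| + 1 by rewrite ltr_wpDl.
have del0 : 0 < del by rewrite divr_gt0.
near=> r.
have r1 : del `^ (- k^-1) <= r by near: r; exact: nbhs_pinfty_ge.
have r0 : 0 < r by apply: lt_le_trans r1; exact: powR_gt0.
have h : r `^ (- k) <= del.
  rewrite powRN -[leRHS]invrK lef_pV2 ?posrE ?powR_gt0 ?invr_gt0 //.
  have -> : del^-1 = (del `^ (- k^-1)) `^ k.
    by rewrite -powRrM mulNr mulVf ?gt_eqF // powR_inv1 // ltW.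
  by apply: ge0_ler_powR; rewrite ?nnegrE ?powR_ge0 // ltW.
rewrite sub0r normrN normrM (ger0_norm (powR_ge0 _ _)).
apply: (@le_trans _ _ ((`|C| + 1) * del)); last by rewrite mulrC divfK ?gt_eqF.
by apply: ler_pM; rewrite ?powR_ge0 // lerDl.
Unshelve. all: by end_near.
Qed.

End asymptotics.

(** * Moments and tails *)

Section moments.
Context {disp} {T : measurableType disp} {R : realType} (P : probability T R) {n : nat}.
Local Notation d := n.+1.
Local Notation bV := (borelV R d).

Lemma markov_tail (Y Z : T -> R) (c Q : R) : measurable_fun setT Y -> measurable_fun setT Z ->
  (forall w, 0 <= Y w) -> 0 < c -> 0 < Q -> (forall w, Z w <= c * Y w) ->
  (\int[P]_w (Y w `^ Q)%:E < +oo)%E ->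
  exists2 m : R, 0 <= m & forall t, 0 < t -> fine (P [set w | t <= Z w]) <= (m / t) `^ Q.
Proof.
move=> mY mZ Y0 c0 Q0 ZY fin.
have pos : (0 <= \int[P]_w (Y w `^ Q)%:E)%E by apply: integral_ge0 => w _; rewrite lee_fin powR_ge0.
pose M := fine (\int[P]_w (Y w `^ Q)%:E)%E.
have M0 : 0 <= M by exact: fine_ge0.
have ME : (\int[P]_w (Y w `^ Q)%:E = M%:E)%E by rewrite fineK // ge0_fin_numE.
(* Chosen so that (m / t)^Q is the moment M divided by (t / c)^Q, which is Markov's inequality for
   Y^Q. *)
exists (c * M `^ Q^-1); first by rewrite mulr_ge0 ?powR_ge0 // ltW.
move=> t t0; have tc : 0 < t / c by rewrite divr_gt0.
have mS : measurable [set w | t <= Z w].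
  rewrite (_ : mkset _ = Z @^-1` `[t, +oo[).
    by rewrite -[X in measurable X]setTI; apply: mZ.
  by apply/seteqP; split => w /=; rewrite in_itv /= andbT.
have -> : (c * M `^ Q^-1 / t) `^ Q = M / (t / c) `^ Q.
  have -> : c * M `^ Q^-1 / t = M `^ Q^-1 * (t / c)^-1 by rewrite invf_div; field; rewrite gt_eqF.
  rewrite powRM ?powR_ge0 ?invr_ge0 ?(ltW tc) // -powRrM mulVf ?gt_eqF // powRr1 //.
  by rewrite -powRN -[(t / c)^-1]powR_inv1 ?(ltW tc) // -powRrM mulN1r.
rewrite ler_pdivlMr ?powR_gt0 // mulrC -lee_fin EFinM fineK ?fin_num_measure // -ME.
have mp : measurable_fun setT (fun w => (Y w `^ Q)%:E).
  by apply/measurable_EFinP; exact: (measurableT_comp (measurable_powR Q) mY).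
set S := [set w | t <= Z w] in mS *.
have -> : (((t / c) `^ Q)%:E * P S = \int[P]_w (((t / c) `^ Q)%:E * (\1_S w)%:E))%E.
  rewrite ge0_integralZl ?lee_fin ?powR_ge0 //.
  - by rewrite integral_indic // setIT.
  - by apply/measurable_EFinP; exact: measurable_indic.
apply: ge0_le_integral => //.
- by move=> w _; rewrite -EFinM lee_fin mulr_ge0 ?powR_ge0 // indicE.
- by apply: measurable_funeM; apply/measurable_EFinP; exact: measurable_indic.
- move=> w _; rewrite -EFinM lee_fin indicE; case: (boolP (w \in _)) => [|_]; last by rewrite mulr0 powR_ge0.
  rewrite inE /= mulr1 => tZ; apply: ge0_ler_powR; rewrite ?nnegrE ?(ltW tc) ?Y0 ?(ltW Q0) //.
  by rewrite ler_pdivrMr // mulrC; exact: le_trans tZ (ZY w).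
Qed.

(** Pointwise Y^q1 <= 1 + Y^q2, and P has finite mass. *)
Lemma moment_le (Y : T -> R) (q1 q2 : R) : measurable_fun setT Y -> (forall w, 0 <= Y w) ->
  0 <= q1 <= q2 -> (\int[P]_w (Y w `^ q2)%:E < +oo)%E -> (\int[P]_w (Y w `^ q1)%:E < +oo)%E.
Proof.
move=> mY Y0 /andP[q10 q12] fin.
have mp q : measurable_fun setT (fun w => (Y w `^ q)%:E).
  by apply/measurable_EFinP; exact: (measurableT_comp (measurable_powR q) mY).
apply: (@le_lt_trans _ _ (\int[P]_w (1%:E + (Y w `^ q2)%:E))%E).
  apply: ge0_le_integral => //.
  - by move=> w _; rewrite lee_fin powR_ge0.
  - by apply: emeasurable_funD => //; exact: measurable_cst.
  - move=> w _; rewrite -EFinD lee_fin; have [w1|w1] := leP 1 (Y w).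
      by apply: (@le_trans _ _ (Y w `^ q2)); [exact: ler_powR|rewrite lerDr].
    apply: (@le_trans _ _ 1); last by rewrite lerDl powR_ge0.
    have -> : 1 = 1 `^ q1 :> R by rewrite powR1.
    by apply: ge0_ler_powR; rewrite ?nnegrE ?Y0 // ltW.
rewrite ge0_integralD //.
  rewrite lte_add_pinfty // integral_cst // mul1e.
  by have := congr1 (fun z => z < +oo)%E (probability_setT P); rewrite ltry; exact: (fun h => eq_ind_r is_true isT h).
by move=> w _; rewrite lee_fin powR_ge0.
Qed.

End moments.

(** * The perturbed lattice in lattice coordinates *)

Section perturbed_lattice_variance.
Context {R : realType} {n : nat} {disp : measure_display} {T : measurableType disp} (P : probability T R).
Local Notation d := n.+1.
Local Notation bV := (borelV R d).
Local Notation rV := 'rV[R]_d.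
Local Notation iV := 'rV[int]_d.
Variables (a : d.-tuple rV) (p : rV -> T -> rV) (U : T -> rV) (s q : R).
Hypothesis a_basis : basis_of fullv a.
Hypothesis p_meas : forall i, lattice a i -> random_vector (p i).
Hypothesis p_stat : strictly_stationary P (lattice a) p.
Hypothesis U_meas : random_vector U.
Hypothesis U_unif : uniform_on P (fundamental_domain a) U.
Hypothesis U_indep : independent P (sigma_gen setT (fun _ : unit => U)) (sigma_gen (lattice a) p).
Hypotheses (s_gt0 : 0 < s) (q_ge1 : 1 <= q) (sq : 1 / s + 1 / q = 1).
Hypothesis p_mixing :
  (\esum_(i in lattice a) alpha11 P (lattice a) p (enorm i) `^ (1 / s)%R < +oo)%E.

Let A := basis_mx a.
Let uA : A \in unitmx. Proof. exact: basis_mx_unit. Qed.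
Let X (k : iV) (w : T) : rV := p (site a k) w *m invmx A.
Let V (w : T) : rV := U w *m invmx A.

Let mX k : measurable_fun setT (X k : T -> bV).
Proof. by apply: measurable_borelVM; apply: p_meas; exact: lattice_site. Qed.

Let mV : measurable_fun setT (V : T -> bV).
Proof. exact: measurable_borelVM. Qed.

Let X_stat (k m : iV) (B : set (bV * bV)) : measurable B ->
  P [set w | B (X k w, X (k + m) w)] = P [set w | B (X 0 w, X m w)].
Proof.
move=> mB; pose Lam : set rV := [set x | x = site a 0 \/ x = site a m].
have LL : Lam `<=` lattice a by move=> x [->|->]; exact: lattice_site.
have sg := @sigma_gen_pair R d (rV -> rV) rV Lam (fun i f => f i) (site a 0) (site a m) (invmx A) B
  (or_introl erefl) (or_intror erefl) mB.
have := p_stat LL (lattice_site a k) sg; rewrite /= -!siteD add0r => e.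
by apply: etrans (esym e); congr (P _); apply/seteqP; split => w /=; rewrite /X addrC.
Qed.

Let XV_indep (k l : iV) (B : set (bV * bV)) (C : set bV) : measurable B -> measurable C ->
  P ([set w | B (X k w, X l w)] `&` V @^-1` C) = (P [set w | B (X k w, X l w)] * P (V @^-1` C))%E.
Proof.
move=> mB mC; rewrite setIC muleC; apply: U_indep; last first.
  by apply: (sigma_gen_pair (invmx A)) => //; exact: lattice_site.
have mC2 : measurable (fst @^-1` C : set (bV * bV)).
  by rewrite -[X in measurable X]setTI; exact: measurable_fst.
exact: (@sigma_gen_pair R d T unit setT (fun _ : unit => U) tt tt (invmx A) _ I I mC2).
Qed.

Let V_unif (C : set bV) : measurable C -> P (V @^-1` C) = LV d (C `&` unit_cube).
Proof. exact: uniform_coordinates. Qed.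

Let alpha_ k : \bar R := alpha11 P (lattice a) p (enorm (site a k)).

Let mix_le (k : iV) (B C : set bV) : measurable B -> measurable C ->
  (`|P (X 0%R @^-1` B `&` X k @^-1` C) - P (X 0%R @^-1` B) * P (X k @^-1` C)| <= alpha_ k)%E.
Proof.
move=> mB mC.
(* The singletons of the sites 0 and k are admissible in [alpha11] at distance |k A|, the norm of
   the site k. *)
pose S0 : set rV := [set site a 0]; pose Sk : set rV := [set site a k].
have sg (S : set rV) l (D : set bV) : S (site a l) -> measurable D -> sigma_gen S p (X l @^-1` D).
  move=> Sl mD.
  have mD2 : measurable (fst @^-1` D : set (bV * bV)).
    by rewrite -[X in measurable X]setTI; exact: measurable_fst.
  exact: (sigma_gen_pair (invmx A) Sl Sl mD2).
apply: (@le_trans _ _ (alpha P (sigma_gen S0 p) (sigma_gen Sk p))).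
  by apply: ereal_sup_ubound; exists (X 0 @^-1` B); [exact: sg|exists (X k @^-1` C); [exact: sg|]].
apply: ereal_sup_ubound; exists S0, Sk; split.
- by move=> x ->; exact: lattice_site.
- by move=> x ->; exact: lattice_site.
- by have := @card_set1 _ (site a 0); rewrite card_eq_le => /andP[].
- by have := @card_set1 _ (site a k); rewrite card_eq_le => /andP[].
- split => //; apply: le_ereal_inf_tmp => _ [i -> [j -> <-]].
  by rewrite site0 sub0r enormN.
Qed.

Let alpha_ge0 k : (0 <= alpha_ k)%E.
Proof.
by apply: le_trans (mix_le k measurableT measurableT); exact: abse_ge0.
Qed.

Let is_gt0 : 0 < 1 / s. Proof. by rewrite div1r invr_gt0. Qed.

Let esum_alpha : (\esum_(i in lattice a) alpha11 P (lattice a) p (enorm i) `^ (1 / s)%R =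
  \esum_(k in [set: iV]) alpha_ k `^ (1 / s)%R)%E.
Proof. exact: (reindex_esum _ _ _ _ (site_bij a_basis)). Qed.

(** Each term is at most the convergent sum, and (+oo)^(1/s) = +oo. *)
Let alpha_fin k : alpha_ k \is a fin_num.
Proof.
rewrite ge0_fin_numE // ltey; apply/negP => /eqP e.
have h : (alpha_ k `^ (1 / s)%R <= \esum_(k in [set: iV]) alpha_ k `^ (1 / s)%R)%E.
  have := @sum_le_esum iV R (fun k => alpha_ k `^ (1 / s)%R)%E [:: k] isT.
  by rewrite big_seq1.
by have := le_lt_trans h; rewrite -esum_alpha e poweRyr ?gt_eqF // => /(_ _ p_mixing); rewrite ltxx.
Qed.

Let al k : R := fine (alpha_ k).

Let mix (m : iV) (B C : set bV) : measurable B -> measurable C ->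
  `|fine (P (X 0 @^-1` B `&` X m @^-1` C)) - fine (P (X 0 @^-1` B)) * fine (P (X m @^-1` C))| <= al m.
Proof.
move=> mB mC.
have mp k (D : set bV) : measurable D -> measurable (X k @^-1` D).
  by move=> mD; rewrite -[X in measurable X]setTI; exact: mX.
have f0 := fin_num_measure P _ (mp 0 B mB); have fm := fin_num_measure P _ (mp m C mC).
have fi := fin_num_measure P _ (measurableI _ _ (mp 0 B mB) (mp m C mC)).
have := mix_le m mB mC; rewrite -(fineK (alpha_fin m)) -(fineK f0) -(fineK fm) -(fineK fi).
by rewrite -EFinM -EFinB abse_EFin lee_fin.
Qed.

Let al_sum : exists Sal : R, forall S : seq iV, uniq S -> \sum_(m <- S) al m `^ (1 / s) <= Sal.
Proof.
have p0 k : (0 <= alpha_ k `^ (1 / s)%R)%E by exact: poweR_ge0.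
have fin : (\esum_(k in [set: iV]) alpha_ k `^ (1 / s)%R)%E \is a fin_num.
  by rewrite ge0_fin_numE -?esum_alpha //; apply: esum_ge0 => i _; exact: poweR_ge0.
exists (fine (\esum_(k in [set: iV]) alpha_ k `^ (1 / s)%R)%E) => S uS.
rewrite -lee_fin fineK // -sumEFin; apply: le_trans (sum_le_esum _ uS).
by apply: lee_sum => k _; rewrite -poweR_EFin fineK.
Qed.

Lemma counting_perturbed_lattice r w :
  perturbed_lattice (lattice a) p U w (eball r) = counting X V (ellipsoid A r) w.
Proof.
rewrite /perturbed_lattice /counting.
apply: (etrans (reindex_esum _ _ _ _ (site_bij a_basis))); apply: eq_esum => k _.
rewrite diracE indicE; congr ((nat_of_bool _)%:R%:E).
have e : (ivec k + X k w + V w) *m A = site a k + p (site a k) w + U w.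
  by rewrite !mulmxDl /X /V !mulmxKV.
by apply/idP/idP; rewrite !inE /ellipsoid /= e.
Qed.

Lemma perturbed_lattice_variance (kap th : R) : 0 < kap <= 1 -> kap < th < 2 ->
  ('E_P[fun w => (enorm (p 0 w) `^ (th * q))%R] < +oo)%E ->
  exists C : R, forall r, 0 < r ->
  (0 <= reduced_variance P (perturbed_lattice (lattice a) p U) r <= (C * r `^ (- kap))%:E)%E.
Proof.
move=> /andP[k0 k1] /andP[kt t2] mom.
have q0 : 0 < q by exact: lt_le_trans q_ge1.
have th0 : 0 < th by exact: lt_trans kt.
have Q0 : 0 < th * q by exact: mulr_gt0.
(* The share of each tail in the interpolation, completing 1/s to 1. With tails of order Q = th q
   this gives Q a2 = th/2 < 1 for the geometric series, and the frequency weight has order 2 Q a2 =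
   th > kap. *)
pose a2 := 1 / (2 * q).
have a20 : 0 < a2 by rewrite /a2 div1r invr_gt0 mulr_gt0.
have q_neq0 : q != 0 by rewrite gt_eqF.
have a12 : 1 / s + (a2 + a2) = 1 by rewrite -[RHS]sq; congr (_ + _); rewrite /a2; field.
have Qa : th * q * a2 = th / 2 by rewrite /a2; field.
have Qa2 : th * q * a2 < 1 by rewrite Qa; lra.
have kQ : kap < th * q * a2 * 2 by rewrite Qa divfK.
have p0m : measurable_fun setT (fun w => enorm (p 0 w)).
  apply: (measurableT_comp (@measurable_enorm R d)).
  by have := p_meas (lattice_site a 0); rewrite site0.
(* A bound for the operator norm of the inverse of A, made positive by the summand 1; it transfers
   the tail of p_0 to X_0. *)
pose c := d%:R * mx_abs_sum (invmx A) + 1.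
have c0 : 0 < c by rewrite ltr_wpDl // mulr_ge0 // mx_abs_sum_ge0.
have X0c w : enorm (X 0 w) <= c * enorm (p 0 w).
  rewrite /X site0; apply: (@le_trans _ _ (d%:R * (enorm (p 0 w) * mx_abs_sum (invmx A)))).
    by apply: enorm_le_box => j; apply: mulmx_coord_le => i; exact: coord_le_enorm.
  by rewrite [enorm _ * _]mulrC mulrA ler_wpM2r ?enorm_ge0 // lerDl.
have mX0 : measurable_fun setT (fun w => enorm (X 0 w)).
  exact: (measurableT_comp (@measurable_enorm R d) (mX 0)).
have mom' : (\int[P]_w (enorm (p 0 w) `^ (th * q))%:E < +oo)%E.
  by move: mom; rewrite unlock.
have [mm mm0 tail] := markov_tail p0m mX0 (fun w => enorm_ge0 _) c0 Q0 X0c mom'.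
have [Sal hS] := al_sum.
have [C hC] := variance_bound mX mV X_stat XV_indep V_unif uA k0 k1 is_gt0 a20 a12 Q0 Qa2 mm0 kQ mix hS tail.
pose ub := @unit_ball_volume R d; have ub0 : 0 < ub by exact: unit_ball_volume_gt0.
exists (C / ub) => r r0.
have fe : (fun w => perturbed_lattice (lattice a) p U w (eball r)) = counting X V (ellipsoid A r).
  by apply/funext => w; exact: counting_perturbed_lattice.
rewrite /reduced_variance fe -LVE LV_eball // -/ub.
have v0 : 0 < ub * r ^+ d by rewrite mulr_gt0 // exprn_gt0.
rewrite inver gt_eqF //; apply/andP; split.
  rewrite mule_ge0 ?lee_fin ?invr_ge0 ?(ltW v0) //.
  by apply: integral_ge0 => w _; exact: sqre_ge0.
apply: (@le_trans _ _ ((C * r `^ (d%:R - kap))%:E * ((ub * r ^+ d)^-1)%:E)%E).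
  by rewrite lee_wpmul2r ?lee_fin ?invr_ge0 ?(ltW v0) // hC.
rewrite -EFinM lee_fin le_eqVlt; apply/orP; left; apply/eqP.
have -> : r `^ (d%:R - kap) = r ^+ d * r `^ (- kap).
  by rewrite -powR_mulrn ?(ltW r0) // -powRD // (gt_eqF r0) implybT.
have rd : r ^+ d != 0 by rewrite expf_neq0 // gt_eqF.
by have ub1 : ub != 0 by [rewrite gt_eqF]; field; rewrite ub1.
Qed.

End perturbed_lattice_variance.

Theorem theorem1 (R : realType) (d : nat) (d_ge1 : (1 <= d)%N)
  (disp : measure_display) (T : measurableType disp) (P : probability T R)
  (a : d.-tuple 'rV[R]_d) (a_basis : basis_of fullv a)
  (p : 'rV[R]_d -> T -> 'rV[R]_d)
  (p_meas : forall i, lattice a i -> random_vector (p i))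
  (p_stat : strictly_stationary P (lattice a) p)
  (U : T -> 'rV[R]_d) (U_meas : random_vector U)
  (U_unif : uniform_on P (fundamental_domain a) U)
  (U_indep : independent P (sigma_gen setT (fun _ : unit => U))
                           (sigma_gen (lattice a) p))
  (s q : R) (s_gt0 : 0 < s) (q_ged : d%:R <= q) (sq : 1 / s + 1 / q = 1)
  (p_moment : ('E_P[fun w => (enorm (p 0 w) `^ q)%R] < +oo)%E)
  (p_mixing :
    (\esum_(i in lattice a) alpha11 P (lattice a) p (enorm i) `^ (1 / s)%R
       < +oo)%E) :
  hyperuniform P (perturbed_lattice (lattice a) p U) /\
  (symmetric_law P (p 0) ->
   ('E_P[fun w => (enorm (p 0 w) `^ (2 * q))%R] < +oo)%E ->
   classI_hyperuniform P (perturbed_lattice (lattice a) p U)).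
Proof.
case: d d_ge1 a a_basis p p_meas p_stat U U_meas U_unif U_indep q_ged p_moment p_mixing => [//|n] _
  a a_basis p p_meas p_stat U U_meas U_unif U_indep q_ged p_moment p_mixing.
have q1 : 1 <= q by apply: le_trans q_ged; rewrite ler1n.
have main := perturbed_lattice_variance a_basis p_meas p_stat U_meas U_unif U_indep s_gt0 q1 sq p_mixing.
split.
  have k1 : 0 < (1 / 2 : R) <= 1 by apply/andP; split; lra.
  have t1 : 1 / 2 < (1 : R) < 2 by apply/andP; split; lra.
  have mom : ('E_P[fun w => (enorm (p 0 w) `^ (1 * q))%R] < +oo)%E by rewrite mul1r.
  have [C hC] := main (1 / 2) 1 k1 t1 mom; rewrite /hyperuniform.
  apply: (@squeeze_cvge _ _ _ _ (fun=> 0%E) _ (fun r => (C * r `^ (- (1 / 2)))%:E)).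
  - near=> r; apply: hC; near: r; exact: nbhs_pinfty_gt.
  - exact: cvg_cst.
  - by apply: cvg_EFin; [exact: nearW|apply: powR_cvg0_pinfty; lra].
move=> _ mom2.
have p0m : measurable_fun setT (fun w => enorm (p 0 w)).
  apply: (measurableT_comp (@measurable_enorm R n.+1)).
  by have := p_meas _ (lattice_site a 0); rewrite site0.
have mom : ('E_P[fun w => (enorm (p 0 w) `^ (3 / 2 * q))%R] < +oo)%E.
  move: mom2; rewrite unlock => h.
  apply: (moment_le p0m (fun w => enorm_ge0 _) _ h).
  by apply/andP; split; nra.
have k1 : 0 < (1 : R) <= 1 by apply/andP; split; lra.
have t1 : 1 < (3 / 2 : R) < 2 by apply/andP; split; lra.
have [C hC] := main 1 (3 / 2) k1 t1 mom.
exists C; near=> r.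
have r0 : 0 < r by near: r; exact: nbhs_pinfty_gt.
by have /andP[_] := hC r r0; rewrite powR_inv1 // ltW.
Unshelve. all: by end_near.
Qed.
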